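(* Let $f=(f_1,\dots,f_n)$ be an $n$-tuple of formal power series in the class $\mathcal M^b$ and let $(M_{Z_1},\dots,M_{Z_n})$ be the universal model associated with the noncommutative domain $\mathbb B_f$. Let $\mathcal E,\mathcal E_*$ be Hilbert spaces, let $\Theta:\mathbb H^2(f)\otimes\mathcal E_*\to\mathbb H^2(f)\otimes\mathcal E$ be a contractive multi-analytic operator, and set $\Delta_\Theta:=(I-\Theta^*\Theta)^{1/2}$. Then the $n$-tuple $\mathbf T=(\mathbf T_1,\dots,\mathbf T_n)$ defined on the Hilbert space $$\mathbf H:=\Big[(\mathbb H^2(f)\otimes\mathcal E)\oplus\overline{\Delta_\Theta(\mathbb H^2(f)\otimes\mathcal E_* )}\Big]\ominus\{\Theta y\oplus\Delta_\Theta y:\ y\in\mathbb H^2(f)\otimes\mathcal E_*\}$$ by $$\mathbf T_i^*(x\oplus\Delta_\Theta y):=(M_{Z_i}^*\otimes I_{\mathcal E})x\oplus D_i^*(\Delta_\Theta y),\qquad i=1,\dots,n,$$ where each operator $D_i$ on $\overline{\Delta_\Theta(\mathbb H^2(f)\otimes\mathcal E_* )}$ is defined by $D_i(\Delta_\Theta y):=\Delta_\Theta(M_{Z_i}\otimes I_{\mathcal E_*})y$, $y\in\mathbb H^2(f)\otimes\mathcal E_*$, is in $\mathbb B_f^{cnc}(\mathbf H)$. Moreover, if $\Theta$ is purely contractive and $$\overline{\Delta_\Theta(\mathbb H^2(f)\otimes\mathcal E_* )}=\overline{\Delta_\Theta\Big(\bigvee_{i=1}^nM_{f_i}(\mathbb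 H^2(f)\otimes\mathcal E_* )\Big)}$$ (where $M_{f_i}$ acts on $\mathbb H^2(f)\otimes\mathcal E_*$ as $M_{f_i}\otimes I_{\mathcal E_*}$), then $\Theta$ coincides with the characteristic function $\Theta_{f,\mathbf T}$ of the $n$-tuple $\mathbf T=(\mathbf T_1,\dots,\mathbf T_n)$.
   Context: Words and series. $\mathbb F_n^+$ is the free semigroup of words in the letters $1,\dots,n$, with empty word $\varnothing$; $|\alpha|$ is the length of $\alpha$. For an $n$-tuple $Y=(Y_1,\dots,Y_n)$ of elements of a unital algebra, $Y_\alpha:=Y_{i_1}\cdots Y_{i_k}$ if $\alpha=i_1\cdots i_k$, and $Y_\varnothing:=1$. Power series are formal power series $\psi=\sum_\alpha a_\alpha Z_\alpha$ with complex coefficients in noncommuting indeterminates $Z_1,\dots,Z_n$. For $Y\in B(\mathcal H)^n$ put $\psi(Y):=\sum_{k\ge0}\sum_{|\alpha|=k}a_\alpha Y_\alpha$ (series over $k$); $\mathcal C_\psi(\mathcal H)$ (resp. $\mathcal C_\psi^{SOT}(\mathcal H)$) is the set of $Y$ for which this converges in norm (resp. in the strong operator topology, SOT). $\mathcal C_\psi^{rad}(\mathcal H)$ is the set of $Y$ for which there is $\delta\in(0,1)$ with $rY\in\mathcal C_\psi(\mathcal H)$ for $r\in(\delta,1)$ and $\text{SOT-}\lim_{r\to1}\psi(rY)$ exists; then $\psi(Y)$ denotes this limit. For an $n$-tuple $f=(f_1,\dots,f_n)$ of power series these conditions are required for every $f_i$; $f(Y)=(f_1(Y),\dots,f_n(Y))$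 is also regarded as a row operator $\mathcal H^{(n)}\to\mathcal H$, where $\mathcal H^{(n)}$ is the direct sum of $n$ copies of $\mathcal H$. $[B(\mathcal H)^n]_r:=\{X\in B(\mathcal H)^n:\|\sum_iX_iX_i^*\|^{1/2}<r\}$. A free holomorphic function on $[B(\mathcal H)^n]_\gamma$ is (the evaluation map of) a power series with $\limsup_k(\sum_{|\alpha|=k}|a_\alpha|^2)^{1/2k}\le1/\gamma$. Model property. $\mathbb H^2(f)$ denotes the Hilbert space with orthonormal basis $\{f_\alpha\}_{\alpha\in\mathbb F_n^+}$ ($f_\varnothing=1$), whose elements are the series $\sum_\alpha c_\alpha f_\alpha$, $\sum|c_\alpha|^2<\infty$. $f$ has the model property ($f\in\mathcal M$) if one of the following holds. ($\mathcal A$) $f$ is an $n$-tuple of noncommutative polynomials and there is an $n$-tuple $q$ of polynomials with $f\circ q=q\circ f=\mathrm{id}$. ($\mathcal S$) $f(0)=0$, each $f_i$ has nonzero radius of convergence, the matrix of linear coefficients of $f$ is invertible ($\det J_f(0)\ne0$; then elements of $\mathbb H^2(f)$ are formal power series), $Z_1,\dots,Z_n\in\mathbb H^2(f)$, each $M_{Z_i}\psi:=Z_i\psi$ is a bounded operator on $\mathbb H^2(f)$, and $M_{f_j}=f_j(M_{Z_1},\dots,M_{Z_n})$, where $M_{f_j}\psi:=f_j\psi$ and $(M_{Z_1},\dots,M_{Z_n})$ is in $\mathcal C_f^{SOT}(\mathbb H^2(f))$ or $\mathcal C_f^{rad}(\mathbb H^2(f))$. ($\mathcal F$) for some $\gamma>0$,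 $f$ is an $n$-tuple of free holomorphic functions on $[B(\mathcal H)^n]_\gamma$ ($\mathcal H$ infinite dimensional) with range in $[B(\mathcal H)^n]_1$, there is no nonzero free holomorphic $G$ on $[B(\mathcal H)^n]_1$ with $G\circ f=0$ (then $\mathbb H^2(f)=\{G\circ f: G=\sum c_\alpha Z_\alpha,\ \sum|c_\alpha|^2<\infty\}$), the coordinate functions lie in $\mathbb H^2(f)$, and the boundedness of $M_{Z_i}$ and $M_{f_j}=f_j(M_{Z_1},\dots,M_{Z_n})$ hold as in ($\mathcal S$). The universal model of $\mathbb B_f$ is $M_Z=(M_{Z_1},\dots,M_{Z_n})$. Writing $Z_i=\sum_\alpha a_\alpha^{(i)}f_\alpha$ in $\mathbb H^2(f)$, the inverse of $f$ under composition is $g=(g_1,\dots,g_n)$, $g_i:=\sum_\alpha a^{(i)}_\alpha Z_\alpha$ (so $g\circ f=\mathrm{id}$). Domain. $\mathbb B_f(\mathcal H)$ is the set of $X\in B(\mathcal H)^n$ with $X\in\mathcal C_f^{SOT}(\mathcal H)$ or $X\in\mathcal C_f^{rad}(\mathcal H)$, $\|f(X)\|\le1$ and $g(f(X))=X$, meaning that either $X_i=\sum_k\sum_{|\alpha|=k}a_\alpha^{(i)}[f(X)]_\alpha$ (SOT convergence) for all $i$, or $X_i=\text{SOT-}\lim_{r\to1}\sum_k\sum_{|\alpha|=k}a_\alpha^{(i)}r^{|\alpha|}[f(X)]_\alpha$ for all $i$. $T\in\mathbb B_f(\mathcal H)$ is completely non-coisometric (c.n.c.) if no nonzero $h\in\mathcal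 H$ satisfies $\langle\Phi_{f,T}^m(I)h,h\rangle=\|h\|^2$ for all $m\ge1$, where $\Phi_{f,T}(Y):=\sum_if_i(T)Yf_i(T)^*$. $\mathbb B_f^{cnc}(\mathcal H)$ is the set of c.n.c. elements of $\mathbb B_f(\mathcal H)$. Class $\mathcal M^b$. With $f_i=\sum_\alpha b_\alpha^{(i)}Z_\alpha$, $f\in\mathcal M^b$ means $f\in\mathcal M$ and either $M_Z\in\mathcal C_f^{SOT}(\mathbb H^2(f))$ and $\sup_m\|\sum_{|\alpha|\le m}b^{(i)}_\alpha(M_Z)_\alpha\|<\infty$ for all $i$, or $M_Z\in\mathcal C_f^{rad}(\mathbb H^2(f))$ and $\sup_{r\in[0,1)}\|\sum_k\sum_{|\alpha|=k}b^{(i)}_\alpha r^{|\alpha|}(M_Z)_\alpha\|<\infty$ for all $i$. Multi-analytic operators. A bounded operator $\Phi:\mathbb H^2(f)\otimes\mathcal K_1\to\mathbb H^2(f)\otimes\mathcal K_2$ is multi-analytic (with respect to $M_{Z_1},\dots,M_{Z_n}$) if $\Phi(M_{Z_i}\otimes I_{\mathcal K_1})=(M_{Z_i}\otimes I_{\mathcal K_2})\Phi$ for all $i$. The multi-analytic operators $\Phi$ and $\Phi':\mathbb H^2(f)\otimes\mathcal K_1'\to\mathbb H^2(f)\otimes\mathcal K_2'$ coincide if there are unitaries $\tau_j:\mathcal K_j\to\mathcal K_j'$, $j=1,2$, with $\Phi'(I\otimes\tau_1)=(I\otimes\tau_2)\Phi$. $\Theta$ is purely contractive if $\|P_{\mathcal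 E}\Theta(1\otimes x)\|<\|x\|$ for every nonzero $x\in\mathcal E_*$, where $P_{\mathcal E}$ is the orthogonal projection onto $1\otimes\mathcal E\cong\mathcal E$. Characteristic function. For $T\in\mathbb B_f(\mathcal H)$: $\Delta_{f,T}:=(I_{\mathcal H}-\sum_if_i(T)f_i(T)^* )^{1/2}$, $\Delta_{f,T^*}:=(I_{\mathcal H^{(n)}}-f(T)^*f(T))^{1/2}$, $\mathcal D_{f,T}:=\overline{\Delta_{f,T}\mathcal H}$, $\mathcal D_{f,T^*}:=\overline{\Delta_{f,T^*}\mathcal H^{(n)}}$. $\Lambda_i$ is right multiplication by $f_i$ on $\mathbb H^2(f)$ ($\Lambda_if_\alpha=f_\alpha f_i$). $\Theta_{f,T}:\mathbb H^2(f)\otimes\mathcal D_{f,T^*}\to\mathbb H^2(f)\otimes\mathcal D_{f,T}$ is the multi-analytic contraction with formal Fourier representation $$-I\otimes f(T)+(I\otimes\Delta_{f,T})\Big(I-\sum_i\Lambda_i\otimes f_i(T)^*\Big)^{-1}[\Lambda_1\otimes I_{\mathcal H},\dots,\Lambda_n\otimes I_{\mathcal H}](I\otimes\Delta_{f,T^*}),$$ i.e. the SOT-limit as $r\uparrow1$ of the operators obtained by replacing each $\Lambda_i$ by $r\Lambda_i$. *)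

(* Defs.v *)
From HB Require Import structures.
From mathcomp Require Import all_boot all_order all_algebra complex ring lra.
From mathcomp Require Import boolp classical_sets functions cardinality fsbigop.
From mathcomp Require Import reals ereal topology normedtype sequences exp.

Set Implicit Arguments.
Unset Strict Implicit.
Unset Printing Implicit Defensive.

Import Order.TTheory GRing.Theory Num.Theory.
Import numFieldNormedType.Exports.
Local Open Scope classical_set_scope.
Local Open Scope ring_scope.

(* Complex Hilbert spaces; the inner product is linear in its first argument. *)
HB.mixin Record isHilbert (R : realType) H of CompleteNormedModule R[i] H := {
  inner : H -> H -> R[i];
  innerDl : forall x y z, inner (x + y) z = inner x z + inner y z;
  innerZl : forall a x z, inner (a *: x) z = a * inner x z;
  innerC : forall x y, inner y x = (inner x y)^*;
  innerxx : forall x, inner x x = `|x| ^+ 2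
}.

#[short(type="hilbertType")]
HB.structure Definition Hilbert (R : realType) :=
  {H of CompleteNormedModule R[i] H & isHilbert R H}.

Lemma invn_ltC (R : realType) (e : R[i]) : 0 < e ->
  exists N, forall k, (N <= k)%N -> (k.+1%:R)^-1 < e.
Proof.
move=> e0; have er : e = (complex.Re e)%:C%C by case: e e0 => a b; rewrite ltcE /= => /andP[/eqP -> _].
have re0 : 0 < complex.Re e by move: e0; rewrite er ltcR.
exists (Num.truncn (complex.Re e)^-1) => k Nk.
rewrite er -(rmorph_nat (real_complex R)) -fmorphV ltcR invf_plt ?posrE ?ltr0Sn//.
by rewrite (lt_le_trans (truncnS_gt _))// ler_nat.
Qed.

HB.factory Record Lmodule_isHilbert (R : realType) H of GRing.Lmodule R[i] H := {
  inner : H -> H -> R[i];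
  innerDl : forall x y z, inner (x + y) z = inner x z + inner y z;
  innerZl : forall a x z, inner (a *: x) z = a * inner x z;
  innerC : forall x y, inner y x = (inner x y)^*;
  inner_ge0 : forall x, 0 <= inner x x;
  inner_eq0 : forall x, inner x x = 0 -> x = 0;
  inner_complete : forall u : nat -> H,
    (forall e : R[i], 0 < e -> exists N, forall m p, (N <= m)%N -> (N <= p)%N ->
       inner (u m - u p) (u m - u p) < e) ->
    exists l, forall e : R[i], 0 < e -> exists N, forall m, (N <= m)%N ->
       inner (u m - l) (u m - l) < e
}.

HB.builders Context R H of Lmodule_isHilbert R H.

Let innerDr x y z : inner z (x + y) = inner z x + inner z y.
Proof. by rewrite innerC innerDl rmorphD /= -!(innerC _ z). Qed.

Let innerZr a x z : inner z (a *: x) = a^* * inner z x.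
Proof. by rewrite innerC innerZl rmorphM /= -!(innerC _ z). Qed.

Let norm (x : H) : R[i] := sqrtC (inner x x).

Let norm_ge0 x : 0 <= norm x. Proof. by rewrite sqrtC_ge0 inner_ge0. Qed.
Let normK x : norm x ^+ 2 = inner x x. Proof. by rewrite sqrtCK. Qed.

Let CS x y : `|inner x y| <= norm x * norm y.
Proof.
have [y0|y0] := eqVneq (inner y y) 0.
  by rewrite (inner_eq0 y0) -[0]/(0 : H) -(scale0r (0 : H)) innerZr conjC0 mul0r
             normr0 mulr_ge0.
rewrite -(@ler_pXn2r _ 2) ?nnegrE ?mulr_ge0// exprMn !normK.
pose t := inner x y / inner y y.
have yr : (inner y y)^* = inner y y by rewrite -innerC.
have y_gt0 : 0 < inner y y by rewrite lt_def y0 inner_ge0.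
have : 0 <= inner (x - t *: y) (x - t *: y) by exact: inner_ge0.

have tC : t^* = (inner x y)^* / inner y y by rewrite /t fmorph_div /= yr.
rewrite -scaleNr innerDl !innerDr !innerZl !innerZr !rmorphN /= tC (innerC x y) /t.
rewrite (_ : _ + _ = inner x x - `|inner x y| ^+ 2 / inner y y); last first.
  by rewrite normCK; field.
by rewrite subr_ge0 ler_pdivrMr.
Qed.


Let ler_normD x y : norm (x + y) <= norm x + norm y.
Proof.
rewrite -(@ler_pXn2r _ 2) ?nnegrE ?addr_ge0// sqrrD !normK innerDl !innerDr.
have -> : inner x x + inner x y + (inner y x + inner y y) =
  inner x x + (inner x y + (inner x y)^*) + inner y y by rewrite -innerC !addrA.
rewrite lerD2r lerD2l.
apply: (@le_trans _ _ (`|inner x y| *+ 2)); last by rewrite lerMn2r CS orbT.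
have sr : inner x y + (inner x y)^* \is Num.real.
  by rewrite CrealE rmorphD /= conjCK addrC.
by rewrite (le_trans (real_ler_norm sr))// (le_trans (ler_normD _ _))// norm_conjC mulr2n.
Qed.

Let normrZ (l : R[i]) x : norm (l *: x) = `|l| * norm x.
Proof.
rewrite /norm innerZl innerZr mulrA -normCK sqrtCM ?nnegrE ?exprn_ge0 ?inner_ge0//.
by rewrite sqrCK.
Qed.

Let normr0_eq0 x : norm x = 0 -> x = 0.
Proof. by move=> /eqP; rewrite sqrtC_eq0 => /eqP /inner_eq0. Qed.

HB.instance Definition _ := Lmodule_isNormed.Build R[i] H ler_normD normrZ normr0_eq0.

Let innerxx (x : H) : inner x x = `|x| ^+ 2.
Proof. by rewrite -[`|x|]/(norm x) normK. Qed.

Let cauchy_cvgH (F : set_system H) : ProperFilter F -> cauchy F -> cvg F.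
Proof.
move=> FF Fc.
have /choice[u uP] : forall k : nat, exists x, F (ball x ((k.+1%:R)^-1 : R[i])).
  move=> k; have /cauchyP := Fc; apply.
  by rewrite invr_gt0 ltr0Sn.
have [|l lP] := @inner_complete u.
  move=> e e0.
  have [|N NP] := @invn_ltC R (sqrtC e / 2); first by rewrite divr_gt0// sqrtC_gt0.
  exists N => m p Nm Np.
  have [z [zm zp]] : ball (u m) ((m.+1%:R)^-1 : R[i]) `&` ball (u p) ((p.+1%:R)^-1 : R[i]) !=set0.
    apply: (@filter_ex _ F); exact: filterI.
  have ? := ltW e0; rewrite innerxx -[ltRHS]sqrtCK ltr_pXn2r ?nnegrE ?sqrtC_ge0 ?inner_ge0//.
  rewrite (splitr (sqrtC e)).
  move: zm zp; rewrite -!ball_normE /= => zm zp.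
  rewrite (_ : u m - u p = (u m - z) - (u p - z)); last by rewrite opprB addrA subrK.
  apply: (le_lt_trans (ler_normB _ _)).
  by rewrite ltrD// ?(lt_trans zm) ?(lt_trans zp) ?NP.
apply: (@cvgP _ F l); apply/cvgrPdist_lt => e e0.
have [N1 N1P] := @invn_ltC R (e / 2) (divr_gt0 e0 (ltr0Sn _ 1)).
have [N2 N2P] := lP ((e / 2) ^+ 2) (exprn_gt0 2 (divr_gt0 e0 (ltr0Sn _ 1))).
pose N := maxn N1 N2.
have : F (ball (u N) ((N.+1%:R)^-1 : R[i])) by [].
apply: filterS => z; rewrite -ball_normE /= => zN.
rewrite (_ : l - z = (u N - z) - (u N - l)); last by rewrite opprB [RHS]addrC addrA subrK.
apply: (le_lt_trans (ler_normB _ _)); rewrite (splitr e) ltrD//.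
  by rewrite (lt_trans zN)// N1P// leq_maxl.
have := N2P N (leq_maxr _ _); rewrite innerxx ltr_pXn2r ?nnegrE ?divr_ge0 ?(ltW e0)// -innerxx inner_ge0.
Qed.

HB.instance Definition _ := Uniform_isComplete.Build H cauchy_cvgH.
HB.instance Definition _ := isHilbert.Build R H innerDl innerZl innerC innerxx.

HB.end.

Section inner_theory.
Context (R : realType) (H : hilbertType R).
Implicit Types x y z : H.

Lemma innerDr x y z : inner z (x + y) = inner z x + inner z y.
Proof. by rewrite innerC innerDl rmorphD /= -!(innerC _ z). Qed.

Lemma innerZr a x z : inner z (a *: x) = a^* * inner z x.
Proof. by rewrite innerC innerZl rmorphM /= -!(innerC _ z). Qed.

Lemma inner_ge0 x : 0 <= inner x x.
Proof. by rewrite innerxx exprn_ge0. Qed.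

Lemma inner_eq0 x : inner x x = 0 -> x = 0.
Proof. by rewrite innerxx => /eqP; rewrite expf_eq0/= normr_eq0 => /eqP. Qed.

Lemma inner0l x : inner 0 x = 0.
Proof. by rewrite -(scale0r (0 : H)) innerZl mul0r. Qed.

Lemma inner0r x : inner x 0 = 0.
Proof. by rewrite innerC inner0l conjC0. Qed.

Lemma inner_complete (u : nat -> H) :
    (forall e : R[i], 0 < e -> exists N, forall m p, (N <= m)%N -> (N <= p)%N ->
       inner (u m - u p) (u m - u p) < e) ->
    exists l, forall e : R[i], 0 < e -> exists N, forall m, (N <= m)%N ->
       inner (u m - l) (u m - l) < e.
Proof.
move=> uc; have : cvg (u @ \oo).
  apply: cauchy_cvg; apply: cauchy_exP => e e0.
  have [N NP] := uc _ (exprn_gt0 2 e0); exists (u N).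
  exists N => // m /= Nm; rewrite -ball_normE /=.
  by have := NP N m (leqnn _) Nm; rewrite innerxx ltr_pXn2r ?nnegrE ?(ltW e0).
move=> /cvgrPdist_lt ul; exists (lim (u @ \oo)) => e e0.
have [|N _ NP] := ul (sqrtC e); first by rewrite sqrtC_gt0.
exists N => m Nm; rewrite innerxx -[ltRHS]sqrtCK ltr_pXn2r ?nnegrE ?sqrtC_ge0 ?(ltW e0)//.
by rewrite distrC; exact: NP.
Qed.

Lemma inner_CS x y : `|inner x y| <= `|x| * `|y|.
Proof.
have [y0|y0] := eqVneq (inner y y) 0.
  by rewrite (inner_eq0 y0) inner0r !normr0 mulr0.
rewrite -(@ler_pXn2r _ 2) ?nnegrE ?mulr_ge0// exprMn -!innerxx.
pose t := inner x y / inner y y.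
have yr : (inner y y)^* = inner y y by rewrite -innerC.
have y_gt0 : 0 < inner y y by rewrite lt_def y0 inner_ge0.
have : 0 <= inner (x - t *: y) (x - t *: y) by exact: inner_ge0.
have tC : t^* = (inner x y)^* / inner y y by rewrite /t fmorph_div /= yr.
rewrite -scaleNr innerDl !innerDr !innerZl !innerZr !rmorphN /= tC (innerC x y) /t.
rewrite (_ : _ + _ = inner x x - `|inner x y| ^+ 2 / inner y y); last first.
  by rewrite normCK; field.
by rewrite subr_ge0 ler_pdivrMr.
Qed.

End inner_theory.

(* An alias of R[i]^o, the one-dimensional Hilbert space: R[i]^o itself cannot
   carry the instance because completeness is already keyed on _^o for real
   fields. *)
Definition cplx (R : realType) : Type := (R[i])^o.

Section cplx_hilbert.
Context (R : realType).
Local Notation C := (cplx R).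

HB.instance Definition _ := NormedModule.copy C (R[i])^o.

Let ip (x y : C) : R[i] := (x : R[i]) * y^*.

Let cC (F : set_system C) : ProperFilter F -> cauchy F -> cvg F.
Proof.
move=> FF Fc.
have Hf (f : R[i] -> R) : (forall x y, `|f x - f y|%:C%C <= `|x - y|) ->
    cvg (f \o (fun x : C => x : R[i]) @ F).
  move=> fl; apply: cauchy_cvg; apply: cauchy_exP => e e0.
  have /cauchyP := Fc => /(_ (e%:C%C)) []; first by rewrite ltcR.
  move=> x xP; exists (f x); rewrite nbhs_filterE.
  rewrite /fmap /=; apply: filterS xP => y; rewrite -ball_normE /= -ball_normE /= => xy.
  by rewrite -ltcR; apply: le_lt_trans xy; exact: fl.
have reE : forall x y : R[i], `|complex.Re x - complex.Re y|%:C%C <= `|x - y|.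
  by move=> x y; rewrite -raddfB; apply: le_trans (normc_ge_Re _).
have imE : forall x y : R[i], `|complex.Im x - complex.Im y|%:C%C <= `|x - y|.
  move=> [a b] [c d] /=.
  rewrite normc_def /= lecR -sqrtr_sqr ler_wsqrtr// lerDr sqr_ge0 //.
have /cvg_ex[a /cvgrPdist_lt ca] := Hf _ reE.
have /cvg_ex[b /cvgrPdist_lt cb] := Hf _ imE.
apply: (@cvgP _ F (Complex a b : C)); apply/cvgrPdist_lt => e e0.
have er : e = (complex.Re e)%:C%C by case: e e0 => ? ?; rewrite ltcE /= => /andP[/eqP -> _].
have re0 : 0 < complex.Re e by move: e0; rewrite er ltcR.
near=> z.
rewrite er (_ : (Complex a b : C) - z =
   (a - complex.Re (z : R[i]))%:C%C + (Complex 0 (b - complex.Im (z : R[i])))); last first.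
  by case: (z) => c d /=; rewrite -[LHS]/(Complex (a - c) (b - d)); congr Complex; rewrite /= ?addr0 ?add0r.
apply: le_lt_trans (ler_normD _ _) _.
rewrite !normc_def /= !expr0n /= addr0 add0r !sqrtr_sqr -rmorphD /= ltcR (splitr (complex.Re e)) ltrD//; near: z.
  by apply: ca; rewrite divr_gt0.
by apply: cb; rewrite divr_gt0.
Unshelve. all: by end_near. Qed.


Let ipC x y : ip y x = (ip x y)^*.
Proof. by rewrite /ip rmorphM /= conjCK mulrC. Qed.

Let ipDl x y z : ip (x + y) z = ip x z + ip y z.
Proof. exact: mulrDl. Qed.

Let ipZl a x z : ip (a *: x) z = a * ip x z.
Proof. by rewrite /ip -mulrA. Qed.

Let ipxx x : ip x x = `|x| ^+ 2.
Proof. by rewrite -[`|x|]/(`|x : R[i]|) normCK. Qed.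

HB.instance Definition _ := Uniform_isComplete.Build C cC.

HB.instance Definition _ := @isHilbert.Build R C ip
  ipDl ipZl ipC ipxx.
End cplx_hilbert.

(* Hilbert-space direct sum of two spaces; the library's instance on V * W has
   the sup norm. *)
Definition hsum (R : realType) (V W : hilbertType R) : Type := (V * W)%type.

Section hsum_hilbert.
Context (R : realType) (V W : hilbertType R).
Local Notation S := (hsum V W).

HB.instance Definition _ := GRing.Lmodule.copy S (V * W)%type.

Let ip (x y : S) : R[i] := inner x.1 y.1 + inner x.2 y.2.

Let ipDl x y z : ip (x + y) z = ip x z + ip y z.
Proof. by rewrite /ip !innerDl addrACA. Qed.

Let ipZl a x z : ip (a *: x) z = a * ip x z.
Proof. by rewrite /ip !innerZl mulrDr. Qed.

Let ipC x y : ip y x = (ip x y)^*.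
Proof. by rewrite /ip rmorphD /= -!innerC. Qed.

Let ip_ge0 x : 0 <= ip x x.
Proof. by rewrite addr_ge0// inner_ge0. Qed.

Let ip_eq0 x : ip x x = 0 -> x = 0.
Proof.
move=> /eqP; rewrite paddr_eq0 ?inner_ge0// => /andP[/eqP/inner_eq0 x1 /eqP/inner_eq0 x2].
by case: x x1 x2 => a b /= -> ->.
Qed.

Let complete (u : nat -> S) :
    (forall e : R[i], 0 < e -> exists N, forall m p, (N <= m)%N -> (N <= p)%N ->
       ip (u m - u p) (u m - u p) < e) ->
    exists l, forall e : R[i], 0 < e -> exists N, forall m, (N <= m)%N ->
       ip (u m - l) (u m - l) < e.
Proof.
move=> uc.
have [|a aP] := @inner_complete R V (fun m => (u m).1).
  move=> e /uc[N NP]; exists N => m p Nm Np; apply: le_lt_trans (NP _ _ Nm Np).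
  by rewrite lerDl inner_ge0.
have [|b bP] := @inner_complete R W (fun m => (u m).2).
  move=> e /uc[N NP]; exists N => m p Nm Np; apply: le_lt_trans (NP _ _ Nm Np).
  by rewrite lerDr inner_ge0.
exists (a, b) => e e0.
have e2 : 0 < e / 2 by rewrite divr_gt0.
have [N1 NP1] := aP _ e2; have [N2 NP2] := bP _ e2.
exists (maxn N1 N2) => m; rewrite geq_max => /andP[m1 m2].
by rewrite (splitr e) ltrD// ?NP1 ?NP2.
Qed.

HB.instance Definition _ := @Lmodule_isHilbert.Build R S ip ipDl ipZl ipC
  ip_ge0 ip_eq0 complete.

End hsum_hilbert.

Record csubspace (R : realType) (H : hilbertType R) := CSubspace {
  csubspace_set :> set H;
  csubspace0 : csubspace_set 0;
  csubspaceD : forall x y, csubspace_set x -> csubspace_set y -> csubspace_set (x + y);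
  csubspaceZ : forall (a : R[i]) x, csubspace_set x -> csubspace_set (a *: x);
  csubspace_closed : closed csubspace_set
}.

Definition csub_pred (R : realType) (H : hilbertType R) (S : csubspace H) : {pred H} :=
  fun x => x \in (S : set H).

Record subsp (R : realType) (H : hilbertType R) (S : csubspace H) := Subsp {
  subsp_val : H;
  subsp_mem : subsp_val \in csub_pred S
}.

Section subsp_hilbert.
Context (R : realType) (H : hilbertType R) (S : csubspace H).
Local Notation T := (subsp S).

HB.instance Definition _ := [isSub for @subsp_val R H S].
HB.instance Definition _ := [Choice of T by <:].

Let inP x : reflect (csubspace_set S x) (x \in csub_pred S).
Proof. by apply: (iffP idP); rewrite unfold_in in_setE. Qed.

Let submodS : GRing.submod_closed (csub_pred S).
Proof.
split=> [|a x y]; first by apply/inP; exact: csubspace0.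
by move=> /inP xS /inP yS; apply/inP; apply: csubspaceD => //; exact: csubspaceZ.
Qed.

HB.instance Definition _ := GRing.isSubmodClosed.Build R[i] H (csub_pred S) submodS.
HB.instance Definition _ := [SubChoice_isSubLmodule of T by <:].

Let ip (x y : T) : R[i] := inner (\val x) (\val y).

Let ipDl x y z : ip (x + y) z = ip x z + ip y z.
Proof. by rewrite /ip !innerDl. Qed.

Let ipZl a x z : ip (a *: x) z = a * ip x z.
Proof. by rewrite /ip !innerZl. Qed.

Let ipC x y : ip y x = (ip x y)^*.
Proof. by rewrite /ip -!innerC. Qed.

Let ip_ge0 x : 0 <= ip x x.
Proof. by rewrite inner_ge0. Qed.

Let ip_eq0 x : ip x x = 0 -> x = 0.
Proof. by move=> /inner_eq0 x0; apply: val_inj. Qed.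

Let complete (u : nat -> T) :
    (forall e : R[i], 0 < e -> exists N, forall m p, (N <= m)%N -> (N <= p)%N ->
       ip (u m - u p) (u m - u p) < e) ->
    exists l, forall e : R[i], 0 < e -> exists N, forall m, (N <= m)%N ->
       ip (u m - l) (u m - l) < e.
Proof.
move=> uc.
have [|l lP] := @inner_complete R H (\val \o u).
  by move=> e /uc[N NP]; exists N => m p Nm Np; exact: NP.
have lS : l \in csub_pred S.
  apply/inP; apply: (@csubspace_closed _ _ S) => B /=.
  rewrite -nbhs_ballE => -[e /= e0 eB].
  have [N NP] := lP _ (exprn_gt0 2 e0).
  exists (\val (u N)); split.
    exact/inP/(subsp_mem (u N)).
  apply: eB; rewrite -ball_normE /=.
  have := NP N (leqnn _); rewrite innerxx distrC ltr_pXn2r ?nnegrE ?(ltW e0)//.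
by exists (Subsp lS).
Qed.

HB.instance Definition _ := @Lmodule_isHilbert.Build R T ip ipDl ipZl ipC
  ip_ge0 ip_eq0 complete.

End subsp_hilbert.

(* Sums over a countable index set, through its canonical enumeration; they are
   only used on absolutely summable families. *)
Definition csum (R : realType) (I : countType) (a : I -> R) : R :=
  limn (series (fun k => oapp a 0 (@pickle_inv I k))).

Definition csummable (R : realType) (I : countType) (a : I -> R) : Prop :=
  cvgn (series (fun k => oapp a 0 (@pickle_inv I k))).

Section csum_theory.
Context (R : realType) (I : countType).
Implicit Types a b : I -> R.

Let en a k := oapp a 0 (@pickle_inv I k).

Let enD a b : en (fun i => a i + b i) = en a + en b.
Proof. by apply/funext => k; rewrite /en -[RHS]/(_ + _); case: pickle_inv => //=; rewrite addr0. Qed.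

Let enZ (c : R) a : en (fun i => c * a i) = c *: en a.
Proof. by apply/funext => k; rewrite /en -[RHS]/(_ * _); case: pickle_inv => //=; rewrite mulr0. Qed.

Lemma csummableD a b : csummable a -> csummable b -> csummable (fun i => a i + b i).
Proof. by move=> sa sb; rewrite /csummable -[X in series X]/(en (fun i => a i + b i)) enD; exact: is_cvg_seriesD. Qed.

Lemma csumD a b : csummable a -> csummable b ->
  csum (fun i => a i + b i) = csum a + csum b.
Proof. by move=> sa sb; rewrite /csum -[X in series X]/(en (fun i => a i + b i)) enD; exact: lim_seriesD. Qed.

Lemma csummableZ (c : R) a : csummable a -> csummable (fun i => c * a i).
Proof. by move=> sa; rewrite /csummable -[X in series X]/(en (fun i => c * a i)) enZ; exact: is_cvg_seriesZ. Qed.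

Lemma csumZ (c : R) a : csummable a -> csum (fun i => c * a i) = c * csum a.
Proof. by move=> sa; rewrite /csum -[X in series X]/(en (fun i => c * a i)) enZ; exact: lim_seriesZ. Qed.

Lemma csummable_le a b : (forall i, `|a i| <= b i) -> csummable b -> csummable a.
Proof.
move=> ab sb; apply: normed_cvg; apply: series_le_cvg sb => k //=.
all: case: pickle_inv => [i|] /=; last by rewrite ?normr0.
all: rewrite ?normr0 ?ab ?(le_trans _ (ab i)) //.
Qed.

Lemma csummable_bound a (M : R) : (forall i, 0 <= a i) ->
  (forall n, series (en a) n <= M) -> csummable a /\ csum a <= M.
Proof.
move=> a0 aM; have sa : csummable a.
  apply: nondecreasing_is_cvgn.
    by apply: nondecreasing_series => k _ _; case: pickle_inv.
  by exists M => _ [n _ <-]; exact: aM.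
split => //; apply: limr_le => //; exact: nearW.
Qed.

Lemma series_le_csum a n : (forall i, 0 <= a i) -> csummable a ->
  series (en a) n <= csum a.
Proof.
move=> a0 sa; apply: (@nondecreasing_cvgn_le _ (series (en a))) => //.
by apply: nondecreasing_series => k _ _; rewrite /en; case: pickle_inv.
Qed.

Lemma le_csum a i : (forall i, 0 <= a i) -> csummable a -> a i <= csum a.
Proof.
move=> a0 sa; apply: le_trans (series_le_csum (pickle i).+1 a0 sa).
rewrite /series/= big_nat_recr//= /en pickleK_inv /= lerDr sumr_ge0// => k _.
by rewrite /en; case: pickle_inv.
Qed.

Lemma csum_ge0 a : (forall i, 0 <= a i) -> csummable a -> 0 <= csum a.
Proof.
by move=> a0 /(series_le_csum 0 a0); rewrite /series/= big_geq.
Qed.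

Lemma csum0 : csummable (fun _ : I => 0 : R) /\ csum (fun _ : I => 0 : R) = 0.
Proof.
have [n|s sl] := @csummable_bound (fun=> 0) 0 (fun=> lexx _).
  by rewrite /series/= big1// => k _; rewrite /en; case: pickle_inv.
by split=> //; apply/le_anti; rewrite sl csum_ge0.
Qed.

End csum_theory.

Definition sqnorm (R : realType) (K : hilbertType R) (v : K) : R := complex.Re (inner v v).

Section sqnorm.
Context (R : realType) (K : hilbertType R).
Implicit Types v w : K.

Lemma sqnormE v : inner v v = (sqnorm v)%:C%C.
Proof.
rewrite /sqnorm; have := inner_ge0 v; case: (inner v v) => a b.
by rewrite lecE /= => /andP[/eqP -> _].
Qed.

Lemma sqnorm_ge0 v : 0 <= sqnorm v.
Proof. by rewrite -lecR -sqnormE inner_ge0. Qed.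

Lemma sqnormZ (a : R[i]) v :
  sqnorm (a *: v) = (complex.Re a ^+ 2 + complex.Im a ^+ 2) * sqnorm v.
Proof.
apply: (@complexI R); rewrite -sqnormE innerZl innerZr mulrA -normCK sqnormE rmorphM /=.
congr (_ * _); rewrite normc_def -rmorphXn /= sqr_sqrtr ?addr_ge0 ?sqr_ge0//.
Qed.

Lemma sqnormN v : sqnorm (- v) = sqnorm v.
Proof. by rewrite -scaleN1r sqnormZ /= oppr0 expr0n sqrrN expr1n addr0 mul1r. Qed.

Lemma sqnormD_le v w : sqnorm (v + w) <= 2 * sqnorm v + 2 * sqnorm w.
Proof.
rewrite -lecR rmorphD /= !rmorphM /= -!sqnormE.
rewrite -subr_ge0 (_ : _ - _ = inner (v - w) (v - w)) ?inner_ge0//.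
rewrite !innerDl !innerDr -(scaleN1r w) !innerZl !innerZr !rmorphN1.
by rewrite rmorph_nat; ring.
Qed.

Lemma Re_inner_le v w : `|complex.Re (inner v w)| <= sqnorm v + sqnorm w.
Proof.
rewrite -lecR rmorphD /= -!sqnormE !innerxx.
apply: (le_trans (normc_ge_Re _)); apply: (le_trans (inner_CS _ _)).
have vr : `|v| \is Num.real by exact: normr_real.
have wr : `|w| \is Num.real by exact: normr_real.
have h : 2 * (`|v| ^+ 2 + `|w| ^+ 2 - `|v| * `|w|) =
    (`|v| - `|w|) ^+ 2 + `|v| ^+ 2 + `|w| ^+ 2 by ring.
rewrite -subr_ge0 -(pmulr_rge0 _ (ltr0Sn _ 1)) h.
by rewrite !addr_ge0 ?(exprn_ge0 _ (normr_ge0 _))// real_exprn_even_ge0 ?rpredB.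
Qed.

Lemma Im_inner_le v w : `|complex.Im (inner v w)| <= sqnorm v + sqnorm w.
Proof.
have := Re_inner_le ((Complex 0 (-1)) *: v) w.
rewrite sqnormZ innerZl /= expr0n sqrrN expr1n add0r mul1r; case: (inner v w) => a b /=.
by rewrite !mul0r mulN1r sub0r opprK.
Qed.

End sqnorm.

Definition is_l2 (R : realType) (I : countType) (K : hilbertType R) (x : I -> K) : Prop :=
  csummable (fun i => sqnorm (x i)).

Definition l2_pred (R : realType) (I : countType) (K : hilbertType R) : {pred I -> K} :=
  fun x => `[< is_l2 x >].

(* l2 I K is the Hilbert space of square-summable families in K: with I = 'I_n it
   is the direct sum of n copies of K, with I the words it is H^2(f) (x) K. *)
Record l2 (R : realType) (I : countType) (K : hilbertType R) := L2 {
  l2_val :> I -> K;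
  l2_mem : l2_val \in @l2_pred R I K
}.

Section l2_hilbert.
Context (R : realType) (I : countType) (K : hilbertType R).
Local Notation T := (@l2 R I K).

HB.instance Definition _ := [isSub for @l2_val R I K].
HB.instance Definition _ := [Choice of T by <:].

Let inP (x : I -> K) : reflect (is_l2 x) (x \in @l2_pred R I K).
Proof. by rewrite unfold_in; exact: asboolP. Qed.

Let isl2D (x y : I -> K) : is_l2 x -> is_l2 y -> is_l2 (x + y).
Proof.
move=> sx sy; rewrite /is_l2; apply: (csummable_le _ (csummableD (csummableZ (c:=2) sx) (csummableZ (c:=2) sy))) => i.
by rewrite ger0_norm ?sqnorm_ge0// sqnormD_le.
Qed.

Let isl2Z (a : R[i]) (x : I -> K) : is_l2 x -> is_l2 (a *: x).
Proof.
move=> sx; rewrite /is_l2; apply: (csummable_le _ (csummableZ (c := complex.Re a ^+ 2 + complex.Im a ^+ 2) sx)) => i.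
by rewrite ger0_norm ?sqnorm_ge0// -[(_ *: _) i]/(a *: x i) sqnormZ.
Qed.

Let submod : GRing.submod_closed (@l2_pred R I K).
Proof.
split=> [|a x y].
  apply/inP; rewrite /is_l2 (_ : (fun i => _) = fun=> 0); first exact: (csum0 _ _).1.
  by apply/funext => i; rewrite -[X in sqnorm X]/(0 : K) /sqnorm inner0l.
by move=> /inP xS /inP yS; apply/inP/isl2D => //; exact: isl2Z.
Qed.

HB.instance Definition _ :=
  GRing.isSubmodClosed.Build R[i] (I -> K) (@l2_pred R I K) submod.
HB.instance Definition _ := [SubChoice_isSubLmodule of T by <:].

Let ip (x y : T) : R[i] :=
  Complex (csum (fun i => complex.Re (inner (x i) (y i))))
          (csum (fun i => complex.Im (inner (x i) (y i)))).

Let l2P (x : T) : csummable (fun i => sqnorm (x i)).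
Proof. by apply/inP; exact: l2_mem. Qed.

Let sRe (x y : T) : csummable (fun i => complex.Re (inner (x i) (y i))).
Proof. by apply: (csummable_le _ (csummableD (@l2P x) (@l2P y))) => i; exact: Re_inner_le. Qed.

Let sIm (x y : T) : csummable (fun i => complex.Im (inner (x i) (y i))).
Proof. by apply: (csummable_le _ (csummableD (@l2P x) (@l2P y))) => i; exact: Im_inner_le. Qed.

Let valD (x y : T) i : (x + y) i = x i + y i. Proof. by []. Qed.
Let valZ a (x : T) i : (a *: x) i = a *: x i. Proof. by []. Qed.
Let valN (x : T) i : (- x) i = - x i. Proof. by []. Qed.

Let ipDl x y z : ip (x + y) z = ip x z + ip y z.
Proof.
rewrite /ip -[RHS]/(Complex _ _) -!csumD//; congr Complex; congr csum;
  by apply/funext => i; rewrite valD innerDl; case: inner; case: inner.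
Qed.

Let ipZl a x z : ip (a *: x) z = a * ip x z.
Proof.
case: a => a b; rewrite /ip -[RHS]/(Complex _ _) -mulNr -!csumZ// -!csumD//;
  try exact: csummableZ.
congr Complex; congr csum; apply/funext => i; rewrite valZ innerZl; case: inner => c d //=.
by rewrite mulNr.
Qed.

Let ipC x y : ip y x = (ip x y)^*.
Proof.
rewrite /ip -[RHS]/(Complex _ _) -[- _]mulN1r -csumZ//; congr Complex; congr csum;
  apply/funext => i; rewrite innerC; case: inner => c d //=.
by rewrite mulN1r.
Qed.

Let ipE x : ip x x = (csum (fun i => sqnorm (x i)))%:C%C.
Proof.
rewrite /ip -[RHS]/(Complex _ _); congr Complex.
rewrite (_ : (fun i => _) = fun=> 0) ?(csum0 _ _).2//.
by apply/funext => i; rewrite sqnormE.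
Qed.

Let ip_ge0 x : 0 <= ip x x.
Proof. by rewrite ipE lecR csum_ge0// => i; exact: sqnorm_ge0. Qed.

Let ip_eq0 x : ip x x = 0 -> x = 0.
Proof.
rewrite ipE => -[x0]; apply: val_inj; apply/funext => i.
apply: inner_eq0; rewrite sqnormE; congr (_%:C%C); apply/le_anti.
by rewrite sqnorm_ge0 andbT -x0 le_csum// => j; exact: sqnorm_ge0.
Qed.

Let complete (u : nat -> T) :
    (forall e : R[i], 0 < e -> exists N, forall m p, (N <= m)%N -> (N <= p)%N ->
       ip (u m - u p) (u m - u p) < e) ->
    exists l, forall e : R[i], 0 < e -> exists N, forall m, (N <= m)%N ->
       ip (u m - l) (u m - l) < e.
Proof.
move=> uc.
have /choice[a aP] : forall i, exists l, forall e : R[i], 0 < e -> exists N, forall m,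
    (N <= m)%N -> inner (u m i - l) (u m i - l) < e.
  move=> i; apply: (@inner_complete R K (fun m => u m i)) => e /uc[N NP].
  exists N => m p Nm Np; apply: le_lt_trans (NP _ _ Nm Np).
  rewrite ipE -valN -valD sqnormE lecR.
  by apply: (le_csum (a := fun j => sqnorm ((u m - u p) j))) => // j; exact: sqnorm_ge0.
pose en (x : I -> K) k := oapp (fun i => sqnorm (x i)) 0 (@pickle_inv I k).
have fin n (e : R) : 0 < e -> exists P, forall p, (P <= p)%N ->
    series (en (fun i => u p i - a i)) n < e.
  elim: n e => [|n IH] e e0; first by exists 0%N => p _; rewrite /series/= big_geq.
  have e2 : 0 < e / 2 by rewrite divr_gt0.
  have [P1 PP1] := IH _ e2.
  have [P2 PP2] : exists P, forall p, (P <= p)%N -> en (fun i => u p i - a i) n < e / 2.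
    rewrite /en; case: pickle_inv => [i|] /=; last by exists 0%N.
    have [|P PP] := aP i (e / 2)%:C%C; first by rewrite ltcR.
    by exists P => p /PP; rewrite sqnormE ltcR.
  exists (maxn P1 P2) => p; rewrite geq_max => /andP[p1 p2].
  by rewrite /series/= big_nat_recr//= (splitr e) ltrD// ?PP1 ?PP2.
have key (e : R) : 0 < e -> exists N, forall m, (N <= m)%N -> forall n,
    series (en (fun i => u m i - a i)) n <= e.
  move=> e0; have e4 : 0 < e / 4 by rewrite divr_gt0.
  have [|N NP] := uc (e / 4)%:C%C; first by rewrite ltcR.
  exists N => m Nm n.
  have [P PP] := fin n _ e4.
  pose p := maxn N P.
  have s1 : series (en (u m - u p)) n <= e / 4.
    apply: le_trans (_ : csum (fun i => sqnorm ((u m - u p) i)) <= _).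
      by apply: series_le_csum => [i|]; [exact: sqnorm_ge0|exact: l2P].
    by have := NP m p Nm (leq_maxl _ _); rewrite ipE ltcR => /ltW.
  have s2 := ltW (PP p (leq_maxr _ _)).
  apply: (@le_trans _ _ (2 * series (en (u m - u p)) n +
      2 * series (en (fun i => u p i - a i)) n)); last by lra.
  rewrite /series/= !mulr_sumr -big_split /= ler_sum// => k _.
  rewrite /en; case: pickle_inv => [i|] /=; last by rewrite mulr0 addr0.
  rewrite (_ : u m i - a i = (u m - u p) i + (u p i - a i)) ?sqnormD_le//.
  by rewrite valD valN addrA subrK.
have ul2 m e : (forall n, series (en (fun i => u m i - a i)) n <= e) ->
    is_l2 (fun i => u m i - a i) /\ csum (fun i => sqnorm (u m i - a i)) <= e.
  by move=> ?; apply: csummable_bound => // i; exact: sqnorm_ge0.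
have [N NP] := key 1 ltr01.
have al2 : a \in @l2_pred R I K.
  apply/inP; have [sN _] := ul2 _ _ (NP N (leqnn _)).
  have := isl2D (isl2Z (a := -1) sN) (@l2P (u N)).
  congr is_l2; apply/funext => i; rewrite -[LHS]/(-1 *: (u N i - a i) + u N i).
  by rewrite scaleN1r opprB subrK.
exists (L2 al2) => e e0.
have er : e = (complex.Re e)%:C%C by case: e e0 => ? ?; rewrite ltcE /= => /andP[/eqP -> _].
have re2 : 0 < complex.Re e / 2 by move: e0; rewrite er ltcR => ?; rewrite divr_gt0.
have [M MP] := key _ re2; exists M => m Mm.
have [_ h] := ul2 _ _ (MP _ Mm).
rewrite ipE er ltcR; apply: le_lt_trans h _; lra.
Qed.

HB.instance Definition _ := @Lmodule_isHilbert.Build R T ip ipDl ipZl ipC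
  ip_ge0 ip_eq0 complete.

End l2_hilbert.

Section subspaces.
Context (R : realType) (H : hilbertType R).
Implicit Types (X : set H).

Let closure_approx X p : closure X p <->
  forall e : R[i], 0 < e -> exists2 y, X y & `|p - y| < e.
Proof.
split=> [cp e e0|ap B].
  have [|y [Xy]] := cp (ball p e); first exact: nbhsx_ballx.
  by rewrite -ball_normE /=; exists y.
rewrite -nbhs_ballE => -[e /= e0 eB]; have [y Xy py] := ap e e0.
by exists y; split => //; apply: eB; rewrite -ball_normE.
Qed.

(* cspan X is the smallest closed subspace that contains X. *)
Definition cspan_set X : set H := [set x | forall S : csubspace H, X `<=` S -> csubspace_set S x].

Let cspan0 X : cspan_set X 0.
Proof. by move=> S _; exact: csubspace0. Qed.

Let cspanD X x y : cspan_set X x -> cspan_set X y -> cspan_set X (x + y).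
Proof. by move=> Xx Xy S XS; apply: csubspaceD; [exact: Xx|exact: Xy]. Qed.

Let cspanZ X (a : R[i]) x : cspan_set X x -> cspan_set X (a *: x).
Proof. by move=> Xx S XS; apply: csubspaceZ; exact: Xx. Qed.

Let cspan_closed X : closed (cspan_set X).
Proof.
move=> x cx S XS; apply: (@csubspace_closed _ _ S); apply: closureS cx => y; exact.
Qed.

Definition cspan X : csubspace H :=
  CSubspace (@cspan0 X) (@cspanD X) (@cspanZ X) (@cspan_closed X).

Lemma sub_cspan X : X `<=` cspan X.
Proof. by move=> x Xx S; exact. Qed.

Definition orthoc_set X : set H := [set x | forall y, X y -> inner x y = 0].

Let orthoc0 X : orthoc_set X 0.
Proof. by move=> y _; exact: inner0l. Qed.

Let orthocD X x y : orthoc_set X x -> orthoc_set X y -> orthoc_set X (x + y).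
Proof. by move=> Xx Xy z Xz; rewrite innerDl Xx// Xy// addr0. Qed.

Let orthocZ X (a : R[i]) x : orthoc_set X x -> orthoc_set X (a *: x).
Proof. by move=> Xx z Xz; rewrite innerZl Xx// mulr0. Qed.

Let orthoc_closed X : closed (orthoc_set X).
Proof.
move=> p /closure_approx cp x Xx; apply/eqP; rewrite -normr_eq0; apply/negPn/negP => px.
have px0 : 0 < `|inner p x| by rewrite lt_def px normr_ge0.
have x1 : 0 < `|x| + 1 by rewrite ltr_wpDl.
have [y Sy py] := cp (`|inner p x| / (`|x| + 1)) (divr_gt0 px0 x1).
have := inner_CS (p - y) x.
rewrite innerDl -scaleN1r innerZl Sy// mulr0 addr0 scaleN1r => h.
have : `|inner p x| < `|inner p x|; last by rewrite ltxx.
apply: (le_lt_trans h); move: py; rewrite ltr_pdivlMr//; apply: le_lt_trans.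
by rewrite mulrDr mulr1 lerDl.
Qed.

Definition orthoc X : csubspace H :=
  CSubspace (@orthoc0 X) (@orthocD X) (@orthocZ X) (@orthoc_closed X).

Lemma cspan_closure X :
    X 0 -> (forall a x y, X x -> X y -> X (a *: x + y)) ->
  (cspan X : set H) = closure X.
Proof.
move=> X0 XD; apply/seteqP; split => [x|x cx S XS]; last first.
  by apply: (@csubspace_closed _ _ S); exact: closureS cx.
have c0 : closure X 0 by apply: subset_closure.
have cD x1 y1 : closure X x1 -> closure X y1 -> closure X (x1 + y1).
  move=> /closure_approx cx /closure_approx cy; apply/closure_approx => e e0.
  have e2 : 0 < e / 2 by rewrite divr_gt0.
  have [x2 Xx2 hx] := cx _ e2; have [y2 Xy2 hy] := cy _ e2.
  exists (x2 + y2); first by rewrite -[x2]scale1r; exact: XD.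
  rewrite opprD addrACA (splitr e); apply: le_lt_trans (ler_normD _ _) _.
  exact: ltrD.
have cZ (a : R[i]) x1 : closure X x1 -> closure X (a *: x1).
  move=> /closure_approx cx; apply/closure_approx => e e0.
  have a1 : 0 < `|a| + 1 by rewrite ltr_wpDl.
  have [x2 Xx2 hx] := cx _ (divr_gt0 e0 a1).
  exists (a *: x2); first by rewrite -[_ *: _]addr0; exact: XD.
  rewrite -scalerBr normrZ; move: hx; rewrite ltr_pdivlMr// mulrC; apply: le_lt_trans.
  by rewrite mulrDl mul1r lerDl.
by move=> /(_ (CSubspace c0 cD cZ (@closed_closure _ X))); apply; exact: subset_closure.
Qed.

End subspaces.

Section operators.
Context (R : realType).

Definition bounded_op (H K : hilbertType R) (A : H -> K) : Prop :=
  linear A /\ exists M : R, forall x, `|A x| <= M%:C%C * `|x|.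

(* Only meaningful on bounded operators: sup is 0 on unbounded sets. *)
Definition opnorm (H K : hilbertType R) (A : H -> K) : R :=
  sup [set complex.Re `|A x| | x in [set x : H | `|x| <= 1]].

(* adj, opsqrt, opinv and tensop select the operator that satisfies the defining
   property; for the bounded operators they are applied to it exists (Riesz,
   positive square root, Neumann series, boundedness of A (x) B) and is unique. *)
Definition adj (H K : hilbertType R) (A : H -> K) : K -> H :=
  xget (fun=> 0) [set B | bounded_op B /\
    forall x y, inner (A x) y = inner x (B y)].

Definition opsqrt (H : hilbertType R) (P : H -> H) : H -> H :=
  xget (fun=> 0) [set D | [/\ bounded_op D, forall x, 0 <= inner (D x) x & D \o D = P]].

Definition opinv (H K : hilbertType R) (A : H -> K) : K -> H :=
  xget (fun=> 0) [set B | [/\ bounded_op B, cancel A B & cancel B A]].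

Definition unitary_op (H K : hilbertType R) (U : H -> K) : Prop :=
  [/\ linear U, bijective U & forall x y, inner (U x) (U y) = inner x y].

(* The closure of the range of a linear A, see clrangeE. *)
Definition clrange (H K : hilbertType R) (A : H -> K) : csubspace K := cspan (range A).

Lemma to_clrange_subproof (H K : hilbertType R) (A : H -> K) (x : H) :
  A x \in csub_pred (clrange A).
Proof. by rewrite unfold_in in_setE; apply: sub_cspan; exists x. Qed.

Definition to_clrange (H K : hilbertType R) (A : H -> K) (x : H) : subsp (clrange A) :=
  Subsp (to_clrange_subproof A x).

Lemma clrangeE (H K : hilbertType R) (A : H -> K) : linear A ->
  (clrange A : set K) = closure (range A).
Proof.
move=> lA; apply: cspan_closure => [|a _ _ [x _ <-] [y _ <-]].
  by exists 0 => //; have := lA (-1) 0 0; rewrite scaler0 addr0 scaleN1r addNr.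
by exists (a *: x + y); rewrite ?lA.
Qed.

End operators.

Section l2_elements.
Context (R : realType) (I : countType).

Definition ldelta_val (K : hilbertType R) (i : I) (v : K) : I -> K :=
  fun j => if j == i then v else 0.

Lemma ldelta_subproof (K : hilbertType R) (i : I) (v : K) :
  ldelta_val i v \in @l2_pred R I K.
Proof.
rewrite unfold_in; apply/asboolP.
have sd j : sqnorm (ldelta_val i v j) = if j == i then sqnorm v else 0.
  by rewrite /ldelta_val; case: ifP => // _; rewrite /sqnorm inner0l.
apply: (csummable_bound (M := sqnorm v) _ _).1 => [j|m]; first exact: sqnorm_ge0.
apply: (@le_trans _ _ (\sum_(0 <= k < m) if k == pickle i then sqnorm v else 0)).
  apply: ler_sum => k _; case: pickle_inv (@pickle_invK I k) => /= [j <-|_].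
    by rewrite sd (inj_eq (pcan_inj pickleK_inv)).
  by case: ifP => // _; exact: sqnorm_ge0.
rewrite -big_mkcond /= big_const_seq; case: (count _ _) (count_uniq_mem (pickle i) (iota_uniq 0 (m - 0))) => [|[|k]] /=.
- by rewrite sqnorm_ge0.
- by rewrite addr0.
- by case: (_ \in _).
Qed.

Definition ldelta (K : hilbertType R) (i : I) (v : K) : l2 I K := L2 (ldelta_subproof i v).

Lemma etens_subproof (K : hilbertType R) (c : l2 I (cplx R)) (v : K) :
  (fun i => (c i : R[i]) *: v) \in @l2_pred R I K.
Proof.
rewrite unfold_in; apply/asboolP.
have := l2_mem c; rewrite unfold_in => /asboolP lc.
apply: (csummable_le _ (csummableZ (c := sqnorm v) lc)) => i.
rewrite ger0_norm ?sqnorm_ge0// sqnormZ mulrC ler_wpM2l ?sqnorm_ge0// /sqnorm /inner /=.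
by case: (c i) => a b /=; rewrite mulrN opprK -!expr2.
Qed.

(* The elementary tensor c (x) v. *)
Definition etens (K : hilbertType R) (c : l2 I (cplx R)) (v : K) : l2 I K :=
  L2 (etens_subproof c v).

Definition tensop (K1 K2 : hilbertType R)
    (A : l2 I (cplx R) -> l2 I (cplx R)) (B : K1 -> K2) : l2 I K1 -> l2 I K2 :=
  xget (fun=> 0) [set T | bounded_op T /\ forall c v, T (etens c v) = etens (A c) (B v)].

End l2_elements.

Notation word n := (seq 'I_n).

Section power_series.
Context (R : realType) (n : nat).

(* A formal power series is the family of its coefficients. *)
Definition fps : Type := word n -> R[i].

Definition fps_var (i : 'I_n) : fps := fun w => (w == [:: i])%:R.

Definition fps_mul (p q : fps) : fps :=
  fun w => \sum_(k < (size w).+1) p (take k w) * q (drop k w).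

Definition fps_word (f : 'I_n -> fps) (a : word n) : fps :=
  foldr (fun i p => fps_mul (f i) p) (fun w => (w == [::])%:R) a.

(* The finite-support sum is the composition p o f when p is a polynomial or
   f(0) = 0: then each coefficient only receives finitely many contributions. *)
Definition fps_comp (p : fps) (f : 'I_n -> fps) : fps :=
  fun w => \sum_(a \in [set: word n]) p a * fps_word f a w.

Definition fps_poly (p : fps) : Prop := finite_set [set a | p a != 0].

(* limsup_k (sum_(|a| = k) |p_a|^2)^(1/2k) <= 1/gamma *)
Definition free_hol (gamma : R) (p : fps) : Prop :=
  (limn_esup (fun k : nat =>
     ((\sum_(a : k.-tuple 'I_n) complex.Re `|p a| ^+ 2) `^ ((2 * k)%:R^-1))%:E)
   <= (gamma^-1)%:E)%E.

End power_series.

Section evaluation.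
Context (R : realType) (n : nat) (H : hilbertType R).
Implicit Types (p : fps R n) (Y A : 'I_n -> H -> H).

Definition word_op Y (a : word n) : H -> H := foldr (fun i T => Y i \o T) idfun a.

(* sum_(|a| < m) p_a Y_a *)
Definition psum p Y (m : nat) : H -> H :=
  fun h => \sum_(k < m) \sum_(a : k.-tuple 'I_n) p a *: word_op Y a h.

Definition scale_tuple (r : R) Y : 'I_n -> H -> H := fun i h => r%:C%C *: Y i h.

Definition eval_norm p Y (T : H -> H) : Prop :=
  bounded_op T /\ opnorm (psum p Y m \- T) @[m --> \oo] --> 0.

Definition eval_SOT p Y (T : H -> H) : Prop :=
  bounded_op T /\ forall h, psum p Y m h @[m --> \oo] --> T h.

Definition eval_rad p Y (T : H -> H) : Prop :=
  bounded_op T /\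
  exists (delta : R) (F : R -> H -> H), [/\ 0 < delta < 1,
    forall r, delta < r < 1 -> eval_norm p (scale_tuple r Y) (F r) &
    forall h, F r h @[r --> 1^'-] --> T h].

(* f(Y) = A, either with all f_i in the SOT sense or all in the radial sense. *)
Definition eval_tuple (f : 'I_n -> fps R n) Y A : Prop :=
  (forall i, eval_SOT (f i) Y (A i)) \/ (forall i, eval_rad (f i) Y (A i)).

Definition fval (f : 'I_n -> fps R n) Y : 'I_n -> H -> H :=
  xget (fun _ _ => 0) [set A | eval_tuple f Y A].

Definition row_op A : l2 'I_n H -> H := fun h => \sum_i A i (h i).

(* The ball [B(H)^n]_r. *)
Definition op_ball (r : R) Y : Prop :=
  (forall i, bounded_op (Y i)) /\
  Num.sqrt (opnorm (fun h => \sum_i Y i (adj (Y i) h))) < r.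

Definition eval_comp p (f : 'I_n -> fps R n) Y (T : H -> H) : Prop :=
  exists2 A, forall i, eval_norm (f i) Y (A i) & eval_norm p A T.

End evaluation.

(* H^2(f) is represented by coordinates in its orthonormal basis (f_a): the family
   c stands for the series sum_a c_a f_a, and H2t n K for H^2(f) (x) K. *)
Definition H2t (R : realType) (n : nat) (K : hilbertType R) : hilbertType R :=
  @l2 R (word n) K.

Definition H2f (R : realType) (n : nat) : hilbertType R := H2t n (cplx R).

Section model.
Context (R : realType) (n : nat).
Local Notation fps := (fps R n).
Local Notation H2f := (H2f R n).
Implicit Types (f : 'I_n -> fps) (g : 'I_n -> H2f) (MZ : 'I_n -> H2f -> H2f).

Definition coef (c : H2f) : fps := fun a => c a.

(* In the three predicates lmul_ below, A is the multiplication psi |-> p psi of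
   H^2(f), where psi = sum_a c_a f_a is the composition of the series c with f:
   a polynomial in case (A), where polynomials are dense in H^2(f); a formal
   power series in case (S); a function on the ball of radius gamma in case (F). *)
Definition lmul_poly f (p : fps) (A : H2f -> H2f) : Prop :=
  bounded_op A /\ forall c : H2f, fps_poly (coef c) ->
    fps_poly (coef (A c)) /\
    fps_comp (coef (A c)) f = fps_mul p (fps_comp (coef c) f).

(* In model_A, model_S and model_F, g i is the family of coefficients of Z_i in the
   basis (f_a), i.e. g is the inverse of f, and MZ is the tuple (M_Z1, ..., M_Zn). *)
Definition model_A f g MZ : Prop :=
  [/\ forall i, fps_poly (f i),
      exists q : 'I_n -> fps, [/\ forall i, fps_poly (q i),
        forall i, fps_comp (f i) q = fps_var R i &
        forall i, fps_comp (q i) f = fps_var R i],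
      forall i, fps_poly (coef (g i)) /\ fps_comp (coef (g i)) f = fps_var R i &
      forall i, lmul_poly f (fps_var R i) (MZ i)].

Definition lmul_fps f (p : fps) (A : H2f -> H2f) : Prop :=
  bounded_op A /\ forall c : H2f,
    fps_comp (coef (A c)) f = fps_mul p (fps_comp (coef c) f).

Definition model_S f g MZ : Prop :=
  [/\ forall i, f i [::] = 0 /\ (exists2 gamma : R, 0 < gamma & free_hol gamma (f i)),
      \det (\matrix_(i, j) f i [:: j]) != 0,
      forall i, fps_comp (coef (g i)) f = fps_var R i,
      forall i, lmul_fps f (fps_var R i) (MZ i) &
      exists2 Mf : 'I_n -> H2f -> H2f,
        forall j, lmul_fps f (f j) (Mf j) & eval_tuple f MZ Mf].

Definition lmul_hol (H : hilbertType R) (gamma : R) f (p : fps) (A : H2f -> H2f) : Prop :=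
  bounded_op A /\ forall (c : H2f) (X : 'I_n -> H -> H), op_ball gamma X ->
    exists P T : H -> H, [/\ eval_norm p X P, eval_comp (coef c) f X T &
      eval_comp (coef (A c)) f X (P \o T)].

Definition infinite_dim (H : hilbertType R) : Prop :=
  ~ exists (m : nat) (e : 'I_m -> H), forall x, exists c : 'I_m -> R[i],
      x = \sum_i c i *: e i.

Definition model_F f g MZ : Prop :=
  exists (H : hilbertType R) (gamma : R), [/\ infinite_dim H, 0 < gamma &
   [/\ (forall i, free_hol gamma (f i)),
      (forall X : 'I_n -> H -> H, op_ball gamma X -> exists2 A : 'I_n -> H -> H,
         forall i, eval_norm (f i) X (A i) & op_ball 1 A),
      (forall G : fps, free_hol 1 G ->
         (forall X : 'I_n -> H -> H, op_ball gamma X -> eval_comp G f X (fun=> 0)) ->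
         G = fun=> 0),
      (forall i (X : 'I_n -> H -> H), op_ball gamma X ->
         eval_comp (coef (g i)) f X (X i)) &
      (forall i, lmul_hol H gamma f (fps_var R i) (MZ i)) /\
      exists2 Mf : 'I_n -> H2f -> H2f,
        forall j, lmul_hol H gamma f (f j) (Mf j) & eval_tuple f MZ Mf]].

Definition model f g MZ : Prop :=
  [\/ model_A f g MZ, model_S f g MZ | model_F f g MZ].

Definition class_Mb f g MZ : Prop :=
  model f g MZ /\
  ((forall i, (exists T, eval_SOT (f i) MZ T) /\
      exists M : R, forall m, opnorm (psum (f i) MZ m.+1) <= M) \/
   (forall i, (exists T, eval_rad (f i) MZ T) /\
      exists M : R, forall r : R, 0 <= r < 1 ->
        exists2 T, eval_norm (f i) (scale_tuple r MZ) T & opnorm T <= M)).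

Definition fbasis (a : word n) : H2f := ldelta a (1 : cplx R).

(* M_(f_i) on H^2(f): f_i f_a = f_(ia). *)
Definition Mshift (i : 'I_n) : H2f -> H2f :=
  xget (fun=> 0) [set S | bounded_op S /\ forall a, S (fbasis a) = fbasis (i :: a)].

Definition Lambda (i : 'I_n) : H2f -> H2f :=
  xget (fun=> 0) [set S | bounded_op S /\ forall a, S (fbasis a) = fbasis (rcons a i)].

Definition multi_analytic MZ (K1 K2 : hilbertType R) (Phi : H2t n K1 -> H2t n K2) : Prop :=
  bounded_op Phi /\
  forall i, Phi \o tensop (MZ i) (idfun : K1 -> K1) = tensop (MZ i) (idfun : K2 -> K2) \o Phi.

Definition coincide (K1 K2 K1' K2' : hilbertType R)
    (Phi : H2t n K1 -> H2t n K2) (Phi' : H2t n K1' -> H2t n K2') : Prop :=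
  exists (tau1 : K1 -> K1') (tau2 : K2 -> K2'), [/\ unitary_op tau1, unitary_op tau2 &
    Phi' \o tensop idfun tau1 = tensop idfun tau2 \o Phi].

(* The projection onto 1 (x) E reads off the coordinate at the empty word. *)
Definition purely_contractive (K1 K2 : hilbertType R) (Theta : H2t n K1 -> H2t n K2) : Prop :=
  forall x : K1, x != 0 -> `|(Theta (etens (fbasis [::]) x) : l2 _ _) [::]| < `|x|.

Section domain.
Context (H : hilbertType R).
Implicit Types T X : 'I_n -> H -> H.

Definition in_domain f g X : Prop :=
  [/\ forall i, bounded_op (X i), exists A, eval_tuple f X A,
      opnorm (row_op (fval f X)) <= 1 &
      eval_tuple (fun i => coef (g i)) (fval f X) X].

Definition Phi_map f T (Y : H -> H) : H -> H :=
  fun h => \sum_i fval f T i (Y (adj (fval f T i) h)).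

Definition cnc f T : Prop :=
  forall h : H, (forall m, (0 < m)%N ->
    inner (iter m (Phi_map f T) idfun h) h = `|h| ^+ 2) -> h = 0.

Definition in_domain_cnc f g T : Prop := in_domain f g T /\ cnc f T.

Definition Delta_T f T : H -> H :=
  opsqrt (fun h => h - \sum_i fval f T i (adj (fval f T i) h)).

Definition Delta_Tstar f T : l2 'I_n H -> l2 'I_n H :=
  opsqrt (fun h => h - adj (row_op (fval f T)) (row_op (fval f T) h)).

(* The operator [Lambda_1 (x) I, ..., Lambda_n (x) I] on H^2(f) (x) H^(n) is
   sum_i Lambda_i (x) coord_i. *)
Definition coord (i : 'I_n) (h : l2 'I_n H) : H := h i.

Definition char_approx f T (r : R) (y : H2t n (l2 'I_n H)) : H2t n H :=
  - tensop idfun (row_op (fval f T)) y +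
  tensop idfun (Delta_T f T)
    (opinv (fun x : H2t n H =>
              x - r%:C%C *: \sum_i tensop (Lambda i) (adj (fval f T i)) x)
       (r%:C%C *: \sum_i tensop (Lambda i) (coord i) (tensop idfun (Delta_Tstar f T) y))).

(* The defect spaces are subspaces of H^(n) and H, and subsp_val is the inclusion. *)
Definition defect f T : hilbertType R := subsp (clrange (Delta_T f T)).

Definition defect_star f T : hilbertType R := subsp (clrange (Delta_Tstar f T)).

Definition is_char_fun MZ f T (Th : H2t n (defect_star f T) -> H2t n (defect f T)) : Prop :=
  [/\ multi_analytic MZ Th, opnorm Th <= 1 &
    forall y, char_approx f T r (tensop idfun (@subsp_val _ _ _) y) @[r --> 1^'-]
      --> (tensop idfun (@subsp_val _ _ _) (Th y) : H2t n H)].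

End domain.

Section functional_model.
Context (E Es : hilbertType R) (Theta : H2t n Es -> H2t n E).

Definition Delta_Theta : H2t n Es -> H2t n Es :=
  opsqrt (fun y => y - adj Theta (Theta y)).

Definition Delta_space : hilbertType R := subsp (clrange Delta_Theta).

Definition model_ambient : hilbertType R :=
  hsum (H2t n E) (Delta_space).

Definition model_graph : set model_ambient :=
  range (fun y => (Theta y, to_clrange Delta_Theta y)).

Definition model_space : hilbertType R := subsp (orthoc model_graph).

Definition is_model_D MZ (D : 'I_n -> Delta_space -> Delta_space) :
    Prop :=
  forall i, bounded_op (D i) /\
    forall y, D i (to_clrange Delta_Theta y) =
              to_clrange Delta_Theta (tensop (MZ i) idfun y).

(* T is given through its adjoint on all vectors x (+) w of the model space; w is in
   the closure of the range of Delta_Theta. *)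
Definition is_model_tuple MZ D (T : 'I_n -> model_space -> model_space) : Prop :=
  forall i, bounded_op (T i) /\
    forall v : model_space,
      subsp_val (adj (T i) v) =
      (tensop (adj (MZ i)) idfun (subsp_val v).1, adj (D i) (subsp_val v).2).

End functional_model.

End model.

Arguments is_char_fun {R n H} MZ f T Th.

(* Main.v *)
Require Import Defs.
From mathcomp Require Import all_boot all_order all_algebra complex ring lra.
From mathcomp Require Import boolp classical_sets functions cardinality fsbigop.
From mathcomp Require Import reals ereal topology normedtype sequences exp.

(** The three model properties have one common content: each M_Zi commutes with
    the right creation operators of the Fock space (it is analytic), its value
    at the vacuum is g_i, and f(M_Z) is the tuple S of left creation operators
    ([model_universal]). The rest of the proof works from these facts
    and from the boundedness that defines the class M^b.

    The engine is a transfer principle. Let A be a row contraction on a space H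
    that is covered by bounded maps chi from the Fock space with
    [chi S_j = A_j chi], the union of their ranges being total. The Poisson
    kernel of [rA] gives the von Neumann inequality [von_neumann]; hence for M
    analytic the values of its symbol at [rA] are bounded by the norm of M and
    converge strongly, as r tends to 1, to an operator B with [B chi = chi M]
    ([transfer]). Applied to the M_Zi this produces operators T_i, and applied to
    the partial sums or dilations of f(M_Z), which are bounded by hypothesis, it
    shows that [f(T) = A] and [g(A) = T] ([eval_transport]). Which convergence, SOT
    or radial, defines f(T) does not matter, by the theorem of Abel
    ([eval_any_unique]).

    Since S is a strong limit of polynomials in M_Z, the operator Theta commutes
    with the shifts ([multi_analytic_shift]). Therefore S (x) I compresses to a
    row isometry V on the closure of the range of Delta_Theta, and the graph of
    Theta is invariant under the row isometry [S (x) I + V]. The model space is its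
    orthogonal complement and A is the compression of this row isometry; its
    adjoint is just a restriction. The projections of both summands of the
    ambient space cover the model space, so the transfer principle yields the
    D_i and the model tuple T, and puts T in the domain with f(T) = A. It is
    c.n.c. because the backward shifts tend strongly to 0 on the Fock part, while
    a vector of the model space without Fock part is 0 ([model_cnc]).

    For the last assertion, y |-> (Theta y, Delta_Theta y) is an isometry whose
    range is the complement of the model space in the space of the isometric
    dilation [S (x) I + V] of A. The closure hypothesis makes V a Cuntz row unitary
    ([V_coisom]). Splitting the vector [sum_i W_i x_i], for W the dilation, into
    its part in the model space, which is the row A applied to x, and its part in
    the graph, which is the image of a constant s0 x, computes Theta on the
    constants s0 x: the result is the symbol of the characteristic function of
    A, once the defect spaces are identified with E and Es through
    [|s0 x| = |defS x|] and [|e0 h| = |defT h|], where e0 h is the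
    constant term of the Fock component of h ([char_fun_dilation]). Pure
    contractivity makes these identifications onto. It remains to see that the
    operators at radius r in the definition of the characteristic function
    converge to the multi-analytic operator with that symbol ([capprox_cvg]): they
    are contractions by an isometric colligation, and on vectors supported at
    one word they are Abel means. *)

Set Implicit Arguments.
Unset Strict Implicit.
Unset Printing Implicit Defensive.

Import Order.TTheory GRing.Theory Num.Theory.
Import numFieldNormedType.Exports.
Local Open Scope classical_set_scope.
Local Open Scope ring_scope.

(** * Real-valued norms and convergence in a Hilbert space *)

(** The ambient norm takes values in the complex numbers; this real version
    lets estimates be ordinary inequalities between reals. *)
Definition rn (R : realType) (H : hilbertType R) (x : H) : R := Num.sqrt (sqnorm x).

Section rnorm.
Context (R : realType) (H : hilbertType R).
Implicit Types x y z : H.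

Lemma rn_ge0 x : 0 <= rn x.
Proof. exact: sqrtr_ge0. Qed.

Lemma rn_sqr x : rn x ^+ 2 = sqnorm x.
Proof. by rewrite sqr_sqrtr// sqnorm_ge0. Qed.

Lemma normE x : `|x| = (rn x)%:C%C.
Proof.
apply/eqP; rewrite -(@eqrXn2 _ 2) ?lecR ?rn_ge0//.
by rewrite -innerxx sqnormE -rn_sqr rmorphXn.
Qed.

Lemma rn0 : rn (0 : H) = 0.
Proof. by apply: (@complexI R); rewrite -normE normr0. Qed.

Lemma rn_eq0 x : rn x = 0 -> x = 0.
Proof. by move=> x0; apply/eqP; rewrite -normr_eq0 normE x0. Qed.

Lemma rnD x y : rn (x + y) <= rn x + rn y.
Proof. by rewrite -lecR rmorphD /= -!normE ler_normD. Qed.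

Lemma rnN x : rn (- x) = rn x.
Proof. by apply: (@complexI R); rewrite -!normE normrN. Qed.

Lemma rnC x y : rn (x - y) = rn (y - x).
Proof. by rewrite -rnN opprB. Qed.

Lemma rnB x y : rn (x - y) <= rn x + rn y.
Proof. by rewrite (le_trans (rnD _ _))// rnN. Qed.

Lemma rn_tri x y z : rn (x - z) <= rn (x - y) + rn (y - z).
Proof. by rewrite (_ : x - z = (x - y) + (y - z)) ?rnD// addrA subrK. Qed.

Lemma rnZ (a : R[i]) x : rn (a *: x) = complex.Re `|a| * rn x.
Proof.
apply: (@complexI R); rewrite rmorphM /= -!normE normrZ; congr (_ * _).
Qed.

Lemma rnZr (a : R) x : rn (a%:C%C *: x) = `|a| * rn x.
Proof. by rewrite rnZ normc_def /= expr0n addr0 sqrtr_sqr. Qed.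

Lemma CS_Re x y : complex.Re (inner x y) <= rn x * rn y.
Proof.
apply: le_trans (ler_norm _) _; rewrite -lecR rmorphM /= -!normE.
exact: le_trans (normc_ge_Re _) (inner_CS _ _).
Qed.

Lemma CS_norm x y : complex.Re `|inner x y| <= rn x * rn y.
Proof.
rewrite -lecR rmorphM /= -!normE; apply: le_trans (inner_CS _ _).
by rewrite normc_def; case: (inner x y) => a b; exact: lexx.
Qed.

Lemma rn_sum (I : Type) (s : seq I) (P : pred I) (F : I -> H) :
  rn (\sum_(i <- s | P i) F i) <= \sum_(i <- s | P i) rn (F i).
Proof.
elim/big_rec2 : _ => [|i a b _ ab]; first by rewrite rn0.
by rewrite (le_trans (rnD _ _))// lerD2l.
Qed.

Lemma inner_sumr (I : Type) (s : seq I) (P : pred I) (F : I -> H) x :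
  inner x (\sum_(i <- s | P i) F i) = \sum_(i <- s | P i) inner x (F i).
Proof. by elim/big_rec2: _ => [|i a b _ <-]; rewrite ?inner0r ?innerDr. Qed.

Lemma inner_suml (I : Type) (s : seq I) (P : pred I) (F : I -> H) x :
  inner (\sum_(i <- s | P i) F i) x = \sum_(i <- s | P i) inner (F i) x.
Proof. by elim/big_rec2: _ => [|i a b _ <-]; rewrite ?inner0l ?innerDl. Qed.

Lemma innerNl x y : inner (- x) y = - inner x y.
Proof. by rewrite -scaleN1r innerZl mulN1r. Qed.

Lemma innerNr x y : inner x (- y) = - inner x y.
Proof. by rewrite -scaleN1r innerZr rmorphN1 mulN1r. Qed.

Lemma innerBl x y z : inner (x - y) z = inner x z - inner y z.
Proof. by rewrite innerDl innerNl. Qed.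

Lemma innerBr x y z : inner z (x - y) = inner z x - inner z y.
Proof. by rewrite innerDr innerNr. Qed.

Lemma inner_extl x y : (forall z, inner x z = inner y z) -> x = y.
Proof.
move=> xy; apply/eqP; rewrite -subr_eq0; apply/eqP/inner_eq0.
by rewrite innerBl xy subrr.
Qed.

Lemma inner_extr x y : (forall z, inner z x = inner z y) -> x = y.
Proof. by move=> xy; apply: inner_extl => z; rewrite innerC xy -innerC. Qed.

Lemma sqnormD x y : sqnorm (x + y) = sqnorm x + sqnorm y + 2 * complex.Re (inner x y).
Proof.
rewrite /sqnorm innerDl !innerDr (innerC x y).
by case: (inner x y) (inner x x) (inner y y) => a b [c d] [e h] /=; lra.
Qed.

Lemma sqnorm_orth x y : inner x y = 0 -> sqnorm (x + y) = sqnorm x + sqnorm y.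
Proof. by move=> xy; rewrite sqnormD xy /= mulr0 addr0. Qed.

Lemma sqnorm0 : sqnorm (0 : H) = 0.
Proof. by rewrite /sqnorm inner0l. Qed.

End rnorm.

Lemma sqnorm_rn_le (R : realType) (H K : hilbertType R) (x : H) (y : K) (M : R) : 0 <= M ->
  (rn x <= M * rn y) = (sqnorm x <= M ^+ 2 * sqnorm y).
Proof.
by move=> M0; rewrite -!rn_sqr -exprMn ler_pXn2r// nnegrE ?rn_ge0// mulr_ge0// rn_ge0.
Qed.

Lemma rn_le (R : realType) (H K : hilbertType R) (x : H) (y : K) :
  (rn x <= rn y) = (sqnorm x <= sqnorm y).
Proof. by rewrite -[rn y]mul1r sqnorm_rn_le// expr1n mul1r. Qed.

Section convergence.
Context (R : realType) (T : Type) (F : set_system T) {FF : Filter F}.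

Lemma hcvg (H : hilbertType R) (u : T -> H) (l : H) :
  u t @[t --> F] --> l <-> forall e : R, 0 < e -> \forall t \near F, rn (u t - l) < e.
Proof.
split=> [/cvgrPdist_lt ul e e0|ul].
  have /ul : 0 < e%:C%C by rewrite ltcR.
  by apply: filterS => t; rewrite normE ltcR rnC.
apply/cvgrPdist_lt => e e0.
have er : e = (complex.Re e)%:C%C by case: e e0 => ? ?; rewrite ltcE /= => /andP[/eqP -> _].
have re0 : 0 < complex.Re e by move: e0; rewrite er ltcR.
by have := ul _ re0; apply: filterS => t tl; rewrite normE er ltcR rnC.
Qed.

Lemma hcvg_rn (H : hilbertType R) (u : T -> H) (l : H) :
  rn (u t - l) @[t --> F] --> (0 : R) -> u t @[t --> F] --> l.
Proof.
move=> /cvgrPdist_lt h; apply/hcvg => e /h; apply: filterS => t.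
by rewrite sub0r normrN ger0_norm ?rn_ge0.
Qed.

Lemma hcvg_near (H : hilbertType R) (u v : T -> H) (l : H) :
  v t @[t --> F] --> l -> (\forall t \near F, u t = v t) -> u t @[t --> F] --> l.
Proof.
move=> /hcvg vl uv; apply/hcvg => e /vl vle; apply: filterS2 uv vle => t -> //.
Qed.

End convergence.

Section convergence_proper.
Context (R : realType) (T : Type) (F : set_system T) {FF : ProperFilter F}.
Context (H : hilbertType R).

Lemma hcvg_unique (u : T -> H) (l l' : H) :
  u t @[t --> F] --> l -> u t @[t --> F] --> l' -> l = l'.
Proof. by move=> ul ul'; apply: (cvg_unique _ ul ul'). Qed.

Lemma hcvg_rn_le (u : T -> H) (l : H) (M : R) :
  u t @[t --> F] --> l -> (\forall t \near F, rn (u t) <= M) -> rn l <= M.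
Proof.
move=> /hcvg ul uM; apply/ler_addgt0Pr => e /ul h.
have [t [h1 h2]] := filter_ex (filterI h uM).
rewrite (_ : l = u t - (u t - l)); last by rewrite subKr.
by rewrite (le_trans (rnB _ _))// lerD// ltW.
Qed.

Lemma hcvg_cauchy (u : T -> H) :
  (forall e : R, 0 < e -> exists l, \forall t \near F, rn (u t - l) < e) ->
  cvg (u t @[t --> F]).
Proof.
move=> uc; apply: cauchy_cvg; apply: cauchy_exP => e e0.
have er : e = (complex.Re e)%:C%C by case: e e0 => ? ?; rewrite ltcE /= => /andP[/eqP -> _].
have re0 : 0 < complex.Re e by move: e0; rewrite er ltcR.
have [l ul] := uc _ re0; exists l.
rewrite nbhs_filterE /fmap /=; apply: filterS ul => t.
by rewrite -ball_normE /= normE er ltcR rnC.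
Qed.

End convergence_proper.

(** * Bounded operators *)

Section bounded.
Context (R : realType) (H K L : hilbertType R).
Implicit Types (A B : H -> K).

Lemma boD A x y : bounded_op A -> A (x + y) = A x + A y.
Proof. by case=> /(_ 1 x y); rewrite !scale1r. Qed.

Lemma bo0 A : bounded_op A -> A 0 = 0.
Proof. by case=> /(_ (-1) 0 0); rewrite scaler0 addr0 scaleN1r addNr. Qed.

Lemma boZ A a x : bounded_op A -> A (a *: x) = a *: A x.
Proof. by move=> bA; case: (bA) => /(_ a x 0); rewrite addr0 (bo0 bA) addr0. Qed.

Lemma boN A x : bounded_op A -> A (- x) = - A x.
Proof. by move=> bA; rewrite -scaleN1r (boZ _ _ bA) scaleN1r. Qed.

Lemma boB A x y : bounded_op A -> A (x - y) = A x - A y.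
Proof. by move=> bA; rewrite (boD _ _ bA) (boN _ bA). Qed.

Lemma bo_sum A (I : Type) (s : seq I) (P : pred I) (F : I -> H) : bounded_op A ->
  A (\sum_(i <- s | P i) F i) = \sum_(i <- s | P i) A (F i).
Proof. by move=> bA; elim/big_rec2: _ => [|i a b _ <-]; rewrite ?(bo0 bA) ?(boD _ _ bA). Qed.

Lemma boP A (M : R) : linear A -> (forall x, rn (A x) <= M * rn x) -> bounded_op A.
Proof.
by move=> lA AM; split=> //; exists M => x; rewrite !normE -rmorphM /= lecR.
Qed.

Lemma bo_ex A : bounded_op A -> exists2 M : R, 0 <= M & forall x, rn (A x) <= M * rn x.
Proof.
case=> _ [M AM]; exists `|M| => // x; rewrite -lecR rmorphM /= -!normE.
by rewrite (le_trans (AM x))// ler_wpM2r// lecR ler_norm.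
Qed.

Lemma bo_cvg A (T : Type) (F : set_system T) {FF : Filter F} (u : T -> H) (l : H) : bounded_op A ->
  u t @[t --> F] --> l -> A (u t) @[t --> F] --> A l.
Proof.
move=> bA /hcvg ul; apply/hcvg => e e0; have [M M0 AM] := bo_ex bA.
have M1 : 0 < M + 1 by rewrite ltr_wpDl.
have := ul _ (divr_gt0 e0 M1); apply: filterS => t.
rewrite ltr_pdivlMr// mulrC -(boB _ _ bA); apply: le_lt_trans.
by rewrite (le_trans (AM _))// ler_wpM2r ?rn_ge0// lerDl.
Qed.

Lemma opnorm_has_sup A : bounded_op A ->
  has_sup [set complex.Re `|A x| | x in [set x : H | `|x| <= 1]].
Proof.
move=> bA; have [M M0 AM] := bo_ex bA; split.
  by exists (complex.Re `|A 0|), 0 => //=; rewrite normr0.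
exists M => _ [x /= x1 <-]; rewrite normE /= (le_trans (AM x))//.
by move: x1; rewrite normE -[1]/(1%:C%C) lecR => x1; rewrite -[leRHS]mulr1 ler_wpM2l.
Qed.

Lemma opnorm_ge0 A : bounded_op A -> 0 <= opnorm A.
Proof.
move=> bA; apply: (le_trans (rn_ge0 (A 0))); apply: ub_le_sup; first by case: (opnorm_has_sup bA).
by exists 0 => /=; rewrite ?normr0// normE.
Qed.

Lemma opnormP A x : bounded_op A -> rn (A x) <= opnorm A * rn x.
Proof.
move=> bA; have [->|x0] := eqVneq x 0; first by rewrite (bo0 bA) !rn0 mulr0.
have px : 0 < rn x.
  by rewrite lt_def rn_ge0 andbT; apply: contra_neq x0 => /rn_eq0.
rewrite -ler_pdivrMr//; apply: ub_le_sup; first by case: (opnorm_has_sup bA).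
exists ((rn x)^-1%:C%C *: x) => /=.
  by rewrite normE rnZr ger0_norm ?invr_ge0 ?rn_ge0// mulVf ?gt_eqF.
by rewrite (boZ _ _ bA) normE rnZr ger0_norm ?invr_ge0 ?rn_ge0//= mulrC.
Qed.

Lemma opnorm_le A (M : R) : (forall x, rn (A x) <= M * rn x) -> 0 <= M -> opnorm A <= M.
Proof.
move=> AM M0; apply: ge_sup; first by exists (complex.Re `|A 0|), 0 => //=; rewrite normr0.
move=> _ [x /= x1 <-]; rewrite normE /= (le_trans (AM x))//.
by move: x1; rewrite normE -[1]/(1%:C%C) lecR => x1; rewrite -[leRHS]mulr1 ler_wpM2l.
Qed.

End bounded.

Section bounded_closure.
Context (R : realType).
Implicit Types (H K L : hilbertType R).

Lemma bo_comp H K L (A : H -> K) (B : K -> L) :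
  bounded_op A -> bounded_op B -> bounded_op (B \o A).
Proof.
move=> bA bB; have [M M0 AM] := bo_ex bA; have [N N0 BN] := bo_ex bB.
apply: (@boP _ _ _ _ (N * M)) => [a x y|x] /=.
  by rewrite (boD _ _ bA) (boZ _ _ bA) (boD _ _ bB) (boZ _ _ bB).
by rewrite (le_trans (BN _))// -mulrA ler_wpM2l.
Qed.

Lemma bo_add H K (A B : H -> K) :
  bounded_op A -> bounded_op B -> bounded_op (fun x => A x + B x).
Proof.
move=> bA bB; have [M M0 AM] := bo_ex bA; have [N N0 BN] := bo_ex bB.
apply: (@boP _ _ _ _ (M + N)) => [a x y|x] /=.
  by rewrite (boD _ _ bA) (boZ _ _ bA) (boD _ _ bB) (boZ _ _ bB) scalerDr addrACA.
by rewrite (le_trans (rnD _ _))// mulrDl lerD.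
Qed.

Lemma bo_scale H K (A : H -> K) (a : R[i]) : bounded_op A -> bounded_op (fun x => a *: A x).
Proof.
move=> bA; have [M M0 AM] := bo_ex bA.
apply: (@boP _ _ _ _ (complex.Re `|a| * M)) => [b x y|x] /=.
  by rewrite (boD _ _ bA) (boZ _ _ bA) scalerDr !scalerA mulrC.
by rewrite rnZ -mulrA ler_wpM2l// normc_def /= sqrtr_ge0.
Qed.

Lemma bo_opp H K (A : H -> K) : bounded_op A -> bounded_op (fun x => - A x).
Proof.
move=> bA; rewrite (_ : (fun x => _) = fun x => (-1) *: A x); first exact: bo_scale.
by apply/funext => x; rewrite scaleN1r.
Qed.

Lemma bo_sub H K (A B : H -> K) :
  bounded_op A -> bounded_op B -> bounded_op (fun x => A x - B x).
Proof. by move=> bA bB; apply: bo_add => //; exact: bo_opp. Qed.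

Lemma bo_zero H K : bounded_op (fun _ : H => 0 : K).
Proof.
by apply: (@boP _ _ _ _ 0) => [a x y|x]; rewrite ?scaler0 ?addr0// rn0 mul0r.
Qed.

Lemma bo_bigsum H K (I : Type) (s : seq I) (P : pred I) (A : I -> H -> K) :
  (forall i, bounded_op (A i)) -> bounded_op (fun x => \sum_(i <- s | P i) A i x).
Proof.
move=> bA; elim: s => [|i s IH].
  rewrite (_ : (fun x => _) = fun=> 0); first exact: bo_zero.
  by apply/funext => x; rewrite big_nil.
have [Pi|nPi] := boolP (P i); last first.
  rewrite (_ : (fun x => _) = fun x => \sum_(i <- s | P i) A i x)//.
  by apply/funext => x; rewrite big_cons (negbTE nPi).
rewrite (_ : (fun x => _) = fun x => A i x + \sum_(i <- s | P i) A i x); first exact: bo_add.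
by apply/funext => x; rewrite big_cons Pi.
Qed.

Lemma bo_id H : bounded_op (idfun : H -> H).
Proof. by apply: (@boP _ _ _ _ 1) => // x; rewrite mul1r. Qed.

Lemma bo_isom H K (A : H -> K) : linear A -> (forall x, rn (A x) <= rn x) -> bounded_op A.
Proof. by move=> lA h; apply: (@boP _ _ _ _ 1) => // x; rewrite mul1r. Qed.

Lemma bo_contr H K (A : H -> K) x : bounded_op A -> opnorm A <= 1 -> rn (A x) <= rn x.
Proof.
by move=> bA A1; rewrite (le_trans (opnormP _ bA))// -[leRHS]mul1r ler_wpM2r// rn_ge0.
Qed.

End bounded_closure.

(** * Riesz representation, adjoints and projections *)

Section riesz.
Context (R : realType) (H : hilbertType R).
Implicit Types x y : H.

Lemma parallelogram x y :
  sqnorm (x + y) + sqnorm (x - y) = 2 * sqnorm x + 2 * sqnorm y.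
Proof. by rewrite !sqnormD sqnormN innerNr /=; case: (inner x y) => a b /=; lra. Qed.

Lemma sqnormZr (t : R) x : sqnorm (t%:C%C *: x) = t ^+ 2 * sqnorm x.
Proof. by rewrite sqnormZ /= expr0n addr0. Qed.

Lemma inv_lt (e : R) : 0 < e -> exists N, forall k, (N <= k)%N -> (k.+1%:R)^-1 < e.
Proof.
move=> e0; exists (Num.truncn e^-1) => k Nk.
rewrite invf_plt ?posrE ?ltr0Sn//.
by rewrite (lt_le_trans (truncnS_gt _))// ler_nat.
Qed.

Lemma seq_cauchy_ex (u : nat -> H) :
  (forall e : R, 0 < e -> exists N, forall m p, (N <= m)%N -> (N <= p)%N ->
     sqnorm (u m - u p) < e) ->
  exists l : H, u m @[m --> \oo] --> l.
Proof.
move=> uc; have cu : cvg (u m @[m --> \oo]).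
  apply: hcvg_cauchy => e e0.
  have [N NP] := uc _ (exprn_gt0 2 e0); exists (u N).
  exists N => // m /= Nm.
  have := NP m N Nm (leqnn _); rewrite -rn_sqr ltr_pXn2r// nnegrE ?rn_ge0//.
  exact: ltW.
by exists (lim (u m @[m --> \oo])).
Qed.

Lemma sqnorm_cvg (u : nat -> H) (l : H) :
  u m @[m --> \oo] --> l -> sqnorm (u m) @[m --> \oo] --> sqnorm l.
Proof.
move=> /hcvg ul; apply/cvgrPdist_lt => e e0.
pose c := 2 * rn l + 1.
have c0 : 0 < c by rewrite ltr_wpDl// mulr_ge0 ?rn_ge0.
have d0 : 0 < Num.min 1 (e / c) by rewrite lt_min ltr01 divr_gt0.
have := ul _ d0; apply: filterS => m; rewrite lt_min => /andP[d1 de].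
have h1 : rn (u m) <= rn l + rn (u m - l).
  by rewrite {1}(_ : u m = l + (u m - l)) ?rnD// addrC subrK.
have h2 : rn l <= rn (u m) + rn (u m - l).
  by rewrite {1}(_ : l = u m - (u m - l)) ?rnB// subKr.
rewrite -!rn_sqr subr_sqr normrM.
have a1 : `|rn l - rn (u m)| <= rn (u m - l) by rewrite ler_norml; apply/andP; split; lra.
have a2 : `|rn l + rn (u m)| <= c.
  by rewrite ger0_norm ?addr_ge0 ?rn_ge0// /c; lra.
apply: le_lt_trans (ler_pM _ _ a1 a2) _ => //.
by rewrite -ltr_pdivlMr.
Qed.

(** The representing vector minimises the functional
    [|x|^2 - 2 Re (phi x)], whose minimising sequences are Cauchy by the
    parallelogram identity; the first-order condition at the minimum is the
    representation formula. *)
Lemma riesz (phi : H -> R[i]) (M : R) :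
  (forall a x y, phi (a *: x + y) = a * phi x + phi y) ->
  (forall x, complex.Re (phi x) <= M * rn x) ->
  exists z, forall x, phi x = inner x z.
Proof.
move=> plin pM.
have p0 : phi 0 = 0 by have := plin (-1) 0 0; rewrite scaler0 addr0 mulN1r addNr.
have pD x y : phi (x + y) = phi x + phi y by have := plin 1 x y; rewrite scale1r mul1r.
have pZ a x : phi (a *: x) = a * phi x by have := plin a x 0; rewrite p0 !addr0.
pose J x := sqnorm x - 2 * complex.Re (phi x).
have Jlb x : - M ^+ 2 <= J x.
  rewrite /J; have := pM x; rewrite -rn_sqr => h.
  have := sqr_ge0 (rn x - M); rewrite sqrrB; nra.
pose mu := inf (range J).
have hinf : has_inf (range J).
  by split; [exists (J 0), 0|exists (- M ^+ 2) => _ [x _ <-]].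
have muJ x : mu <= J x.
  by apply: ge_inf; [exact: hinf.2|exists x].
have Jpar x y : sqnorm (x - y) <= 2 * (J x - mu) + 2 * (J y - mu).
  have := muJ ((2^-1)%:C%C *: (x + y)); rewrite /J sqnormZr pZ pD.
  have := parallelogram x y.
  case: (phi x) (phi y) => a b [c d] /=; rewrite ?mul0r ?subr0 => h1 h2.
  nra.
have /choice[u uP] : forall k : nat, exists x, J x < mu + (k.+1%:R)^-1.
  move=> k; have [_ [x _ <-] xk] : exists2 y, range J y & y < mu + (k.+1%:R)^-1.
    by apply: inf_adherent => //; rewrite invr_gt0.
  by exists x.
have [z uz] : exists z : H, u m @[m --> \oo] --> z.
  apply: seq_cauchy_ex => e e0.
  have e4 : 0 < e / 4 by rewrite divr_gt0.
  have [N NP] := inv_lt e4.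
  exists N => m p /NP hm /NP hp.
  apply: le_lt_trans (Jpar _ _) _.
  move: (uP m) (uP p) hm hp.
  by set a := _^-1; set b := _^-1 => h1 h2 h3 h4; lra.
have Jz : J z <= mu.
  have cJ : J (u m) @[m --> \oo] --> J z.
    apply: cvgB; first exact: sqnorm_cvg.
    apply: cvgMr; apply/cvgrPdist_lt => e e0.
    have M1 : 0 < `|M| + 1 by rewrite ltr_wpDl.
    have dp x y : complex.Re (phi x) - complex.Re (phi y) <= (`|M| + 1) * rn (x - y).
      rewrite -raddfB (_ : phi x - phi y = phi (x - y)); last first.
        by rewrite pD -[- y]scaleN1r pZ mulN1r.
      rewrite (le_trans (pM _))// ler_wpM2r ?rn_ge0// (le_trans (ler_norm M))//.
      by rewrite lerDl.
    have /hcvg /(_ _ (divr_gt0 e0 M1)) := uz; apply: filterS => m.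
    rewrite ltr_pdivlMr// mulrC => h.
    have := dp z (u m); have := dp (u m) z; rewrite [in X in _ -> X]rnC => h1 h2.
    by rewrite ltr_norml; apply/andP; split; lra.
  have cK : (mu + (m.+1%:R)^-1) @[m --> \oo] --> mu + 0.
    by apply: cvgD; [exact: cvg_cst|exact: cvg_harmonic].
  rewrite addr0 in cK.
  by apply: (ler_cvg_to cJ cK); apply: nearW => m; exact: ltW.
have Rez x : complex.Re (phi x) = complex.Re (inner x z).
  have key (t : R) : 0 <= t ^+ 2 * sqnorm x + 2 * t * (complex.Re (inner x z) - complex.Re (phi x)).
    have := muJ (z + t%:C%C *: x); rewrite /J sqnormD sqnormZr innerZr pD pZ.
    have := Jz; rewrite /J (innerC x z).
    case: (phi x) (phi z) (inner x z) => a b [c d] [e h] /= h1 h2.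
    nra.
  set d := complex.Re (inner x z) - complex.Re (phi x) in key.
  suff : d = 0 by rewrite /d => /eqP; rewrite subr_eq0 => /eqP ->.
  have sx := sqnorm_ge0 x.
  have s1 : 0 < sqnorm x + 1 by rewrite ltr_wpDl.
  set n := sqnorm x in key sx s1 *.
  have h : 0 <= - d ^+ 2 * (n + 2).
    have := mulr_ge0 (exprn_ge0 2 (ltW s1)) (key (- d / (n + 1))).
    rewrite [X in 0 <= X](_ : _ = - d ^+ 2 * (n + 2))//.
    by field; rewrite gt_eqF.
  apply/eqP; rewrite -sqrf_eq0; apply/eqP/le_anti; rewrite sqr_ge0 andbT.
  by have := sqr_ge0 d; nra.
exists z => x.
have := Rez ('i%C *: x); have := Rez x; rewrite pZ innerZl.
case: (phi x) (inner x z) => a b [c d] /=; rewrite !mul0r !mul1r !sub0r => -> h.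
by congr Complex; lra.
Qed.

End riesz.

Section adjoint.
Context (R : realType).
Implicit Types (H K L : hilbertType R).

Lemma adj_ex H K (A : H -> K) : bounded_op A ->
  exists B, bounded_op B /\ forall x y, inner (A x) y = inner x (B y).
Proof.
move=> bA.
have /choice[B BP] : forall y, exists z, forall x, inner (A x) y = inner x z.
  move=> y; have [M M0 AM] := bo_ex bA.
  apply: (@riesz _ _ _ (M * rn y)) => [a x x'|x].
    by rewrite (boD _ _ bA) (boZ _ _ bA) innerDl innerZl.
  by rewrite (le_trans (CS_Re _ _))// mulrAC ler_wpM2r ?rn_ge0.
exists B; split; last by move=> x y; exact: BP.
have [M M0 AM] := bo_ex bA.
apply: (@boP _ _ _ _ M) => [a x y|y].
  by apply: inner_extr => z; rewrite -BP !innerDr !innerZr !BP.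
have [->|By0] := eqVneq (rn (B y)) 0; first by rewrite mulr_ge0 ?rn_ge0.
have By1 : 0 < rn (B y) by rewrite lt_def By0 rn_ge0.
rewrite -(ler_pM2l By1) -expr2 rn_sqr /sqnorm -BP.
rewrite (le_trans (CS_Re _ _))// mulrCA mulrA ler_wpM2r ?rn_ge0//.
Qed.

Lemma adjP H K (A : H -> K) : bounded_op A ->
  bounded_op (adj A) /\ forall x y, inner (A x) y = inner x (adj A y).
Proof.
move=> bA; rewrite /adj; case: xgetP => [B _ //|].
by have [B BP] := adj_ex bA => /(_ B).
Qed.

Lemma bo_adj H K (A : H -> K) : bounded_op A -> bounded_op (adj A).
Proof. by case/adjP. Qed.

Lemma adjE H K (A : H -> K) x y : bounded_op A -> inner (A x) y = inner x (adj A y).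
Proof. by case/adjP => _; exact. Qed.

Lemma adjEr H K (A : H -> K) x y : bounded_op A -> inner y (A x) = inner (adj A y) x.
Proof. by move=> bA; rewrite innerC (adjE _ _ bA) -innerC. Qed.

Lemma adj_unique H K (A : H -> K) (B : K -> H) : bounded_op A ->
  (forall x y, inner (A x) y = inner x (B y)) -> adj A = B.
Proof. by move=> bA h; apply/funext => y; apply: inner_extr => x; rewrite -h adjE. Qed.

Lemma adjK H K (A : H -> K) : bounded_op A -> adj (adj A) = A.
Proof.
by move=> bA; apply: adj_unique; [exact: bo_adj|move=> x y; rewrite adjEr].
Qed.

Lemma adj_bound H K (A : H -> K) (M : R) : bounded_op A -> 0 <= M ->
  (forall x, rn (A x) <= M * rn x) -> forall y, rn (adj A y) <= M * rn y.
Proof.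
move=> bA M0 AM y.
have [->|By0] := eqVneq (rn (adj A y)) 0; first by rewrite mulr_ge0 ?rn_ge0.
have By1 : 0 < rn (adj A y) by rewrite lt_def By0 rn_ge0.
rewrite -(ler_pM2l By1) -expr2 rn_sqr /sqnorm -adjE//.
by rewrite (le_trans (CS_Re _ _))// mulrCA mulrA ler_wpM2r ?rn_ge0.
Qed.

Lemma adj_contr H K (A : H -> K) : bounded_op A ->
  (forall x, rn (A x) <= rn x) -> forall y, rn (adj A y) <= rn y.
Proof.
by move=> bA AM y; rewrite -[leRHS]mul1r; apply: adj_bound => // x; rewrite mul1r.
Qed.

(** Expanding the form at [x + y] and at [x + i y] recovers its values off the
    diagonal; this is where complex scalars matter. *)
Lemma polarize0 H (A : H -> H) : bounded_op A ->
  (forall x, inner (A x) x = 0) -> forall x, A x = 0.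
Proof.
move=> bA A0 x; apply: inner_eq0.
have e1 y z : inner (A y) z + inner (A z) y = 0.
  by have := A0 (y + z); rewrite (boD _ _ bA) innerDl !innerDr !A0 add0r addr0.
have e2 := e1 x (A x); have := e1 x ('i%C *: A x).
rewrite (boZ _ _ bA) innerZl innerZr.
move: e2; case: (inner (A x) (A x)) (inner (A (A x)) x) => a b [c d] /=.
move=> [h1 h2] [/= h3 h4]; congr Complex; lra.
Qed.

End adjoint.

Section subspace_incl.
Context (R : realType) (H : hilbertType R) (S : csubspace H).
Local Notation J := (@subsp_val R H S).

Lemma bo_subsp_val : bounded_op J.
Proof. by apply: bo_isom. Qed.

Lemma inner_subsp (x y : subsp S) : inner (J x) (J y) = inner x y.
Proof. by []. Qed.

Lemma rn_subsp (x : subsp S) : rn (J x) = rn x.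
Proof. by []. Qed.

Lemma sqnorm_subsp (x : subsp S) : sqnorm (J x) = sqnorm x.
Proof. by []. Qed.

Lemma subsp_val_inj (x y : subsp S) : J x = J y -> x = y.
Proof. exact: val_inj. Qed.

Lemma subsp_in (x : subsp S) : csubspace_set S (J x).
Proof. by have := subsp_mem x; rewrite unfold_in in_setE. Qed.

Lemma subsp_adjK (x : subsp S) : adj J (J x) = x.
Proof. by apply: inner_extr => y; rewrite -adjE//; exact: bo_subsp_val. Qed.

Lemma subsp_proj (x : H) : csubspace_set S x -> J (adj J x) = x.
Proof.
move=> Sx; have xp : x \in csub_pred S by rewrite unfold_in in_setE.
by rewrite -[in LHS](_ : J (Subsp xp) = x)// subsp_adjK.
Qed.

Lemma subsp_orth (x : H) (y : subsp S) : inner (x - J (adj J x)) (J y) = 0.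
Proof.
by rewrite innerBl inner_subsp (adjEr _ _ bo_subsp_val) subrr.
Qed.

End subspace_incl.

Lemma orthocE (R : realType) (H : hilbertType R) (X : set H) x :
  csubspace_set (orthoc X) x = (forall y, X y -> inner x y = 0).
Proof. by []. Qed.

Section total.
Context (R : realType).
Implicit Types (H K : hilbertType R).

(** Totality is stated through orthogonality, the form in which it is checked
    below; [total_csubspace] turns it into density of the span. *)
Definition total_set H (X : set H) := forall x, (forall y, X y -> inner x y = 0) -> x = 0.

(** The projection onto S fixes X, so the difference of x and its projection
    is orthogonal to X. *)
Lemma total_csubspace H (X : set H) (S : csubspace H) :
  total_set X -> X `<=` S -> forall x, csubspace_set S x.
Proof.
move=> tX XS x; have -> : x = subsp_val (adj (@subsp_val R H S) x); last exact: subsp_in.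
apply/eqP; rewrite -subr_eq0; apply/eqP/tX => y /XS Sy.
by rewrite -(subsp_proj Sy) subsp_orth.
Qed.

Lemma total_clrange H K (Q : H -> K) :
  total_set (range (to_clrange Q)).
Proof.
move=> x xQ; have -> : x = adj (@subsp_val R K (clrange Q)) (subsp_val x) by rewrite subsp_adjK.
suff -> : subsp_val x = 0 by rewrite (bo0 (bo_adj (@bo_subsp_val _ _ _))).
have xs : csubspace_set (clrange Q) (subsp_val x) by exact: subsp_in.
have xo : csubspace_set (orthoc [set subsp_val x]) (subsp_val x).
  apply: xs => _ [y _ <-]; rewrite orthocE => z ->.
  have := xQ (to_clrange Q y) (ex_intro2 _ _ y I erefl).
  by rewrite -inner_subsp /= innerC => h; rewrite -[LHS]conjCK h conjC0.
by apply: inner_eq0; exact: xo.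
Qed.

(** Uniformly bounded nets of operators that converge on a total set converge
    strongly: the vectors where the net is Cauchy form a closed subspace. *)
Lemma SOT_total_cvg (T : Type) (F : set_system T) {FF : ProperFilter F} H K
    (A : T -> H -> K) (M : R) (X : set H) :
  (forall t, bounded_op (A t)) ->
  (\forall t \near F, forall x, rn (A t x) <= M * rn x) ->
  total_set X -> (forall x, X x -> cvg (A t x @[t --> F])) ->
  forall x, cvg (A t x @[t --> F]).
Proof.
move=> bA AM tX Xc.
pose S := [set x | cvg (A t x @[t --> F])].
have S0 : S 0.
  rewrite /S /= (_ : (fun t => _) = fun=> 0); first exact: is_cvg_cst.
  by apply/funext => t; rewrite (bo0 (bA t)).
have SD x y : S x -> S y -> S (x + y).
  move=> Sx Sy; rewrite /S /= (_ : (fun t => _) = (fun t => A t x) \+ (fun t => A t y)).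
    exact: is_cvgD.
  by apply/funext => t /=; rewrite (boD _ _ (bA t)).
have SZ (a : R[i]) x : S x -> S (a *: x).
  move=> Sx; rewrite /S /= (_ : (fun t => _) = (fun t => a *: A t x)).
    exact: is_cvgZr.
  by apply/funext => t /=; rewrite (boZ _ _ (bA t)).
have Sc : closed S.
  move=> x cx; apply: hcvg_cauchy => e e0.
  have M1 : 0 < `|M| + 1 by rewrite ltr_wpDl.
  have e2 : 0 < e / 2 by rewrite divr_gt0.
  have [y [Sy]] := cx _ (nbhsx_ballx x (e / 2 / (`|M| + 1))%:C%C (ltac:(by rewrite ltcR divr_gt0))).
  rewrite -ball_normE /= normE ltcR ltr_pdivlMr// => xy.
  have /cvg_ex[l /hcvg/(_ _ e2) yl] := Sy; exists l.
  apply: filterS2 AM yl => t AM yl.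
  rewrite (_ : A t x - l = (A t (x - y)) + (A t y - l)); last first.
    by rewrite (boB _ _ (bA t)) addrA subrK.
  rewrite (le_lt_trans (rnD _ _))// (splitr e) ltrD//.
  apply: le_lt_trans xy; rewrite (le_trans (AM _))// mulrC ler_wpM2l ?rn_ge0//.
  by rewrite (le_trans (ler_norm _))// lerDl.
exact: (total_csubspace (S := CSubspace S0 SD SZ Sc) tX Xc).
Qed.

Lemma bo_eq_total H K (A B : H -> K) (X : set H) : bounded_op A -> bounded_op B ->
  total_set X -> (forall x, X x -> A x = B x) -> A = B.
Proof.
move=> bA bB tX AB.
have bC := bo_sub bA bB.
suff h y : adj (fun x => A x - B x) y = 0.
  apply/funext => x; apply/eqP; rewrite -subr_eq0; apply/eqP; apply: inner_eq0.
  by rewrite (adjE _ _ bC) h inner0r.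
apply: tX => x Xx; rewrite -(adjEr _ _ bC) AB// subrr inner0r //.
Qed.

(** The strong limit exists by [SOT_total_cvg] and is a bounded operator, so
    it is enough to recognise it on the total set. *)
Lemma SOT_total (T : Type) (F : set_system T) {FF : ProperFilter F} H K
    (A : T -> H -> K) (B : H -> K) (M : R) (X : set H) :
  (forall t, bounded_op (A t)) ->
  (\forall t \near F, forall x, rn (A t x) <= M * rn x) -> bounded_op B ->
  total_set X -> (forall x, X x -> A t x @[t --> F] --> B x) ->
  forall x, A t x @[t --> F] --> B x.
Proof.
move=> bA AM bB tX Xc x.
have Ac : forall x, cvg (A t x @[t --> F]).
  by apply: (SOT_total_cvg bA AM tX) => y /Xc; exact: cvgP.
have bL : bounded_op (fun x => lim (A t x @[t --> F])).
  apply: (@boP _ _ _ _ `|M|) => [a y z|z].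
    apply: cvg_lim => //.
    rewrite (_ : (fun t => _) = (fun t => a *: A t y + A t z)); last first.
      by apply/funext => t; rewrite (boD _ _ (bA t)) (boZ _ _ (bA t)).
    by apply: cvgD; [apply: cvgZr; exact: Ac|exact: Ac].
  refine (hcvg_rn_le (u := A^~ z) (Ac z) _); apply: filterS AM => t /(_ z) h.
  by rewrite (le_trans h)// ler_wpM2r ?rn_ge0// ler_norm.
have -> : B = fun x => lim (A t x @[t --> F]); last exact: Ac.
apply: (bo_eq_total (X := X)) => // y /Xc h; apply/esym/cvg_lim => //.
Qed.

Lemma bo_lim (T : Type) (F : set_system T) {FF : ProperFilter F} H K
    (A : T -> H -> K) (B : H -> K) (M : R) :
  (forall t, bounded_op (A t)) -> 0 <= M ->
  (\forall t \near F, forall x, rn (A t x) <= M * rn x) ->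
  (forall x, A t x @[t --> F] --> B x) ->
  bounded_op B /\ forall x, rn (B x) <= M * rn x.
Proof.
move=> bA M0 AM AB; have BM x : rn (B x) <= M * rn x.
  by apply: (hcvg_rn_le (AB x)); apply: filterS AM.
split=> //; apply: (boP _ BM) => a y z; apply: hcvg_unique (AB _) _.
rewrite (_ : (fun t => _) = (fun t => a *: A t y + A t z)); last first.
  by apply/funext => t; rewrite (boD _ _ (bA t)) (boZ _ _ (bA t)).
by apply: cvgD; [apply: cvgZr|]; exact: AB.
Qed.

(** The bound makes [B x] a function of [Q x] and sends Cauchy sequences of
    values of Q to Cauchy sequences, so B extends by continuity from the range
    of Q to its closure. *)
Lemma clrange_ext (L H K : hilbertType R) (Q : H -> K) (B : H -> L) (M : R) :
  bounded_op Q -> linear B -> 0 <= M -> (forall x, rn (B x) <= M * rn (Q x)) ->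
  exists D : subsp (clrange Q) -> L,
    [/\ bounded_op D, forall x, D (to_clrange Q x) = B x & forall w, rn (D w) <= M * rn w].
Proof.
move=> bQ lB M0 BM.
have appr (w : subsp (clrange Q)) (e : R) : 0 < e -> exists x, rn (subsp_val w - Q x) < e.
  move=> e0; have : closure (range Q) (subsp_val w).
    by rewrite -clrangeE; [exact: subsp_in|case: bQ].
  move=> /(_ _ (nbhsx_ballx (subsp_val w) e%:C%C (ltac:(by rewrite ltcR)))) [_ [[x _ <-]]].
  by rewrite -ball_normE /= normE ltcR => h; exists x.
have /choice[s sP] : forall w : subsp (clrange Q), exists u : nat -> H,
    forall k, rn (subsp_val w - Q (u k)) < k.+1%:R^-1.
  move=> w; suff /choice[u uP] : forall k : nat, exists x, rn (subsp_val w - Q x) < k.+1%:R^-1.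
    by exists u.
  by move=> k; apply: appr; rewrite invr_gt0.
have lBB x y : B x - B y = B (x - y).
  by rewrite (_ : x - y = -1 *: y + x) ?lB scaleN1r addrC.
have Bc (w : subsp (clrange Q)) (u : nat -> H) : Q (u k) @[k --> \oo] --> subsp_val w ->
    cvg (B (u k) @[k --> \oo]).
  move=> /hcvg uw; apply: hcvg_cauchy => e e0.
  have M1 : 0 < M + 1 by rewrite ltr_wpDl.
  have e2 : 0 < e / (M + 1) / 2 by rewrite !divr_gt0.
  have [N _ NP] := uw _ e2; exists (B (u N)); exists N => // k /= Nk.
  rewrite lBB; apply: le_lt_trans (BM _) _; rewrite (boB _ _ bQ).
  have h : rn (Q (u k) - Q (u N)) < e / (M + 1).
    rewrite (splitr (e / (M + 1))) (le_lt_trans (rn_tri _ (subsp_val w) _))// ltrD//.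
      exact: NP.
    by rewrite rnC; exact: NP (leqnn _).
  have := rn_ge0 (Q (u k) - Q (u N)); move: h; rewrite ltr_pdivlMr// => h h'.
  nra.
have sQ w : Q (s w k) @[k --> \oo] --> subsp_val w.
  apply/hcvg => e /inv_lt[N NP]; exists N => // k /= /NP h.
  by rewrite rnC; exact: lt_trans (sP w k) h.
pose D w := lim (B (s w k) @[k --> \oo]).
have DP w : B (s w k) @[k --> \oo] --> D w by exact: Bc (sQ w).
have Dcvg w u : Q (u k) @[k --> \oo] --> subsp_val w -> B (u k) @[k --> \oo] --> D w.
  move=> uw; rewrite [X in X @ _ --> _](_ : _ = fun k => B (s w k) - B (s w k - u k)); last first.
    by apply/funext => k; rewrite -lBB subKr.
  rewrite -[D w]subr0; apply: cvgB => //; apply/hcvg => e e0.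
  have M1 : 0 < M + 1 by rewrite ltr_wpDl.
  have : Q (s w k) - Q (u k) @[k --> \oo] --> subsp_val w - subsp_val w by exact: cvgB.
  rewrite subrr => /hcvg/(_ _ (divr_gt0 e0 M1)); apply: filterS => k.
  rewrite !subr0 ltr_pdivlMr// => h; apply: le_lt_trans (BM _) _; rewrite (boB _ _ bQ).
  have := rn_ge0 (Q (s w k) - Q (u k)); nra.
have DM w : rn (D w) <= M * rn w.
  apply/ler_addgt0Pr => e e0; have M1 : 0 < M + 1 by rewrite ltr_wpDl.
  apply: (hcvg_rn_le (DP w)); have /hcvg/(_ _ (divr_gt0 e0 M1)) := sQ w.
  apply: filterS => k; rewrite ltr_pdivlMr// => h; apply: le_trans (BM _) _.
  have h2 : rn (Q (s w k)) <= rn w + rn (Q (s w k) - subsp_val w).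
    by rewrite -rn_subsp {1}(_ : Q (s w k) = subsp_val w + (Q (s w k) - subsp_val w)) ?rnD// addrC subrK.
  have := rn_ge0 (Q (s w k) - subsp_val w); nra.
exists D; split=> //; last first.
  by move=> x; apply: hcvg_unique (Dcvg _ (fun=> x) _) _; exact: cvg_cst.
apply: (boP _ DM) => a w w'.
apply: hcvg_unique (Dcvg _ (fun k => a *: s w k + s w' k) _) _.
  rewrite (_ : (fun k => _) = fun k => a *: Q (s w k) + Q (s w' k)); last first.
    by apply/funext => k; rewrite (boD _ _ bQ) (boZ _ _ bQ).
  by apply: cvgD; [apply: cvgZr|]; exact: sQ.
rewrite (_ : (fun k => _) = fun k => a *: B (s w k) + B (s w' k)); last first.
  by apply/funext => k; rewrite lB.
by apply: cvgD; [apply: cvgZr|]; exact: DP.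
Qed.

Lemma isometry_adjK H K (U : H -> K) : bounded_op U ->
  (forall x, rn (U x) = rn x) -> cancel U (adj U).
Proof.
move=> bU Ui x; have bD := bo_sub (bo_comp bU (bo_adj bU)) (bo_id H).
apply/eqP; rewrite -subr_eq0; apply/eqP; move: x; apply: (polarize0 bD) => x /=.
by rewrite innerBl -(adjEr _ _ bU) !sqnormE -!rn_sqr Ui subrr.
Qed.

(** For every x the vector [x - U U^* x] is orthogonal to the range of U, so
    totality of the range makes U onto. *)
Lemma isometry_total H K (U : H -> K) : bounded_op U ->
  (forall x, rn (U x) = rn x) -> total_set (range U) ->
  [/\ cancel U (adj U), cancel (adj U) U, unitary_op U & unitary_op (adj U)].
Proof.
move=> bU Ui tU; have UK := isometry_adjK bU Ui.
have KU : cancel (adj U) U.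
  move=> x; apply/eqP; rewrite -subr_eq0; apply/eqP/tU => _ [y _ <-].
  by rewrite innerBl !(adjEr _ _ bU) UK subrr.
have ip x y : inner (U x) (U y) = inner x y by rewrite (adjE _ _ bU) UK.
split=> //; first by split=> //; [case: bU|exists (adj U)].
split; [by case: (bo_adj bU)|by exists U|].
by move=> x y; rewrite -ip !KU.
Qed.

End total.

(** * Positive square roots *)

(** The sequence [sqrt_iter B k] converges to [1 - sqrt (1 - B)]: its limit Y
    solves [2 Y = B + Y^2]. The scalar iteration [sqrt_bnd], the case [B = 1],
    dominates it in norm. *)
Fixpoint sqrt_iter (R : realType) (H : hilbertType R) (B : H -> H) (k : nat) (x : H) : H :=
  if k is k'.+1 then (2^-1)%:C%C *: (B x + sqrt_iter B k' (sqrt_iter B k' x)) else 0.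

Fixpoint sqrt_bnd (R : realType) (k : nat) : R :=
  if k is k'.+1 then (1 + sqrt_bnd R k' ^+ 2) / 2 else 0.

Lemma sqrt_bnd01 (R : realType) k : 0 <= sqrt_bnd R k <= 1.
Proof. by elim: k => [|k /andP[h1 h2]] /=; [rewrite lexx ler01|apply/andP; split; nra]. Qed.

Lemma sqrt_bndS (R : realType) k : sqrt_bnd R k <= sqrt_bnd R k.+1.
Proof. by have /andP[h1 h2] := sqrt_bnd01 R k; rewrite /=; nra. Qed.

Lemma sqrt_bnd_mono (R : realType) j k : (j <= k)%N -> sqrt_bnd R j <= sqrt_bnd R k.
Proof.
elim: k => [|k IH]; first by rewrite leqn0 => /eqP ->.
rewrite leq_eqVlt => /orP[/eqP -> //|]; rewrite ltnS => /IH h.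
exact: le_trans h (sqrt_bndS _ _).
Qed.

Lemma inner_cvg_eq (R : realType) (T : Type) (F : set_system T) {FF : ProperFilter F}
    (H K : hilbertType R) (u : T -> H) (v : T -> K) (l y : H) (x l' : K) :
  u t @[t --> F] --> l -> v t @[t --> F] --> l' ->
  (\forall t \near F, inner (u t) y = inner x (v t)) -> inner l y = inner x l'.
Proof.
move=> /hcvg ul /hcvg vl uv.
have e0 (e : R) : 0 < e -> complex.Re `|inner l y - inner x l'| <= e * rn y + rn x * e.
  move=> e0; have [t [[h1 h2] h3]] := filter_ex (filterI (filterI (ul _ e0) (vl _ e0)) uv).
  have -> : inner l y - inner x l' = inner x (v t - l') - inner (u t - l) y.
    by rewrite innerBr innerBl h3; ring.
  have := CS_norm x (v t - l'); have := CS_norm (u t - l) y.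
  have : complex.Re `|inner x (v t - l') - inner (u t - l) y| <=
     complex.Re `|inner x (v t - l')| + complex.Re `|inner (u t - l) y|.
    have := ler_normB (inner x (v t - l')) (inner (u t - l) y).
    by rewrite lecE => /andP[_].
  have := rn_ge0 x; have := rn_ge0 y; have := rn_ge0 (u t - l); have := rn_ge0 (v t - l'); nra.
apply/eqP; rewrite -subr_eq0 -normr_eq0; set d := inner l y - inner x l' in e0 *.
have dE : `|d| = (complex.Re `|d|)%:C%C by rewrite normc_def.
rewrite dE; have d0 : 0 <= complex.Re `|d| by rewrite -lecR -dE normr_ge0.
suff -> : complex.Re `|d| = 0 by [].
apply/le_anti; rewrite d0 andbT; apply/ler_addgt0Pr => e e1; rewrite add0r.
have c0 : 0 < rn x + rn y + 1 by rewrite ltr_wpDl// addr_ge0 ?rn_ge0.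
apply: le_trans (e0 _ (divr_gt0 e1 c0)) _.
rewrite mulrC -mulrDl mulrA ler_pdivrMr// mulrC ler_wpM2l ?(ltW e1)//; lra.
Qed.

Section sqrt_iter.
Context (R : realType).
Implicit Types (H K : hilbertType R).

Lemma sqrt_iter_bo H (B : H -> H) k : bounded_op B -> bounded_op (sqrt_iter B k).
Proof.
move=> bB; elim: k => [|k IH] /=; first exact: bo_zero.
by apply: bo_scale; apply: bo_add => //; exact: (bo_comp IH IH).
Qed.

Lemma sqrt_iter_comm H K (B : H -> H) (C : K -> K) (T : H -> K) k :
  bounded_op T -> (forall x, T (B x) = C (T x)) ->
  forall x, T (sqrt_iter B k x) = sqrt_iter C k (T x).
Proof.
move=> bT TB; elim: k => [|k IH] x /=; first by rewrite (bo0 bT).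
by rewrite (boZ _ _ bT) (boD _ _ bT) TB !IH.
Qed.

Lemma sqrt_iter_self H (B : H -> H) k : (forall x y, inner (B x) y = inner x (B y)) ->
  forall x y, inner (sqrt_iter B k x) y = inner x (sqrt_iter B k y).
Proof.
move=> sB; elim: k => [|k IH] x y /=; first by rewrite inner0l inner0r.
rewrite innerZl innerZr innerDl innerDr sB !IH; congr (_ * _).
exact/esym/conjc_real.
Qed.

Section fixed.
Context (H : hilbertType R) (B : H -> H) (bB : bounded_op B) (cB : forall x, rn (B x) <= rn x).

Lemma sqrt_iter_rn k x : rn (sqrt_iter B k x) <= sqrt_bnd R k * rn x.
Proof.
elim: k x => [|k IH] x /=; first by rewrite rn0 mul0r.
rewrite rnZr ger0_norm ?invr_ge0// mulrC mulrAC ler_wpM2r ?invr_ge0//.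
rewrite (le_trans (rnD _ _))// mulrDl mul1r lerD// (le_trans (IH _))//.
by rewrite expr2 -mulrA ler_wpM2l// (andP (sqrt_bnd01 R k)).1.
Qed.

Lemma sqrt_iter_comm2 j k x :
  sqrt_iter B j (sqrt_iter B k x) = sqrt_iter B k (sqrt_iter B j x).
Proof.
apply: sqrt_iter_comm; first exact: sqrt_iter_bo.
by move=> y; rewrite (sqrt_iter_comm (C := B) _ bB).
Qed.

(** The iterates commute, so the difference of two consecutive ones factors
    like a difference of squares; the scalar iteration factors in the same
    way, which propagates the bound. *)
Lemma sqrt_iterS_rn k x :
  rn (sqrt_iter B k.+1 x - sqrt_iter B k x) <= (sqrt_bnd R k.+1 - sqrt_bnd R k) * rn x.
Proof.
elim: k x => [|k IH] x.
  rewrite /= subr0 addr0 expr0n addr0 subr0 rnZr ger0_norm ?invr_ge0// div1r.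
  by rewrite ler_wpM2l ?invr_ge0.
set y1 := sqrt_iter B k.+1; set y0 := sqrt_iter B k.
have b1 : bounded_op y1 by exact: sqrt_iter_bo.
have b0 : bounded_op y0 by exact: sqrt_iter_bo.
have -> : sqrt_iter B k.+2 x - y1 x = (2^-1)%:C%C *: (y1 (y1 x - y0 x) + y0 (y1 x - y0 x)).
  rewrite -[sqrt_iter B k.+2 x]/((2^-1)%:C%C *: (B x + y1 (y1 x))).
  rewrite [in y1 x](_ : y1 x = (2^-1)%:C%C *: (B x + y0 (y0 x)))// -scalerBr; congr (_ *: _).
  rewrite (boB _ _ b1) (boB _ _ b0) [y1 (y0 x)]sqrt_iter_comm2.
  by rewrite addrA subrK opprD addrACA subrr add0r.
rewrite rnZr ger0_norm ?invr_ge0// mulrC.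
have -> : sqrt_bnd R k.+2 - sqrt_bnd R k.+1 =
   (sqrt_bnd R k.+1 + sqrt_bnd R k) * (sqrt_bnd R k.+1 - sqrt_bnd R k) / 2.
  rewrite -[sqrt_bnd R k.+2]/((1 + sqrt_bnd R k.+1 ^+ 2) / 2).
  by rewrite [X in _ - X = _](_ : _ = (1 + sqrt_bnd R k ^+ 2) / 2)//; field.
rewrite [leRHS]mulrAC ler_wpM2r ?invr_ge0// (le_trans (rnD _ _))// -mulrA mulrDl lerD//.
  rewrite (le_trans (sqrt_iter_rn _ _))// ler_wpM2l ?IH//.
  by rewrite (andP (sqrt_bnd01 R _)).1.
rewrite (le_trans (sqrt_iter_rn _ _))// ler_wpM2l ?IH//.
by rewrite (andP (sqrt_bnd01 R _)).1.
Qed.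

Lemma sqrt_iter_cauchy j k x : (j <= k)%N ->
  rn (sqrt_iter B k x - sqrt_iter B j x) <= (sqrt_bnd R k - sqrt_bnd R j) * rn x.
Proof.
elim: k => [|k IH]; first by rewrite leqn0 => /eqP ->; rewrite !subrr rn0 mul0r.
rewrite leq_eqVlt => /orP[/eqP ->|]; first by rewrite !subrr rn0 mul0r.
rewrite ltnS => /IH h; rewrite (le_trans (rn_tri _ (sqrt_iter B k x) _))//.
rewrite (le_trans (lerD (sqrt_iterS_rn _ _) h))// -mulrDl.
by rewrite addrA subrK.
Qed.

Lemma sqrt_iter_lim : exists Y : H -> H,
  forall x, sqrt_iter B k x @[k --> \oo] --> Y x.
Proof.
have cs : cvgn (sqrt_bnd R).
  apply: nondecreasing_is_cvgn; first by move=> j k; exact: sqrt_bnd_mono.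
  by exists 1 => _ [k _ <-]; rewrite (andP (sqrt_bnd01 R k)).2.
suff h x : cvg (sqrt_iter B k x @[k --> \oo]).
  by exists (fun x => lim (sqrt_iter B k x @[k --> \oo])) => x; exact: h.
apply: hcvg_cauchy => e e0.
have M1 : 0 < rn x + 1 by rewrite ltr_wpDl ?rn_ge0.
have /cvgrPdist_lt/(_ _ (divr_gt0 e0 M1)) [N _ NP] := cs.
exists (sqrt_iter B N x); exists N => // k /= Nk.
apply: le_lt_trans (sqrt_iter_cauchy x Nk) _.
have /ltW h1 := NP N (leqnn _).
have h2 : sqrt_bnd R k <= limn (sqrt_bnd R).
  by apply: nondecreasing_cvgn_le => // i j; exact: sqrt_bnd_mono.
have {}h1 : sqrt_bnd R k - sqrt_bnd R N < e / (rn x + 1).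
  by apply: le_lt_trans (NP N (leqnn _)); rewrite (le_trans _ (ler_norm _))// lerB.
move: h1; rewrite ltr_pdivlMr// => h1; have := sqrt_bnd_mono R Nk; have := rn_ge0 x; nra.
Qed.

End fixed.

Lemma pos_self H (D : H -> H) : bounded_op D -> (forall x, 0 <= inner (D x) x) ->
  forall x y, inner (D x) y = inner x (D y).
Proof.
move=> bD D0 x y; rewrite (adjE _ _ bD); congr inner.
have bC := bo_sub (bo_adj bD) bD.
apply/eqP; rewrite -subr_eq0; apply/eqP; move: y; apply: (polarize0 bC) => y.
rewrite innerBl -(adjEr _ _ bD) (innerC (D y)); have := D0 y.
case: (inner (D y) y) => a b; rewrite lecE /= => /andP[/eqP -> _].
by rewrite [X in X - _](conjc_real a) subrr.
Qed.

(** Positivity of the form at [x + t D x] for small negative t. *)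
Lemma pos_eq0 H (D : H -> H) x : bounded_op D -> (forall x, 0 <= inner (D x) x) ->
  inner (D x) x = 0 -> D x = 0.
Proof.
move=> bD D0 Dx; have sD := pos_self bD D0.
have [M M0 DM] := bo_ex bD.
pose n := sqnorm (D x); have n0 : 0 <= n by exact: sqnorm_ge0.
have key (t : R) : 0 <= 2 * t * n + t ^+ 2 * (M * n).
  have h : complex.Re (inner (D (D x)) (D x)) <= M * n.
    rewrite (le_trans (CS_Re _ _))// /n -rn_sqr expr2 mulrA.
    by rewrite ler_wpM2r ?rn_ge0.
  have := D0 (x + t%:C%C *: D x).
  rewrite (boD _ _ bD) (boZ _ _ bD) innerDl !innerDr !innerZl !innerZr Dx.
  rewrite [inner (D (D x)) x]sD sqnormE -/n.
  move: h; case: (inner (D (D x)) (D x)) => a b /= ab.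
  rewrite lecE /= => /andP[_]; nra.
suff : n = 0 by move=> n00; apply: inner_eq0; rewrite sqnormE -/n n00.
apply/le_anti; rewrite n0 andbT.
have := key (- (M + 1)^-1); have M1 : 0 < M + 1 by rewrite ltr_wpDl.
rewrite sqrrN => h; have : 0 <= (M + 1) ^+ 2 * (2 * - (M + 1)^-1 * n + (M + 1)^-1 ^+ 2 * (M * n)).
  by rewrite mulr_ge0// exprn_ge0// ltW.
rewrite (_ : _ * (_ + _) = - (M + 2) * n); last by field; rewrite gt_eqF.
by move=> h'; nra.
Qed.

(** The limit of the iteration gives a positive root D0. Any positive root D
    commutes with B, hence with the iterates and with D0; then [(D + D0) (D -
    D0) = 0], and positivity of both roots forces [D = D0]. *)
Lemma opsqrtP H (B : H -> H) : bounded_op B ->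
  (forall x y, inner (B x) y = inner x (B y)) -> (forall x, rn (B x) <= rn x) ->
  let D := opsqrt (fun x => x - B x) in
  [/\ bounded_op D, forall x, 0 <= inner (D x) x, forall x, D (D x) = x - B x &
   forall x, sqrt_iter B k x @[k --> \oo] --> x - D x].
Proof.
move=> bB sB cB D.
have [Y YP] := sqrt_iter_lim bB cB.
have [bY Y1] : bounded_op Y /\ forall x, rn (Y x) <= 1 * rn x.
  apply: (bo_lim (A := sqrt_iter B) (F := \oo)) => //; first by move=> k; exact: sqrt_iter_bo.
  apply: nearW => k x; rewrite (le_trans (sqrt_iter_rn cB _ _))// ler_wpM2r ?rn_ge0//.
  by rewrite (andP (sqrt_bnd01 R k)).2.
have sY x y : inner (Y x) y = inner x (Y y).
  apply: (inner_cvg_eq (F := \oo) (YP x) (YP y)); apply: nearW => k.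
  exact: sqrt_iter_self.
have YYP x : sqrt_iter B k (sqrt_iter B k x) @[k --> \oo] --> Y (Y x).
  rewrite (_ : (fun k => _) = fun k => sqrt_iter B k (sqrt_iter B k x - Y x) + sqrt_iter B k (Y x)); last first.
    by apply/funext => k; rewrite (boB _ _ (sqrt_iter_bo _ bB)) subrK.
  rewrite -[Y (Y x)]add0r; apply: cvgD; last exact: YP.
  apply/hcvg => e e0; have /hcvg/(_ _ e0) := YP x; apply: filterS => k; apply: le_lt_trans.
  rewrite subr0 (le_trans (sqrt_iter_rn cB _ _))// -[leRHS]mul1r ler_wpM2r ?rn_ge0//.
  by rewrite (andP (sqrt_bnd01 R k)).2.
have YE x : Y x = (2^-1)%:C%C *: (B x + Y (Y x)).
  apply: (hcvg_unique (F := \oo) (u := fun k => sqrt_iter B k.+1 x)).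
    by have := YP x; rewrite -(cvg_shiftS).
  by apply: cvgZr; apply: cvgD => //; exact: cvg_cst.
pose D0 x := x - Y x.
have bD0 : bounded_op D0 by exact: bo_sub (bo_id H) bY.
have D00 x : 0 <= inner (D0 x) x.
  rewrite /D0 innerBl sqnormE.
  have := CS_Re (Y x) x; have : rn (Y x) * rn x <= sqnorm x.
    by rewrite -rn_sqr expr2 ler_wpM2r ?rn_ge0// (le_trans (Y1 _))// mul1r.
  have := innerC (Y x) x; rewrite -sY; case: (inner (Y x) x) => a b /= [h] h1 h2.
  rewrite lecE /= sub0r oppr_eq0; apply/andP; split; last lra.
  by apply/eqP; lra.
have DD0 x : D0 (D0 x) = x - B x.
  have h : Y (Y x) = Y x + Y x - B x.
    have -> : Y x + Y x = B x + Y (Y x); last by rewrite addrC addKr.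
    rewrite {1 2}YE -scalerDl (_ : _ + _ = 1) ?scale1r//.
    by rewrite -rmorphD /= -[1 in RHS]/(1%:C%C); congr (_%:C%C); lra.
  by rewrite /D0 (boB _ _ bY) h opprB [_ + _ - B x]addrAC addrK addrA subrK.
have [bD Dp DD] : [/\ bounded_op D, forall x, 0 <= inner (D x) x & forall x, D (D x) = x - B x].
  rewrite /D /opsqrt; case: xgetP => [D' _ [h1 h2 h3]|/(_ D0) []].
    by split=> // x; rewrite -[D' (D' x)]/((D' \o D') x) h3.
  by split=> //; apply/funext => x /=.
have DBc x : D (B x) = B (D x).
  have -> : B x = x - D (D x) by rewrite DD subKr.
  by rewrite (boB _ _ bD) [RHS](_ : _ = D x - D (D (D x))) // (DD (D x)) subKr.
have DY x : D (Y x) = Y (D x).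
  have h : D (sqrt_iter B k x) @[k --> \oo] --> D (Y x) by apply: bo_cvg.
  apply: hcvg_unique h _; rewrite (_ : (fun k => _) = fun k => sqrt_iter B k (D x)); first exact: YP.
  by apply/funext => k; exact: sqrt_iter_comm.
have DD0c x : D (D0 x) = D0 (D x) by rewrite /D0 (boB _ _ bD) DY.
have DE x : D x = D0 x.
  have bE := bo_sub bD bD0.
  have zE z : (D z - D0 z = 0) <-> (D z = D0 z).
    by split=> [/eqP|->]; rewrite ?subrr// subr_eq0 => /eqP.
  apply/zE; pose z := D x - D0 x.
  have h : D z + D0 z = 0.
    rewrite /z (boB _ _ bD) (boB _ _ bD0) DD DD0 DD0c.
    by rewrite addrA subrK subrr.
  have h2 : inner (D z) z + inner (D0 z) z = 0 by rewrite -innerDl h inner0l.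
  move/eqP: h2; rewrite paddr_eq0 ?Dp ?D00// => /andP[/eqP/(pos_eq0 bD Dp) z1 /eqP/(pos_eq0 bD0 D00) z2].
  by rewrite -/z; apply: inner_eq0; rewrite {1}/z innerBl (pos_self bD Dp) (pos_self bD0 D00) z1 z2 subrr.
by split=> // x; rewrite DE /D0 subKr.
Qed.

End sqrt_iter.

(** An operator that intertwines B and C intertwines the polynomials in them
    that define the square roots. *)
Lemma opsqrt_comm (R : realType) (H K : hilbertType R) (B : H -> H) (C : K -> K) (T : H -> K) :
  bounded_op B -> (forall x y, inner (B x) y = inner x (B y)) -> (forall x, rn (B x) <= rn x) ->
  bounded_op C -> (forall x y, inner (C x) y = inner x (C y)) -> (forall x, rn (C x) <= rn x) ->
  bounded_op T -> (forall x, T (B x) = C (T x)) ->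
  forall x, T (opsqrt (fun x => x - B x) x) = opsqrt (fun x => x - C x) (T x).
Proof.
move=> bB sB cB bC sC cC bT TB x.
have [_ _ _ /(_ x) h1] := opsqrtP bB sB cB; have [_ _ _ /(_ (T x)) h2] := opsqrtP bC sC cC.
have e : T (x - opsqrt (fun x => x - B x) x) = T x - opsqrt (fun x => x - C x) (T x).
  apply: hcvg_unique h2.
  rewrite (_ : (fun k => _) = fun k => T (sqrt_iter B k x)); first exact: bo_cvg.
  by apply/funext => k; apply/esym/sqrt_iter_comm.
by move: e; rewrite (boB _ _ bT) => /(congr1 (fun z => T x - z)); rewrite !subKr.
Qed.

(** * Square-summable families *)

Section csum_finite.
Context (R : realType) (I : countType).
Implicit Types a b : I -> R.

Definition enum_upto (m : nat) : seq I := pmap (@pickle_inv I) (iota 0 m).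

Lemma enum_upto_uniq m : uniq (enum_upto m).
Proof. by apply: (pmap_uniq (g := pickle)); [exact: pickle_invK|exact: iota_uniq]. Qed.

Lemma mem_enum_upto m i : (i \in enum_upto m) = (pickle i < m)%N.
Proof.
rewrite /enum_upto mem_pmap; apply/mapP/idP => [[k + h]|h].
  by rewrite mem_iota add0n => /andP[_]; have := @pickle_invK I k; rewrite -h /= => ->.
by exists (pickle i); rewrite ?mem_iota ?add0n// pickleK_inv.
Qed.

Lemma series_enum a m :
  series (fun k => oapp a 0 (@pickle_inv I k)) m = \sum_(i <- enum_upto m) a i.
Proof.
rewrite /series /= /index_iota subn0 /enum_upto.
by elim: (iota 0 m) => [|k s IH] /=; rewrite ?big_nil// big_cons IH;
  case: pickle_inv => [i|] /=; rewrite ?big_cons ?add0r.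
Qed.

Lemma ler_sum_sub (J : eqType) (c : J -> R) (s t : seq J) : (forall i, 0 <= c i) ->
  uniq s -> {subset s <= t} -> \sum_(i <- s) c i <= \sum_(i <- t) c i.
Proof.
move=> c0; elim: s t => [|j s IH] t /=; first by rewrite big_nil sumr_ge0.
move=> /andP[js us] st; have jt : j \in t by apply: st; rewrite mem_head.
rewrite big_cons (perm_big _ (perm_to_rem jt)) big_cons lerD2l; apply: IH => // i si.
have it : i \in t by apply: st; rewrite inE si orbT.
have : i \in j :: rem j t by rewrite -(perm_mem (perm_to_rem jt)).
by rewrite inE => /predU1P[ij|//]; move: js; rewrite -ij si.
Qed.

Lemma csum_fin_le a (s : seq I) : (forall i, 0 <= a i) -> csummable a -> uniq s ->
  \sum_(i <- s) a i <= csum a.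
Proof.
move=> a0 sa us; pose m := (\max_(i <- s) (pickle i).+1)%N.
apply: le_trans (series_le_csum m a0 sa); rewrite series_enum; apply: ler_sum_sub => // i si.
by rewrite mem_enum_upto /m; exact: leq_bigmax_seq.
Qed.

Lemma csum_fin_bound a (M : R) : (forall i, 0 <= a i) ->
  (forall s, uniq s -> \sum_(i <- s) a i <= M) -> csummable a /\ csum a <= M.
Proof.
by move=> a0 h; apply: csummable_bound => // m; rewrite series_enum h// enum_upto_uniq.
Qed.

Lemma csum_single (i : I) (b : R) : csum (fun j => if j == i then b else 0) = b.
Proof.
pose d j : R := (j == i)%:R.
have d0 j : 0 <= d j by rewrite ler0n.
have [sd d1] : csummable d /\ csum d <= 1.
  apply: csum_fin_bound => // s us; rewrite /d.
  have [si|si] := boolP (i \in s).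
    rewrite (bigD1_seq i)//= eqxx big1 ?addr0// => j ji.
    by rewrite (negbTE ji).
  rewrite big1_seq// => j /= sj.
  by have [ji|//] := eqVneq j i; move: si; rewrite -ji sj.
have d2 : 1 <= csum d.
  have := csum_fin_le d0 sd (isT : uniq [:: i]).
  by rewrite big_seq1 /d eqxx.
rewrite (_ : (fun j => _) = fun j => b * d j); last first.
  by apply/funext => j; rewrite /d; case: ifP; rewrite ?mulr1 ?mulr0.
rewrite csumZ// (_ : csum d = 1) ?mulr1//; exact/le_anti/andP.
Qed.

End csum_finite.

Section l2_basic.
Context (R : realType) (I : countType).
Implicit Types (K : hilbertType R).

Lemma l2P K (x : l2 I K) : csummable (fun i => sqnorm (x i)).
Proof. by have := l2_mem x; rewrite unfold_in => /asboolP. Qed.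

Lemma l2_ext K (x y : l2 I K) : (forall i, x i = y i) -> x = y.
Proof. by move=> xy; apply: val_inj; apply/funext. Qed.

Lemma sqnorm_l2 K (x : l2 I K) : sqnorm x = csum (fun i => sqnorm (x i)).
Proof. by []. Qed.

Lemma l2D K (x y : l2 I K) i : (x + y) i = x i + y i. Proof. by []. Qed.
Lemma l2Z K a (x : l2 I K) i : (a *: x) i = a *: x i. Proof. by []. Qed.
Lemma l2N K (x : l2 I K) i : (- x) i = - x i. Proof. by []. Qed.
Lemma l20 K i : (0 : l2 I K) i = 0. Proof. by []. Qed.

Lemma l2_sum K (J : Type) (s : seq J) (P : pred J) (F : J -> l2 I K) i :
  (\sum_(j <- s | P j) F j) i = \sum_(j <- s | P j) F j i.
Proof. by elim/big_rec2: _ => [//|j a b _ <-]. Qed.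

Lemma sqnorm_l2_fin K (x : l2 I K) (s : seq I) : uniq s ->
  \sum_(i <- s) sqnorm (x i) <= sqnorm x.
Proof. by move=> us; apply: csum_fin_le => //; [move=> i; exact: sqnorm_ge0|exact: l2P]. Qed.

Lemma sqnorm_l2_le K (x : l2 I K) (M : R) :
  (forall s, uniq s -> \sum_(i <- s) sqnorm (x i) <= M) -> sqnorm x <= M.
Proof. by move=> h; apply: (csum_fin_bound _ h).2 => i; exact: sqnorm_ge0. Qed.

Lemma sqnorm_l2_i K (x : l2 I K) i : sqnorm (x i) <= sqnorm x.
Proof. by have := sqnorm_l2_fin x (isT : uniq [:: i]); rewrite big_seq1. Qed.

Lemma rn_l2_i K (x : l2 I K) i : rn (x i) <= rn x.
Proof. by rewrite rn_le sqnorm_l2_i. Qed.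

Lemma ldeltaE K (i j : I) (v : K) : ldelta i v j = if j == i then v else 0.
Proof. by []. Qed.

Lemma inner_ldelta K (x : l2 I K) i (v : K) : inner x (ldelta i v) = inner (x i) v.
Proof.
transitivity (Complex (csum (fun j => complex.Re (inner (x j) (ldelta i v j))))
    (csum (fun j => complex.Im (inner (x j) (ldelta i v j))))) => //.
have -> : (fun j => complex.Re (inner (x j) (ldelta i v j))) =
    fun j => if j == i then complex.Re (inner (x i) v) else 0.
  by apply/funext => j; rewrite ldeltaE; case: eqP => [->//|_]; rewrite inner0r.
have -> : (fun j => complex.Im (inner (x j) (ldelta i v j))) =
    fun j => if j == i then complex.Im (inner (x i) v) else 0.
  by apply/funext => j; rewrite ldeltaE; case: eqP => [->//|_]; rewrite inner0r.
by rewrite !csum_single; case: (inner (x i) v).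
Qed.

Lemma sqnorm_ldelta K (i : I) (v : K) : sqnorm (ldelta i v) = sqnorm v.
Proof. by rewrite /sqnorm inner_ldelta ldeltaE eqxx. Qed.

Lemma rn_ldelta K (i : I) (v : K) : rn (ldelta i v) = rn v.
Proof. by rewrite /rn sqnorm_ldelta. Qed.

Lemma ldeltaZ K (i : I) a (v : K) : ldelta i (a *: v) = a *: ldelta i v.
Proof. by apply: l2_ext => j; rewrite l2Z !ldeltaE; case: ifP => //; rewrite scaler0. Qed.

Lemma bo_coord K (i : I) : bounded_op (fun x : l2 I K => x i).
Proof. by apply: bo_isom => // x; exact: rn_l2_i. Qed.

Definition ldelta_set K : set (l2 I K) := [set x | exists i v, x = ldelta i v].

Lemma total_ldelta K : total_set (@ldelta_set K).
Proof.
move=> x h; apply: l2_ext => i; apply: inner_extl => v.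
by rewrite -inner_ldelta h ?inner0l//; exists i, v.
Qed.

Definition mkl2 K (x : I -> K) : l2 I K := insubd (0 : l2 I K) x.

Lemma mkl2E K (x : I -> K) i : is_l2 x -> mkl2 x i = x i.
Proof. by move=> h; rewrite /mkl2 val_insubd unfold_in asboolT. Qed.

Lemma is_l2_fin K (x : I -> K) (M : R) :
  (forall s, uniq s -> \sum_(i <- s) sqnorm (x i) <= M) -> is_l2 x.
Proof. by move=> h; apply: (csum_fin_bound _ h).1 => i; exact: sqnorm_ge0. Qed.

Lemma etensE K (c : l2 I (cplx R)) (v : K) i : etens c v i = (c i : R[i]) *: v.
Proof. by []. Qed.

Lemma etensDl K (c d : l2 I (cplx R)) (v : K) : etens (c + d) v = etens c v + etens d v.
Proof. by apply: l2_ext => i; rewrite l2D !etensE -scalerDl. Qed.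

Lemma etensZl K a (c : l2 I (cplx R)) (v : K) : etens (a *: c) v = a *: etens c v.
Proof. by apply: l2_ext => i; rewrite l2Z !etensE scalerA. Qed.

Lemma etensDr K (c : l2 I (cplx R)) (v w : K) : etens c (v + w) = etens c v + etens c w.
Proof. by apply: l2_ext => i; rewrite l2D !etensE -scalerDr. Qed.

Lemma etensZr K a (c : l2 I (cplx R)) (v : K) : etens c (a *: v) = a *: etens c v.
Proof. by apply: l2_ext => i; rewrite l2Z !etensE !scalerA mulrC. Qed.

Lemma ldelta_etens K (i : I) (v : K) : ldelta i v = etens (ldelta i (1 : cplx R)) v.
Proof.
apply: l2_ext => j; rewrite etensE !ldeltaE; case: ifP => _; first by rewrite scale1r.
by rewrite scale0r.
Qed.

Lemma etens_ldelta K (i : I) (a : cplx R) (v : K) : etens (ldelta i a) v = ldelta i ((a : R[i]) *: v).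
Proof.
apply: l2_ext => j; rewrite etensE !ldeltaE; case: ifP => // _.
by rewrite scale0r.
Qed.

Lemma sqnorm_etens K (c : l2 I (cplx R)) (v : K) : sqnorm (etens c v) = sqnorm c * sqnorm v.
Proof.
rewrite !sqnorm_l2 mulrC -csumZ; last exact: l2P.
congr csum; apply/funext => i; rewrite etensE sqnormZ mulrC; congr (_ * _).
by rewrite /sqnorm /inner /=; case: (c i) => a b /=; rewrite mulrN opprK -!expr2.
Qed.

Lemma rn_etens K (c : l2 I (cplx R)) (v : K) : rn (etens c v) = rn c * rn v.
Proof. by rewrite /rn sqnorm_etens sqrtrM// sqnorm_ge0. Qed.

Lemma bo_etensl K (v : K) : bounded_op (fun c : l2 I (cplx R) => etens c v).
Proof.
apply: (@boP _ _ _ _ (rn v)) => [a x y|x]; first by rewrite etensDl etensZl.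
by rewrite rn_etens mulrC.
Qed.

Lemma bo_etensr K (c : l2 I (cplx R)) : bounded_op (fun v : K => etens c v).
Proof.
apply: (@boP _ _ _ _ (rn c)) => [a x y|x]; first by rewrite etensDr etensZr.
by rewrite rn_etens.
Qed.

Lemma inner_etens K (c d : l2 I (cplx R)) (v w : K) :
  inner (etens c v) (etens d w) = inner c d * inner v w.
Proof.
have bE := bo_etensl w; rewrite (adjEr _ _ bE).
suff -> : adj (fun c => etens c w) (etens c v) = inner v w *: c by rewrite innerZl mulrC.
apply/eqP; rewrite -subr_eq0; apply/eqP; apply: total_ldelta => _ [i [a ->]].
rewrite innerBl -(adjEr _ _ bE) etens_ldelta inner_ldelta etensE innerZl innerZr.
rewrite innerZl inner_ldelta /inner /=.
by apply/eqP; rewrite subr_eq0; apply/eqP; rewrite mulrA mulrC.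
Qed.

Definition etens_set K : set (l2 I K) := [set x | exists c v, x = etens c v].

Lemma total_etens K : total_set (@etens_set K).
Proof.
by move=> x h; apply: total_ldelta => _ [i [v ->]]; apply: h; rewrite ldelta_etens; exists (ldelta i (1 : cplx R)), v.
Qed.

(** Tensoring an operator with the identity does not increase its norm: for a
    finite sum of elementary tensors, orthogonalise the right factors against
    the first one; the sum splits into two orthogonal parts and one recurses. *)
Lemma etens_sum_bound K (A : l2 I (cplx R) -> l2 I (cplx R)) (M : R) :
  bounded_op A -> 0 <= M -> (forall x, rn (A x) <= M * rn x) ->
  forall s : seq (l2 I (cplx R) * K),
    rn (\sum_(p <- s) etens (A p.1) p.2) <= M * rn (\sum_(p <- s) etens p.1 p.2).
Proof.
move=> bA M0 AM s; have [k] := ubnP (size s); elim: k s => // k IH [|[c0 v0] s].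
  by rewrite !big_nil !rn0 mulr0.
rewrite ltnS /= => sk; rewrite !big_cons /=.
have [->|v0n] := eqVneq v0 0.
  rewrite !(bo0 (bo_etensr _ _)) !add0r; exact: IH.
have vv : inner v0 v0 != 0 by apply: contra_neq v0n; exact: inner_eq0.
pose a (p : l2 I (cplx R) * K) := inner p.2 v0 / inner v0 v0.
pose s' := [seq (p.1, p.2 - a p *: v0) | p <- s].
pose c1 := c0 + \sum_(p <- s) a p *: p.1.
have split (B : l2 I (cplx R) -> l2 I (cplx R)) : bounded_op B ->
    etens (B c0) v0 + \sum_(p <- s) etens (B p.1) p.2 =
    \sum_(p <- s') etens (B p.1) p.2 + etens (B c1) v0.
  move=> bB; rewrite (boD _ _ bB) (bo_sum _ _ _ bB) etensDl addrCA; congr (_ + _).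
  rewrite (bo_sum _ _ _ (bo_etensl _)) big_map -big_split /=; apply: eq_bigr => p _.
  by rewrite (boZ _ _ bB) etensZl -etensZr -etensDr subrK.
have orth (B : l2 I (cplx R) -> l2 I (cplx R)) :
    inner (\sum_(p <- s') etens (B p.1) p.2) (etens (B c1) v0) = 0.
  rewrite inner_suml big_map big1// => p _; rewrite inner_etens /= innerBl innerZl /a.
  by rewrite mulfVK// subrr mulr0.
rewrite (split _ bA) (split idfun (bo_id _)) sqnorm_rn_le// !sqnorm_orth ?orth ?(orth idfun)//.
rewrite mulrDr lerD//; first by rewrite -sqnorm_rn_le//; apply: IH; rewrite size_map.
by rewrite !sqnorm_etens mulrA ler_wpM2r ?sqnorm_ge0// -sqnorm_rn_le.
Qed.

End l2_basic.

(** * Tensor products of operators *)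

Section lmap.
Context (R : realType) (I : countType).
Implicit Types (K L : hilbertType R).

(** The operator [I (x) B], see [tensop_idl]. *)
Definition lmap K L (B : K -> L) (x : l2 I K) : l2 I L := mkl2 (fun i => B (x i)).

Lemma lmapE K L (B : K -> L) x i : bounded_op B -> lmap B x i = B (x i).
Proof.
move=> bB; apply: mkl2E; have [M M0 BM] := bo_ex bB.
apply: (@is_l2_fin _ _ _ _ (M ^+ 2 * sqnorm x)) => s us.
apply: le_trans (ler_wpM2l _ (sqnorm_l2_fin x us)); last exact: exprn_ge0.
by rewrite mulr_sumr ler_sum// => j _; rewrite -sqnorm_rn_le.
Qed.

Lemma lmap_rn K L (B : K -> L) (M : R) x : bounded_op B -> 0 <= M ->
  (forall v, rn (B v) <= M * rn v) -> rn (lmap B x) <= M * rn x.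
Proof.
move=> bB M0 BM; rewrite sqnorm_rn_le//; apply: sqnorm_l2_le => s us.
apply: le_trans (ler_wpM2l _ (sqnorm_l2_fin x us)); last exact: exprn_ge0.
by rewrite mulr_sumr ler_sum// => j _; rewrite lmapE// -sqnorm_rn_le.
Qed.

Lemma bo_lmap K L (B : K -> L) : bounded_op B -> bounded_op (lmap B).
Proof.
move=> bB; have [M M0 BM] := bo_ex bB; apply: (@boP _ _ _ _ M) => [a x y|x].
  by apply: l2_ext => i; rewrite l2D l2Z !lmapE// l2D l2Z (boD _ _ bB) (boZ _ _ bB).
exact: lmap_rn.
Qed.

Lemma lmap_etens K L (B : K -> L) c v : bounded_op B -> lmap B (etens c v) = etens c (B v).
Proof. by move=> bB; apply: l2_ext => i; rewrite lmapE// !etensE (boZ _ _ bB). Qed.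

End lmap.

Lemma sum_seq1 (V : nmodType) (J : eqType) (s : seq J) (i : J) (F : J -> V) :
  uniq s -> i \in s -> (forall j, j != i -> F j = 0) -> \sum_(j <- s) F j = F i.
Proof.
move=> us si F0; rewrite (bigD1_seq i)//= [X in _ + X]big1 ?addr0// => j; exact: F0.
Qed.

Section tensop.
Context (R : realType) (I : countType).
Implicit Types (K L : hilbertType R) (A : l2 I (cplx R) -> l2 I (cplx R)).

(** On finite sums of vectors of the form [delta_i (x) v] the operator [A (x)
    I] is forced, and [etens_sum_bound] controls it; the truncations then
    converge strongly. *)
Lemma amplify_ex K A (M : R) : bounded_op A -> 0 <= M -> (forall x, rn (A x) <= M * rn x) ->
  exists T : l2 I K -> l2 I K, [/\ bounded_op T, forall c v, T (etens c v) = etens (A c) v &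
    forall x, rn (T x) <= M * rn x].
Proof.
move=> bA M0 AM.
pose t (m : nat) (x : l2 I K) := \sum_(i <- enum_upto I m) etens (A (ldelta i (1 : cplx R))) (x i).
have bt m : bounded_op (t m).
  apply: bo_bigsum => i; apply: (bo_comp (bo_coord _ i) (bo_etensr _ _)).
have tM m x : rn (t m x) <= M * rn x.
  have := etens_sum_bound bA M0 AM [seq (ldelta i (1 : cplx R), x i) | i <- enum_upto I m].
  rewrite !big_map /= => h; apply: le_trans h _; rewrite ler_wpM2l//.
  rewrite (eq_bigr (fun i => ldelta i (x i))) => [|i _]; last by rewrite -ldelta_etens.
  rewrite rn_le; set y := \sum_(i <- _) _.
  have yi i : y i = if i \in enum_upto I m then x i else 0.
    rewrite /y l2_sum; have := enum_upto_uniq I m; case: ifPn => [mi um|mi _].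
      rewrite (sum_seq1 um mi) ?ldeltaE ?eqxx// => j ji.
      by rewrite /= /ldelta_val eq_sym (negbTE ji).
    rewrite big1_seq// => j /andP[_ mj]; rewrite ldeltaE.
    by have [ij|//] := eqVneq i j; move: mi; rewrite ij mj.
  apply: sqnorm_l2_le => s us; apply: le_trans (sqnorm_l2_fin x us).
  by apply: ler_sum => i _; rewrite yi; case: ifP => // _; rewrite sqnorm0 sqnorm_ge0.
have tc x : cvg (t m x @[m --> \oo]).
  apply: (@SOT_total_cvg _ _ \oo _ _ _ t M (@ldelta_set R I K)) => //.
  - by apply: nearW.
  - exact: total_ldelta.
  - move=> _ [i [v ->]]; apply: (@cvgP _ _ (etens (A (ldelta i (1 : cplx R))) v)).
    apply: cvg_near_cst; exists (pickle i).+1 => // m /= im.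
    rewrite /t (sum_seq1 (i := i)) ?mem_enum_upto ?enum_upto_uniq// ?ldeltaE ?eqxx// => j ji.
    by rewrite /= /ldelta_val (negbTE ji) (bo0 (bo_etensr _ _)).
pose T x := lim (t m x @[m --> \oo]).
have [bT TM] : bounded_op T /\ forall x, rn (T x) <= M * rn x.
  by apply: (bo_lim (A := t) (F := \oo)) => //; apply: nearW.
have Td i (v : K) : T (ldelta i v) = etens (A (ldelta i (1 : cplx R))) v.
  apply: cvg_lim => //; apply: cvg_near_cst; exists (pickle i).+1 => // m /= im.
  rewrite /t (sum_seq1 (i := i)) ?mem_enum_upto ?enum_upto_uniq// ?ldeltaE ?eqxx// => j ji.
  by rewrite /= /ldelta_val (negbTE ji) (bo0 (bo_etensr _ _)).
exists T; split=> // c v; move: c.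
suff : (T \o (fun c => etens c v)) = (fun c => etens c v) \o A by move=> h c; exact: (congr1 (fun f => f c) h).
apply: (bo_eq_total (X := @ldelta_set R I (cplx R))).
- by apply: bo_comp => //; exact: bo_etensl.
- by apply: bo_comp => //; exact: bo_etensl.
- exact: total_ldelta.
- move=> _ [i [a ->]] /=; rewrite etens_ldelta Td.
  have -> : ldelta i a = (a : R[i]) *: ldelta i (1 : cplx R).
    by rewrite -ldeltaZ; congr ldelta; rewrite -[RHS]/((a : R[i]) * 1) mulr1.
  by rewrite (boZ _ _ bA) etensZl etensZr.
Qed.

Lemma tensopP K L A (B : K -> L) : bounded_op A -> bounded_op B ->
  bounded_op (tensop A B) /\ forall c v, tensop A B (etens c v) = etens (A c) (B v).
Proof.
move=> bA bB; rewrite /tensop; case: xgetP => [T _ //|].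
have [M M0 AM] := bo_ex bA; have [T [bT TE _]] := amplify_ex L bA M0 AM.
move=> /(_ (T \o lmap B)) []; split; first exact: (bo_comp (bo_lmap _ bB) bT).
by move=> c v /=; rewrite lmap_etens// TE.
Qed.

Lemma bo_tensop K L A (B : K -> L) : bounded_op A -> bounded_op B -> bounded_op (tensop A B).
Proof. by move=> bA /(tensopP bA)[]. Qed.

Lemma tensop_etens K L A (B : K -> L) c v : bounded_op A -> bounded_op B ->
  tensop A B (etens c v) = etens (A c) (B v).
Proof. by move=> bA /(tensopP bA)[]. Qed.

Lemma tensop_unique K L A (B : K -> L) (T : l2 I K -> l2 I L) :
  bounded_op A -> bounded_op B -> bounded_op T ->
  (forall c v, T (etens c v) = etens (A c) (B v)) -> tensop A B = T.
Proof.
move=> bA bB bT h; apply: (bo_eq_total (X := @etens_set R I K)) => //.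
- exact: bo_tensop.
- exact: total_etens.
- by move=> _ [c [v ->]]; rewrite tensop_etens.
Qed.

Lemma tensop_idl K L (B : K -> L) : bounded_op B -> tensop idfun B = @lmap R I K L B.
Proof.
move=> bB; apply: tensop_unique => //; [exact: bo_id|exact: bo_lmap|].
by move=> c v; rewrite lmap_etens.
Qed.

Lemma tensop_idlE K L (B : K -> L) x (i : I) : bounded_op B -> tensop idfun B x i = B (x i).
Proof. by move=> bB; rewrite tensop_idl// lmapE. Qed.

Lemma tensop_rn K A (M : R) x : bounded_op A -> 0 <= M -> (forall x, rn (A x) <= M * rn x) ->
  rn (tensop A (idfun : K -> K) x) <= M * rn x.
Proof.
move=> bA M0 AM; have [T [bT TE TM]] := amplify_ex K bA M0 AM.
by rewrite (tensop_unique (T := T))//; exact: bo_id.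
Qed.

Lemma tensop_comp K L (P : hilbertType R) A A' (B : K -> L) (B' : L -> P) :
  bounded_op A -> bounded_op A' -> bounded_op B -> bounded_op B' ->
  forall x, tensop A' B' (tensop A B x) = tensop (A' \o A) (B' \o B) x.
Proof.
move=> bA bA' bB bB' x; rewrite (tensop_unique (T := tensop A' B' \o tensop A B))//.
- exact: bo_comp.
- exact: bo_comp.
- by apply: bo_comp; exact: bo_tensop.
- by move=> c v /=; rewrite !tensop_etens.
Qed.

(** Adjoints are compared on elementary tensors, where the inner product
    factors. *)
Lemma tensop_adj K A : bounded_op A ->
  adj (tensop A (idfun : K -> K)) = tensop (adj A) (idfun : K -> K).
Proof.
move=> bA; have bi := bo_id K; have bT := bo_tensop bA bi; have bA' := bo_adj bA.
apply/esym/tensop_unique => //; first exact: bo_adj.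
move=> c v; apply/eqP; rewrite -subr_eq0; apply/eqP/total_etens => _ [d [w ->]].
by rewrite innerBl -(adjEr _ _ bT) tensop_etens// !inner_etens (adjEr _ _ bA) subrr.
Qed.

End tensop.

(** * Reindexing operators *)

Section reindexing.
Context (R : realType) (I : countType).
Implicit Types (K L : hilbertType R) (p q : I -> option I).

Definition pinj p := forall i j k, p i = Some k -> p j = Some k -> i = j.

(** The partial isometry of [l2] that transports the coordinate at [p j] to
    [j]; left and right creation operators on the Fock space and their
    adjoints are all of this form. *)
Definition reidx K p (x : l2 I K) : l2 I K := mkl2 (fun j => oapp x 0 (p j)).

Lemma reidx_fin K p (x : l2 I K) s : pinj p -> uniq s ->
  \sum_(j <- s) sqnorm (oapp x 0 (p j)) <= sqnorm x.
Proof.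
move=> pp us; have us' : uniq (pmap p s).
  elim: s us => //= j s IH /andP[js us]; case E: (p j) => [i|] /=; last exact: IH.
  rewrite IH// andbT mem_pmap; apply/mapP => -[k ks] /esym Ek.
  by move: js; rewrite (pp _ _ _ E Ek) ks.
apply: le_trans (sqnorm_l2_fin x us').
rewrite le_eqVlt; apply/orP; left; apply/eqP.
elim: s {us us'} => /= [|j s IH]; first by rewrite !big_nil.
by rewrite big_cons IH; case: (p j) => [i|] /=; rewrite ?big_cons// sqnorm0 add0r.
Qed.

Lemma reidxE K p (x : l2 I K) j : pinj p -> reidx p x j = oapp x 0 (p j).
Proof.
by move=> pp; apply: mkl2E; apply: is_l2_fin => s; exact: reidx_fin.
Qed.

Lemma reidx_rn K p (x : l2 I K) : pinj p -> rn (reidx p x) <= rn x.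
Proof.
move=> pp; rewrite rn_le; apply: sqnorm_l2_le => s us.
by under eq_bigr do rewrite reidxE//; exact: reidx_fin.
Qed.

Lemma bo_reidx K p : pinj p -> bounded_op (@reidx K p).
Proof.
move=> pp; apply: bo_isom => [a x y|x]; last exact: reidx_rn.
apply: l2_ext => j; rewrite l2D l2Z !reidxE//; case: (p j) => //=.
by rewrite scaler0 addr0.
Qed.

Lemma reidx_ldelta K p i j (v : K) : pinj p -> p j = Some i -> reidx p (ldelta i v) = ldelta j v.
Proof.
move=> pp pj; apply: l2_ext => k; rewrite reidxE// ldeltaE; have [->|kj] := eqVneq k j.
  by rewrite pj /= /ldelta_val eqxx.
case E: (p k) => [l|]//=; rewrite /ldelta_val; case: eqP => // li.
by move: kj; rewrite -(pp _ _ _ E (etrans pj (congr1 Some (esym li)))) eqxx.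
Qed.

Lemma reidx_ldelta0 K p i (v : K) : pinj p -> (forall j, p j <> Some i) -> reidx p (ldelta i v) = 0.
Proof.
move=> pp pj; apply: l2_ext => k; rewrite reidxE// l20.
by case E: (p k) => [l|]//=; rewrite /ldelta_val; case: eqP => // li; case: (pj k); rewrite E li.
Qed.

Lemma reidx_adj K p q : pinj p -> pinj q -> (forall i j, p i = Some j <-> q j = Some i) ->
  adj (@reidx K p) = reidx q.
Proof.
move=> pp pq h; apply: adj_unique; first exact: bo_reidx.
move=> x y; have bp := bo_reidx K pp; have bq := bo_reidx K pq.
suff : adj (@reidx K p) = reidx q by move=> <-; rewrite adjE.
apply: (bo_eq_total (X := @ldelta_set R I K)) => //; [exact: bo_adj|exact: total_ldelta|].
move=> _ [i [v ->]]; apply: inner_extr => z.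
rewrite -(adjE _ _ bp) inner_ldelta reidxE//; case E: (p i) => [j|] /=.
  by rewrite (reidx_ldelta (j := j)) ?inner_ldelta//; exact/h.
by rewrite reidx_ldelta0 ?inner0l ?inner0r// => j /h; rewrite E.
Qed.

Lemma reidx_etens K p (c : l2 I (cplx R)) (v : K) : pinj p ->
  reidx p (etens c v) = etens (reidx p c) v.
Proof.
move=> pp; apply: l2_ext => j; rewrite etensE !reidxE//; case: (p j) => //=.
by rewrite scale0r.
Qed.

Lemma tensop_reidx K L p (B : K -> L) x j : pinj p -> bounded_op B ->
  tensop (reidx p) B x j = oapp (fun i => B (x i)) 0 (p j).
Proof.
move=> pp bB; rewrite (tensop_unique (T := reidx p \o lmap B)) /=.
- by rewrite reidxE//; case: (p j) => //= i; rewrite lmapE.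
- exact: bo_reidx.
- by [].
- by apply: bo_comp; [exact: bo_lmap|exact: bo_reidx].
- by move=> c v /=; rewrite lmap_etens// reidx_etens.
Qed.

End reindexing.

(** * Creation operators on the Fock space *)

Section fock.
Context (R : realType) (n : nat).
Local Notation F2 := (H2f R n).
Local Notation W := (word n).

(** Deleting the letter i at the left end, adding it there, and deleting it at
    the right end: the reindexings behind the creation operators. *)
Definition lpre (i : 'I_n) (w : W) : option W := if w is j :: a then (if j == i then Some a else None) else None.
Definition lpost (i : 'I_n) (w : W) : option W := Some (i :: w).
Definition rpre (i : 'I_n) (w : W) : option W :=
  if w is j :: a then (if last j a == i then Some (belast j a) else None) else None.

Lemma lpreP i w a : lpre i w = Some a <-> w = i :: a.
Proof.
case: w => [|j w] /=; first by [].
case: eqP => [->|ji]; split=> //; first by case=> ->.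
  by case=> ->.
by case=> /ji.
Qed.

Lemma rpreP i w a : rpre i w = Some a <-> w = rcons a i.
Proof.
case: w => [|j w] /=; first by split=> //; case: a.
rewrite lastI; case: eqP => [->|ji]; split => //.
- by case=> ->.
- by move=> /rcons_inj[->].
- by move=> /rcons_inj[_ /ji].
Qed.

Lemma pinj_lpre i : pinj (lpre i).
Proof. by move=> a b c /lpreP -> /lpreP ->. Qed.

Lemma pinj_lpost i : pinj (lpost i).
Proof. by move=> a b c [<-] []. Qed.

Lemma pinj_rpre i : pinj (rpre i).
Proof. by move=> a b c /rpreP -> /rpreP ->. Qed.

Lemma fbasis_set_total : total_set [set x : F2 | exists a : W, x = @fbasis R n a].
Proof.
move=> x h; apply: total_ldelta => _ [i [a ->]].
have -> : ldelta i a = (a : R[i]) *: @fbasis R n i.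
  by rewrite /fbasis -ldeltaZ; congr ldelta; rewrite -[RHS]/((a : R[i]) * 1) mulr1.
by rewrite innerZr h ?mulr0//; exists i.
Qed.

Lemma MshiftE (i : 'I_n) : @Mshift R n i = reidx (lpre i).
Proof.
have bS : bounded_op (@reidx R _ (cplx R) (lpre i)) by exact/bo_reidx/pinj_lpre.
have SE a : reidx (lpre i) (fbasis R a) = fbasis R (i :: a).
  by apply: reidx_ldelta; [exact: pinj_lpre|exact/lpreP].
rewrite /Mshift; case: xgetP => [S _ [h1 h2]|/(_ (reidx (lpre i))) []] //.
apply: (bo_eq_total h1 bS fbasis_set_total) => _ [a ->]; by rewrite h2 SE.
Qed.

Lemma LambdaE (i : 'I_n) : @Lambda R n i = reidx (rpre i).
Proof.
have bS : bounded_op (@reidx R _ (cplx R) (rpre i)) by exact/bo_reidx/pinj_rpre.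
have SE a : reidx (rpre i) (fbasis R a) = fbasis R (rcons a i).
  by apply: reidx_ldelta; [exact: pinj_rpre|exact/rpreP].
rewrite /Lambda; case: xgetP => [S _ [h1 h2]|/(_ (reidx (rpre i))) []] //.
apply: (bo_eq_total h1 bS fbasis_set_total) => _ [a ->]; by rewrite h2 SE.
Qed.

Lemma bo_Mshift i : bounded_op (@Mshift R n i).
Proof. by rewrite MshiftE; exact/bo_reidx/pinj_lpre. Qed.

Lemma bo_Lambda i : bounded_op (@Lambda R n i).
Proof. by rewrite LambdaE; exact/bo_reidx/pinj_rpre. Qed.

Lemma Mshift_fbasis i (a : W) : Mshift i (fbasis R a) = fbasis R (i :: a).
Proof. by rewrite MshiftE; apply: reidx_ldelta; [exact: pinj_lpre|exact/lpreP]. Qed.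

Lemma Lambda_fbasis i (a : W) : Lambda i (fbasis R a) = fbasis R (rcons a i).
Proof. by rewrite LambdaE; apply: reidx_ldelta; [exact: pinj_rpre|exact/rpreP]. Qed.

(** The left creation operator [S_i (x) I]; [bshift] is its adjoint. *)
Definition fshift (K : hilbertType R) (i : 'I_n) : H2t n K -> H2t n K :=
  tensop (Mshift i) (idfun : K -> K).
Definition bshift (K : hilbertType R) (i : 'I_n) : H2t n K -> H2t n K := reidx (lpost i).

Lemma fshiftE (K : hilbertType R) (i : 'I_n) (x : H2t n K) w :
  (fshift i x : l2 _ _) w = oapp x 0 (lpre i w).
Proof.
by rewrite /fshift MshiftE tensop_reidx//; [exact: pinj_lpre|exact: bo_id].
Qed.

Lemma fshift_reidx (K : hilbertType R) (i : 'I_n) : @fshift K i = reidx (lpre i).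
Proof.
apply/funext => x; apply: l2_ext => w; rewrite fshiftE reidxE//; exact: pinj_lpre.
Qed.

Lemma bo_fshift (K : hilbertType R) i : bounded_op (@fshift K i).
Proof. by rewrite fshift_reidx; exact/bo_reidx/pinj_lpre. Qed.

Lemma bshiftE (K : hilbertType R) (i : 'I_n) (x : H2t n K) w : (bshift i x : l2 _ _) w = x (i :: w).
Proof. by rewrite /bshift reidxE//; exact: pinj_lpost. Qed.

Lemma bo_bshift (K : hilbertType R) i : bounded_op (@bshift K i).
Proof. exact/bo_reidx/pinj_lpost. Qed.

Lemma adj_fshift (K : hilbertType R) i : adj (@fshift K i) = bshift i.
Proof.
rewrite fshift_reidx; apply: reidx_adj; [exact: pinj_lpre|exact: pinj_lpost|].
by move=> a b; rewrite lpreP /lpost; split=> [->|[]].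
Qed.

Lemma bshift_fshift (K : hilbertType R) i j (x : H2t n K) :
  bshift i (fshift j x) = if i == j then x else 0.
Proof.
apply: l2_ext => w; rewrite bshiftE fshiftE /=; case: eqP => //= _.
Qed.

End fock.

(** * Words and row contractions *)

Section words.
Context (n : nat).

Lemma sum_tuple0 (V : nmodType) (F : word n -> V) : \sum_(a : 0.-tuple 'I_n) F a = F [::].
Proof.
rewrite (bigD1 [tuple])//= big1 ?addr0// => a /negP[].
by apply/eqP; rewrite [LHS]tuple0.
Qed.

Lemma sum_tupleS (V : nmodType) k (F : word n -> V) :
  \sum_(a : k.+1.-tuple 'I_n) F a = \sum_i \sum_(a : k.-tuple 'I_n) F (i :: a).
Proof.
rewrite pair_big /= (reindex (fun p : 'I_n * k.-tuple 'I_n => [tuple of p.1 :: p.2])) //=.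
exists (fun a : k.+1.-tuple 'I_n => (thead a, [tuple of behead a])) => [[i a] _|a _] /=.
  by rewrite theadE; congr pair; apply: val_inj.
by rewrite -tuple_eta.
Qed.

Lemma sum_tuple_rcons (V : nmodType) k (F : word n -> V) :
  \sum_(a : k.+1.-tuple 'I_n) F a = \sum_(a : k.-tuple 'I_n) \sum_i F (rcons a i).
Proof.
elim: k F => [|k IH] F.
  rewrite sum_tupleS (sum_tuple0 (fun a => \sum_i F (rcons a i))); apply: eq_bigr => i _.
  by rewrite (sum_tuple0 (fun a => F (i :: a))).
rewrite sum_tupleS (sum_tupleS _ (fun a => \sum_i F (rcons a i))); apply: eq_bigr => i _.
by rewrite (IH (fun a => F (i :: a))).
Qed.

Fixpoint words_upto (m : nat) : seq (word n) :=
  if m is k.+1 then words_upto k ++ [seq tval a | a <- enum {:k.-tuple 'I_n}] else [::].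

Lemma mem_words_upto m a : (a \in words_upto m) = (size a < m)%N.
Proof.
elim: m => [|m IH] //=; rewrite mem_cat IH ltnS [RHS]leq_eqVlt orbC; congr (_ || _).
apply/mapP/eqP => [[t _ ->]|sa]; first by rewrite size_tuple.
by exists (tcast sa (in_tuple a)); rewrite ?mem_enum// val_tcast.
Qed.

Lemma words_upto_uniq m : uniq (words_upto m).
Proof.
elim: m => [|m IH] //=; rewrite cat_uniq IH /= map_inj_uniq ?enum_uniq ?andbT//; last exact: val_inj.
by apply/hasPn => _ /mapP[t _ ->]; rewrite mem_words_upto size_tuple ltnn.
Qed.

Lemma sum_words_upto (V : nmodType) m (F : word n -> V) :
  \sum_(a <- words_upto m) F a = \sum_(k < m) \sum_(a : k.-tuple 'I_n) F a.
Proof.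
elim: m => [|m IH] /=; first by rewrite big_nil big_ord0.
by rewrite big_cat IH big_ord_recr /= big_map big_enum.
Qed.

End words.

Section row_contraction.
Context (R : realType) (n : nat) (H : hilbertType R).
Implicit Types (A Y : 'I_n -> H -> H) (p : fps R n).

Lemma psum_words p Y m h : psum p Y m h = \sum_(a <- words_upto n m) p a *: word_op Y a h.
Proof. by rewrite (sum_words_upto m (fun a => p a *: word_op Y a h)). Qed.

Lemma bo_word_op Y (a : word n) : (forall i, bounded_op (Y i)) -> bounded_op (word_op Y a).
Proof.
by move=> bY; elim: a => [|i a IH] /=; [exact: bo_id|exact: bo_comp].
Qed.

Lemma bo_psum p Y m : (forall i, bounded_op (Y i)) -> bounded_op (psum p Y m).
Proof.
move=> bY; rewrite /psum; apply: bo_bigsum => k; apply: bo_bigsum => a.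
by apply: bo_scale; exact: bo_word_op.
Qed.

Lemma bo_scale_tuple (r : R) Y : (forall i, bounded_op (Y i)) ->
  forall i, bounded_op (scale_tuple r Y i).
Proof. by move=> bY i; exact: bo_scale. Qed.

Lemma word_op_scale (r : R) Y (a : word n) h : (forall i, bounded_op (Y i)) ->
  word_op (scale_tuple r Y) a h = (r ^+ size a)%:C%C *: word_op Y a h.
Proof.
move=> bY; elim: a => [|i a IH] /=; first by rewrite scale1r.
by rewrite IH /scale_tuple (boZ _ _ (bY i)) scalerA exprS rmorphM.
Qed.

Lemma word_op_rcons Y (a : word n) i h : word_op Y (rcons a i) h = word_op Y a (Y i h).
Proof. by elim: a => //= j a ->. Qed.

(** The adjoint of [word_op A a], applied letter by letter from the left. *)
Definition wadj A (a : word n) (h : H) : H := foldl (fun h i => adj (A i) h) h a.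

Lemma wadj_rcons A (a : word n) i h : wadj A (rcons a i) h = adj (A i) (wadj A a h).
Proof. by rewrite /wadj -cats1 foldl_cat. Qed.

Lemma wadjE A (a : word n) x y : (forall i, bounded_op (A i)) ->
  inner (word_op A a x) y = inner x (wadj A a y).
Proof. by move=> bA; elim: a x y => //= i a IH x y; rewrite (adjE _ _ (bA i)) IH. Qed.

Lemma wadjEr A (a : word n) x y : (forall i, bounded_op (A i)) ->
  inner (wadj A a x) y = inner x (word_op A a y).
Proof. by move=> bA; rewrite innerC -wadjE// -innerC. Qed.

Lemma bo_wadj A (a : word n) : (forall i, bounded_op (A i)) -> bounded_op (wadj A a).
Proof.
move=> bA; elim/last_ind: a => [|a i IH]; first exact: bo_id.
rewrite (_ : wadj A (rcons a i) = adj (A i) \o wadj A a).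
  by apply: bo_comp => //; exact: bo_adj.
by apply/funext => h; rewrite wadj_rcons.
Qed.

(** The row [A_1, ..., A_n] is contractive, expressed through its adjoint
    column. *)
Definition row_contr A := (forall i, bounded_op (A i)) /\
  forall h, \sum_i sqnorm (adj (A i) h) <= sqnorm h.

Lemma row_contr_level A k h : row_contr A ->
  \sum_(a : k.-tuple 'I_n) sqnorm (wadj A a h) <= sqnorm h.
Proof.
move=> [bA cA]; elim: k h => [|k IH] h.
  by rewrite (sum_tuple0 (fun a => sqnorm (wadj A a h))).
rewrite (sum_tupleS _ (fun a => sqnorm (wadj A a h))).
by apply: le_trans (cA h); apply: ler_sum => i _; exact: IH.
Qed.

(** The sum is the adjoint of the column of all [A_a^*] with a of length k,
    which is contractive by [row_contr_level]. *)
Lemma row_contr_sum A k (h : word n -> H) : row_contr A ->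
  sqnorm (\sum_(a : k.-tuple 'I_n) word_op A a (h a)) <=
  \sum_(a : k.-tuple 'I_n) sqnorm (h a).
Proof.
move=> cA; set y := \sum_(a : _) _.
have e : sqnorm y = \sum_(a : k.-tuple 'I_n) complex.Re (inner (h a) (wadj A a y)).
  rewrite {1}/sqnorm {1}/y inner_suml raddf_sum; apply: eq_bigr => a _.
  by rewrite wadjE//; case: cA.
have : sqnorm y <= 2^-1 * (\sum_(a : k.-tuple 'I_n) sqnorm (h a) + sqnorm y).
  rewrite {1}e (le_trans _ (ler_wpM2l _ (lerD (lexx _) (row_contr_level k y cA))))//.
  rewrite -big_split /= mulr_sumr; apply: ler_sum => a _.
  rewrite (le_trans (CS_Re _ _))// -!rn_sqr.
  by have := sqr_ge0 (rn (h a) - rn (wadj A a y)); rewrite sqrrB; lra.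
by lra.
Qed.

Lemma row_contr_row A (h : 'I_n -> H) : row_contr A ->
  sqnorm (\sum_i A i (h i)) <= \sum_i sqnorm (h i).
Proof.
move=> cA; have := row_contr_sum 1 (fun a => if a is i :: _ then h i else 0) cA.
have e (V : nmodType) (F : word n -> V) : \sum_(a : 1.-tuple 'I_n) F a = \sum_i F [:: i].
  by rewrite sum_tupleS; apply: eq_bigr => i _; rewrite (sum_tuple0 (fun a => F (i :: a))).
rewrite (e _ (fun a => word_op A a (if a is i :: _ then h i else 0))).
by rewrite (e _ (fun a => sqnorm (if a is i :: _ then h i else 0))).
Qed.

(** Isometries with mutually orthogonal ranges. *)
Definition row_isom A := (forall i, bounded_op (A i)) /\
  forall i j h, adj (A i) (A j h) = if i == j then h else 0.

Lemma row_isom_sum A (h : 'I_n -> H) : row_isom A ->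
  sqnorm (\sum_i A i (h i)) = \sum_i sqnorm (h i).
Proof.
case=> bA iA; rewrite {1}/sqnorm inner_suml raddf_sum; apply: eq_bigr => i _.
rewrite inner_sumr (bigD1 i)//= (adjE _ _ (bA i)) iA eqxx big1 ?addr0// => j ji.
by rewrite (adjE _ _ (bA i)) iA eq_sym (negbTE ji) inner0r.
Qed.

(** Bessel inequality for the orthogonal ranges of the [A_i]. *)
Lemma row_isom_contr A : row_isom A -> row_contr A.
Proof.
move=> iA; have [bA dA] := iA; split=> // h.
set y := \sum_i A i (adj (A i) h).
have e : inner y h = (sqnorm y)%:C%C.
  rewrite (row_isom_sum _ iA) /y inner_suml rmorph_sum /=; apply: eq_bigr => i _.
  by rewrite (adjE _ _ (bA i)) sqnormE.
rewrite -(row_isom_sum _ iA) -/y.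
have : 0 <= sqnorm (h - y) by exact: sqnorm_ge0.
rewrite sqnormD sqnormN innerNr raddfN /= (innerC y h) e.
by rewrite (_ : complex.Re (_%:C%C)^* = sqnorm y)//; lra.
Qed.

End row_contraction.

Section fock_row.
Context (R : realType) (n : nat) (K : hilbertType R).

Lemma fshift_row_isom : row_isom (@fshift R n K).
Proof.
split=> [i|i j h]; first exact: bo_fshift.
by rewrite adj_fshift bshift_fshift.
Qed.

(** A vector of the Fock space is its constant term plus the pairwise
    orthogonal parts [S_i S_i^* x]. *)
Lemma fock_decomp (x : H2t n K) : sqnorm x = sqnorm ((x : l2 _ _) [::]) + \sum_i sqnorm (bshift i x).
Proof.
rewrite -(row_isom_sum _ fshift_row_isom) -(sqnorm_ldelta ([::] : word n) ((x : l2 _ _) [::])) -sqnorm_orth.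
  congr sqnorm; apply: l2_ext => w; rewrite l2D l2_sum ldeltaE.
  case: w => [|i w] /=; first by rewrite big1 ?addr0// => i _; rewrite fshiftE.
  rewrite add0r (bigD1 i)//= fshiftE /= eqxx /= bshiftE big1 ?addr0// => j ji.
  by rewrite fshiftE /= eq_sym (negbTE ji).
rewrite inner_sumr big1// => i _.
have z v : bshift i (ldelta ([::] : word n) v : H2t n K) = 0.
  by apply: l2_ext => w; rewrite bshiftE.
by rewrite (adjEr _ _ (bo_fshift _ _)) adj_fshift z inner0l.
Qed.

End fock_row.

Lemma Mshift_row_isom (R : realType) (n : nat) : row_isom (@Mshift R n).
Proof.
have -> : @Mshift R n = @fshift R n (cplx R).
  by apply/funext => i; rewrite MshiftE fshift_reidx.
exact: fshift_row_isom.
Qed.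

(** * The functional calculus of a row contraction *)

Lemma geom_bound_cvg (R : realType) (C r : R) : 0 <= r < 1 ->
  (C * r ^+ m / (1 - r)) @[m --> \oo] --> (0 : R).
Proof.
move=> /andP[r0 r1]; rewrite -[0](mul0r (1 - r)^-1); apply: cvgMl.
rewrite -[0](mulr0 C); apply: cvgMr.
by apply: cvg_expr; rewrite ger0_norm.
Qed.

Lemma geom_series_lim (R : realType) (H : hilbertType R) (u : nat -> H) (C r : R) :
  0 <= r < 1 -> 0 <= C -> (forall k, rn (u k) <= C * r ^+ k) ->
  exists l, forall m, rn (\sum_(k < m) u k - l) <= C * r ^+ m / (1 - r).
Proof.
move=> r01 C0 uC; have rc := @geom_bound_cvg R C r r01.
have /andP[r0 r1] := r01; have r1' : 0 < 1 - r by rewrite subr_gt0.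
pose s m := \sum_(k < m) u k.
have sb m p : rn (s (m + p)%N - s m) <= C * r ^+ m * (1 - r ^+ p) / (1 - r).
  elim: p => [|p IH]; first by rewrite addn0 subrr rn0 expr0 subrr mulr0 mul0r.
  rewrite addnS /s big_ord_recr /= -/(s _) addrAC (le_trans (rnD _ _))//.
  apply: le_trans (lerD IH (uC _)) _; rewrite exprD exprS.
  rewrite -(ler_pM2r r1') mulrDl !mulfVK ?gt_eqF//.
  have := exprn_ge0 m r0; have := exprn_ge0 p r0; nra.
have sb' m p : (m <= p)%N -> rn (s p - s m) <= C * r ^+ m / (1 - r).
  move=> /subnKC <-; apply: le_trans (sb _ _) _.
  rewrite ler_pM2r ?invr_gt0// -[leRHS]mulr1 ler_wpM2l ?mulr_ge0 ?exprn_ge0//.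
  by rewrite gerBl exprn_ge0.
have sc : cvg (s m @[m --> \oo]).
  apply: hcvg_cauchy => e e0; have /cvgrPdist_lt/(_ _ e0) [N _ NP] := rc.
  exists (s N); exists N => // m /= /sb' h; apply: le_lt_trans h _.
  have := NP N (leqnn _); rewrite sub0r normrN; apply: le_lt_trans; exact: ler_norm.
exists (lim (s m @[m --> \oo])) => m.
apply: (hcvg_rn_le (F := \oo) (u := fun p => s m - s p)).
  by apply: cvgB; [exact: cvg_cst|exact: sc].
by exists m => // p /= /sb'; rewrite rnC.
Qed.

Section calculus.
Context (R : realType) (n : nat) (H : hilbertType R).
Implicit Types (A : 'I_n -> H -> H) (c d : H2f R n) (r : R).

Lemma sqnorm_cplx (a : cplx R) : sqnorm a = complex.Re (a : R[i]) ^+ 2 + complex.Im (a : R[i]) ^+ 2.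
Proof. by rewrite /sqnorm /inner /=; case: a => a b /=; rewrite mulrN opprK -!expr2. Qed.

(** Each homogeneous part is the row of the [A_a] applied to the vectors [c_a
    h], so its norm is at most that of c; the factor [r^k] then makes the
    series converge in norm. *)
Lemma level_bound A c r k h : row_contr A -> 0 <= r ->
  rn (\sum_(a : k.-tuple 'I_n) coef c a *: word_op (scale_tuple r A) a h) <=
  rn c * rn h * r ^+ k.
Proof.
move=> cA r0.
rewrite (eq_bigr (fun a : k.-tuple 'I_n => (r ^+ k)%:C%C *: word_op A a (coef c a *: h))).
  rewrite -scaler_sumr rnZr ger0_norm ?exprn_ge0// mulrC ler_wpM2r ?exprn_ge0//.
  rewrite -(ler_pXn2r (isT : (0 < 2)%N)) ?nnegrE ?mulr_ge0 ?rn_ge0//.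
  rewrite exprMn !rn_sqr; apply: le_trans (row_contr_sum k (fun a => coef c a *: h) cA) _.
  rewrite (eq_bigr (fun a : k.-tuple 'I_n => sqnorm (c a) * sqnorm h)); last first.
    by move=> a _; rewrite sqnormZ sqnorm_cplx.
  rewrite -mulr_suml ler_wpM2r ?sqnorm_ge0//.
  have := sqnorm_l2_fin c (s := [seq tval a | a <- enum {:k.-tuple 'I_n}]).
  rewrite big_map big_enum; apply.
  by rewrite map_inj_uniq ?enum_uniq//; exact: val_inj.
move=> a _; rewrite word_op_scale; last by case: cA.
by rewrite size_tuple (boZ _ _ (bo_word_op _ _)) ?scalerA 1?mulrC//; case: cA.
Qed.

(** The value at [rA] of the series with coefficients c. *)
Definition hcalc A r c (h : H) : H := lim (psum (coef c) (scale_tuple r A) m h @[m --> \oo]).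

Lemma hcalc_tail A r c m h : row_contr A -> 0 <= r < 1 ->
  rn (psum (coef c) (scale_tuple r A) m h - hcalc A r c h) <= rn c * rn h * r ^+ m / (1 - r).
Proof.
move=> cA r01; have /andP[r0 r1] := r01.
have [|l lP] := @geom_series_lim R H (fun k => \sum_(a : k.-tuple 'I_n) coef c a *:
   word_op (scale_tuple r A) a h) (rn c * rn h) r r01 (mulr_ge0 (rn_ge0 _) (rn_ge0 _)).
  by move=> k; exact: level_bound.
have rc := @geom_bound_cvg R (rn c * rn h) r r01.
suff -> : hcalc A r c h = l by exact: lP.
apply: cvg_lim => //; apply/hcvg => e e0.
have /cvgrPdist_lt/(_ _ e0) := rc; apply: filterS => k; rewrite sub0r normrN => h1.
by apply: le_lt_trans h1; apply: le_trans (ler_norm _); exact: lP.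
Qed.

Lemma hcalc_cvg A r c h : row_contr A -> 0 <= r < 1 ->
  psum (coef c) (scale_tuple r A) m h @[m --> \oo] --> hcalc A r c h.
Proof.
move=> cA r01; have /andP[r0 r1] := r01; apply/hcvg => e e0.
have rc := @geom_bound_cvg R (rn c * rn h) r r01.
have /cvgrPdist_lt/(_ _ e0) := rc; apply: filterS => k; rewrite sub0r normrN => h1.
by apply: le_lt_trans h1; apply: le_trans (ler_norm _); exact: hcalc_tail.
Qed.

Lemma hcalc_rn A r c h : row_contr A -> 0 <= r < 1 ->
  rn (hcalc A r c h) <= rn c * (1 - r)^-1 * rn h.
Proof.
move=> cA r01; have := hcalc_tail c 0 h cA r01.
by rewrite {1}/psum big_ord0 sub0r rnN expr0 mulr1 mulrAC.
Qed.

Lemma bo_hcalc A r c : row_contr A -> 0 <= r < 1 -> bounded_op (hcalc A r c).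
Proof.
move=> cA r01; apply: (@boP _ _ _ _ (rn c * (1 - r)^-1)) => [a x y|x]; last exact: hcalc_rn.
have bp m := bo_psum (coef c) m (bo_scale_tuple r cA.1).
apply: (hcvg_unique (F := \oo) (u := fun m => psum (coef c) (scale_tuple r A) m (a *: x + y))).
  exact: hcalc_cvg.
rewrite (_ : (fun m => _) = (fun m => a *: psum (coef c) (scale_tuple r A) m x
   + psum (coef c) (scale_tuple r A) m y)); last first.
  by apply/funext => m; rewrite (boD _ _ (bp m)) (boZ _ _ (bp m)).
by apply: cvgD; [apply: cvgZr|]; exact: hcalc_cvg.
Qed.

Lemma bo_hcalcl A r h : row_contr A -> 0 <= r < 1 -> bounded_op (fun c => hcalc A r c h).
Proof.
move=> cA r01; apply: (@boP _ _ _ _ ((1 - r)^-1 * rn h)) => [a x y|x]; last first.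
  by apply: le_trans (hcalc_rn x h cA r01) _; rewrite [leRHS]mulrC mulrA.
apply: (hcvg_unique (F := \oo) (u := fun m => psum (coef (a *: x + y)) (scale_tuple r A) m h)).
  exact: hcalc_cvg.
rewrite (_ : (fun m => _) = (fun m => a *: psum (coef x) (scale_tuple r A) m h
   + psum (coef y) (scale_tuple r A) m h)); last first.
  apply/funext => m; rewrite !psum_words scaler_sumr -big_split /=; apply: eq_bigr => w _.
  by rewrite scalerA -scalerDl.
by apply: cvgD; [apply: cvgZr|]; exact: hcalc_cvg.
Qed.

Lemma eval_norm_hcalc A r c : row_contr A -> 0 <= r < 1 ->
  eval_norm (coef c) (scale_tuple r A) (hcalc A r c).
Proof.
move=> cA r01; have /andP[r0 r1] := r01; split; first exact: bo_hcalc.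
have rc := @geom_bound_cvg R (rn c) r r01.
apply/cvgrPdist_lt => e e0; have /cvgrPdist_lt/(_ _ e0) := rc; apply: filterS => m.
rewrite !sub0r !normrN; have h0 : 0 <= rn c * r ^+ m / (1 - r).
  by rewrite divr_ge0 ?mulr_ge0 ?rn_ge0 ?exprn_ge0// subr_ge0 ltW.
have bd := bo_sub (bo_psum (coef c) m (bo_scale_tuple r cA.1)) (bo_hcalc c cA r01).
rewrite [`|rn c * _ / _|]ger0_norm// ger0_norm; last exact: (opnorm_ge0 bd).
apply: le_lt_trans; apply: opnorm_le => // x /=.
by apply: le_trans (hcalc_tail c m x cA r01) _; rewrite -!mulrA ler_wpM2l ?rn_ge0// mulrC mulrA.
Qed.

Lemma hcalc_fbasis A r (a : word n) h : row_contr A -> 0 <= r < 1 ->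
  hcalc A r (fbasis R a) h = word_op (scale_tuple r A) a h.
Proof.
move=> cA r01; apply: cvg_lim => //; apply: cvg_near_cst; exists (size a).+1 => // m /= am.
rewrite psum_words (sum_seq1 (i := a)) ?words_upto_uniq ?mem_words_upto//.
  by rewrite /coef /fbasis ldeltaE eqxx scale1r.
by move=> b ba; rewrite /coef /fbasis ldeltaE (negbTE ba) scale0r.
Qed.

(** Right creation appends a letter to the words of the series, hence a factor
    [r A_j] on the right. *)
Lemma hcalc_Lambda A r c j h : row_contr A -> 0 <= r < 1 ->
  hcalc A r (Lambda j c) h = hcalc A r c (scale_tuple r A j h).
Proof.
move=> cA r01.
suff /(congr1 (fun F => F c)) /= -> : (fun c => hcalc A r c (scale_tuple r A j h)) =
   (fun c => hcalc A r c h) \o Lambda j by [].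
apply: (bo_eq_total _ _ (@fbasis_set_total R n)).
- exact: bo_hcalcl.
- by apply: bo_comp; [exact: bo_Lambda|exact: bo_hcalcl].
- by move=> _ [a ->] /=; rewrite Lambda_fbasis !hcalc_fbasis// word_op_rcons.
Qed.

End calculus.

(** Operators that commute with the right creation operators; such an operator
    is determined by its value at the vacuum. *)
Definition analytic (R : realType) (n : nat) (M : H2f R n -> H2f R n) : Prop :=
  bounded_op M /\ forall j c, M (Lambda j c) = Lambda j (M c).

Section analytic.
Context (R : realType) (n : nat).
Implicit Types (M : H2f R n -> H2f R n).

Definition rapp (a : word n) (c : H2f R n) : H2f R n := foldl (fun c i => Lambda i c) c a.

Lemma rapp_rcons a i c : rapp (rcons a i) c = Lambda i (rapp a c).
Proof. by rewrite /rapp -cats1 foldl_cat. Qed.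

Lemma bo_rapp a : bounded_op (rapp a).
Proof.
elim/last_ind: a => [|a i IH]; first exact: bo_id.
rewrite (_ : rapp (rcons a i) = Lambda i \o rapp a).
  by apply: bo_comp => //; exact: bo_Lambda.
by apply/funext => h; rewrite rapp_rcons.
Qed.

Lemma rapp_fbasis a b : rapp a (fbasis R b) = fbasis R (b ++ a).
Proof.
elim/last_ind: a => [|a i IH]; first by rewrite cats0.
by rewrite rapp_rcons IH Lambda_fbasis rcons_cat.
Qed.

Lemma analytic_rapp M a c : analytic M -> M (rapp a c) = rapp a (M c).
Proof.
case=> bM cM; elim/last_ind: a => [//|a i IH].
by rewrite !rapp_rcons cM IH.
Qed.

Lemma analytic_fbasis M a : analytic M -> M (fbasis R a) = rapp a (M (fbasis R [::])).
Proof. by move=> aM; rewrite -analytic_rapp// rapp_fbasis. Qed.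

Lemma hcalc_analytic (H : hilbertType R) (A : 'I_n -> H -> H) r M a h : row_contr A -> 0 <= r < 1 ->
  analytic M -> hcalc A r (M (fbasis R a)) h =
    hcalc A r (M (fbasis R [::])) (word_op (scale_tuple r A) a h).
Proof.
move=> cA r01 aM; rewrite analytic_fbasis//.
elim/last_ind: a h => [//|a i IH] h.
by rewrite rapp_rcons hcalc_Lambda// IH word_op_rcons.
Qed.

End analytic.

Lemma Re_realM (R : realType) (q : R) (z : R[i]) : complex.Re (q%:C%C * z) = q * complex.Re z.
Proof. by case: z => a b /=; rewrite mul0r subr0. Qed.

Section poisson.
Context (R : realType) (n : nat) (H : hilbertType R) (A : 'I_n -> H -> H).
Context (cA : row_contr A) (r : R) (r01 : 0 <= r < 1).

Let bA := cA.1.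
Let r0 : 0 <= r. Proof. by case/andP: r01. Qed.
Let r1 : r < 1. Proof. by case/andP: r01. Qed.

Let B (h : H) : H := (r ^+ 2)%:C%C *: \sum_i A i (adj (A i) h).

Let bB : bounded_op B.
Proof.
apply: bo_scale; apply: bo_bigsum => i.
by apply: bo_comp => //; exact: bo_adj.
Qed.

Let innerB x y : inner (B x) y = (r ^+ 2)%:C%C * \sum_i inner (adj (A i) x) (adj (A i) y).
Proof.
rewrite innerZl inner_suml; congr (_ * _); apply: eq_bigr => i _.
by rewrite (adjE _ _ (bA i)).
Qed.

Let sB x y : inner (B x) y = inner x (B y).
Proof.
rewrite innerB (innerC (B y)) innerB; move: (r ^+ 2) => q.
rewrite rmorphM rmorph_sum; congr (_ * _).
  exact/esym/conjc_real.
by apply: eq_bigr => i _; exact: innerC.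
Qed.

Let B1 x : rn (B x) <= rn x.
Proof.
have r21 : r ^+ 2 <= 1 by rewrite expr_le1// ltW.
rewrite rnZr ger0_norm ?exprn_ge0// -[leRHS]mul1r ler_pM ?exprn_ge0 ?rn_ge0//.
rewrite rn_le; apply: le_trans (cA.2 x).
exact: (row_contr_row (fun i => adj (A i) x) cA).
Qed.

(** D is the defect operator of [rA]; the Poisson kernel K below sends h to the
    family [r^|a| D A_a^* h]. *)
Let D := opsqrt (fun h => h - B h).
Let bD : bounded_op D. Proof. by case: (opsqrtP bB sB B1). Qed.
Let sD x y : inner (D x) y = inner x (D y).
Proof. by have [_ h _ _] := opsqrtP bB sB B1; exact: pos_self. Qed.
Let DD x : D (D x) = x - B x. Proof. by case: (opsqrtP bB sB B1). Qed.

Let sqD x : sqnorm (D x) = sqnorm x - r ^+ 2 * \sum_i sqnorm (adj (A i) x).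
Proof.
rewrite /sqnorm -sD DD innerBl innerB raddfB /=; congr (_ - _).
by rewrite Re_realM raddf_sum.
Qed.

Let kfun h (a : word n) : H := (r ^+ size a)%:C%C *: D (wadj A a h).

(** Telescoping: the level m of the kernel is the decrease of the weighted sums
    of [|A_a^* h|^2] from level m to level [m + 1]. *)
Let ksum h m : \sum_(a <- words_upto n m) sqnorm (kfun h a) =
  sqnorm h - r ^+ (2 * m) * \sum_(a : m.-tuple 'I_n) sqnorm (wadj A a h).
Proof.
elim: m => [|m IH].
  by rewrite big_nil expr0 mul1r (sum_tuple0 (fun a => sqnorm (wadj A a h))) subrr.
rewrite /= big_cat IH big_map big_enum /= -addrA; congr (_ + _).
rewrite (sum_tuple_rcons _ (fun a => sqnorm (wadj A a h))).
rewrite [X in _ + X = _](eq_bigr (fun a : m.-tuple 'I_n => r ^+ (2 * m) * sqnorm (wadj A a h) -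
   r ^+ (2 * m.+1) * \sum_i sqnorm (wadj A (rcons a i) h))).
  by rewrite big_split /= sumrN -!mulr_sumr addrA addNr sub0r.
move=> a _; rewrite /kfun sqnormZr size_tuple -exprM mulnC sqD mulrBr mulrA -exprD.
by congr (_ - _ * _); [congr (_ ^+ _); rewrite mulnS addnC|apply: eq_bigr => i _; rewrite wadj_rcons].
Qed.

Let ksum_le h s : uniq s -> \sum_(a <- s) sqnorm (kfun h a) <= sqnorm h.
Proof.
move=> us; pose m := (\max_(a <- s) (size a).+1)%N.
apply: (@le_trans _ _ (\sum_(a <- words_upto n m) sqnorm (kfun h a))).
  apply: ler_sum_sub => // [a|a sa]; first exact: sqnorm_ge0.
  by rewrite mem_words_upto /m; exact: leq_bigmax_seq.
rewrite ksum gerBl mulr_ge0 ?exprn_ge0// sumr_ge0// => a _; exact: sqnorm_ge0.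
Qed.

Let K (h : H) : H2t n H := mkl2 (kfun h).

Let KE h a : (K h : l2 _ _) a = kfun h a.
Proof. by apply: mkl2E; apply: is_l2_fin => s; exact: ksum_le. Qed.

Let Kiso h : rn (K h) = rn h.
Proof.
apply/le_anti; rewrite !rn_le; apply/andP; split.
  by apply: sqnorm_l2_le => s us; under eq_bigr do rewrite KE; exact: ksum_le.
have h1 m : sqnorm h - (r ^+ 2) ^+ m * sqnorm h <= sqnorm (K h).
  apply: le_trans (sqnorm_l2_fin _ (words_upto_uniq n m)).
  under eq_bigr do rewrite KE.
  rewrite ksum -exprM lerD2l lerN2 ler_wpM2l ?exprn_ge0//.
  exact: row_contr_level.
have c1 : (sqnorm h - (r ^+ 2) ^+ m * sqnorm h) @[m --> \oo] --> sqnorm h - 0 * sqnorm h.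
  apply: cvgB; first exact: cvg_cst.
  apply: cvgMl; apply: cvg_expr; rewrite ger0_norm ?exprn_ge0// expr_lt1//.
rewrite mul0r subr0 in c1.
by apply: (ler_cvg_to c1 (cvg_cst _)); exact: nearW.
Qed.

Let bK : bounded_op K.
Proof.
apply: bo_isom => [a x y|x]; last by rewrite Kiso.
apply: l2_ext => w; rewrite l2D l2Z !KE /kfun.
have bw := bo_comp (bo_wadj w bA) bD.
by rewrite [D _](boD (a *: x) y bw) (boZ a x bw) /= scalerDr !scalerA mulrC.
Qed.

Let adjK_ldelta (a : word n) d : adj K (ldelta a d) = word_op (scale_tuple r A) a (D d).
Proof.
apply: inner_extr => z; rewrite -(adjE _ _ bK) inner_ldelta KE /kfun word_op_scale//.
rewrite innerZl innerZr sD (wadjEr _ _ _ bA); congr (_ * _).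
exact/esym/conjc_real.
Qed.

Let adjK_etens c d : adj K (etens c d) = hcalc A r c (D d).
Proof.
suff /(congr1 (fun F => F c)) : adj K \o (fun c => etens c d) = (fun c => hcalc A r c (D d)) by [].
apply: (bo_eq_total _ _ (@fbasis_set_total R n)).
- by apply: bo_comp; [exact: bo_etensl|exact: bo_adj].
- exact: bo_hcalcl.
- by move=> _ [a ->] /=; rewrite hcalc_fbasis// -adjK_ldelta ldelta_etens.
Qed.

(** The von Neumann inequality: the Poisson kernel K of [rA] is an isometry
    into the Fock space, and its adjoint intertwines [M (x) I] with the value
    of M at [rA]. *)
Lemma von_neumann M (mu : R) h : analytic M -> 0 <= mu -> (forall c, rn (M c) <= mu * rn c) ->
  rn (hcalc A r (M (fbasis R [::])) h) <= mu * rn h.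
Proof.
move=> aM mu0 Mmu; have bM := aM.1.
have bT := bo_tensop bM (bo_id H); have bG := bo_hcalc (M (fbasis R [::])) cA r01.
have key : adj K \o tensop M (idfun : H -> H) = hcalc A r (M (fbasis R [::])) \o adj K.
  apply: (bo_eq_total _ _ (@total_ldelta R _ H)).
  - by apply: bo_comp => //; exact: bo_adj.
  - by apply: bo_comp => //; exact: bo_adj.
  - move=> _ [a [d ->]] /=; rewrite adjK_ldelta -hcalc_analytic// -adjK_etens.
    by rewrite ldelta_etens tensop_etens//; exact: bo_id.
rewrite -{1}(isometry_adjK bK Kiso h) -[X in rn X](congr1 (fun F => F (K h)) key) /=.
rewrite (le_trans (adj_contr bK _ _))// => [x|]; first by rewrite Kiso.
by rewrite -(Kiso h); exact: tensop_rn.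
Qed.

End poisson.

Lemma expr_cvg_left1 (R : realType) k : (r ^+ k : R) @[r --> (1:R)^'-] --> (1 ^+ k : R).
Proof.
elim: k => [|k IH]; first exact: cvg_cst.
rewrite (_ : (fun r : R => _) = (fun r => r * r ^+ k)); last first.
  by apply/funext => r; rewrite exprS.
by rewrite exprS; apply: cvgM => //; apply: cvg_at_left_filter; exact: cvg_id.
Qed.

Lemma near_left01 (R : realType) : \forall r \near (1:R)^'-, 0 <= r < 1.
Proof.
near=> r; apply/andP; split; near: r; last exact: nbhs_left_lt.
by apply: nbhs_left_ge.
Unshelve. all: by end_near. Qed.

Section abel_means.
Context (R : realType) (I : countType) (K : hilbertType R) (e : I -> nat).

(** The Abel means of c, with the coordinate a weighted by [r^(e a)]. *)
Definition diag (r : R) (c : l2 I K) : l2 I K := mkl2 (fun a => (r ^+ e a)%:C%C *: c a).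

Lemma diag_le (r : R) (c : l2 I K) a : 0 <= r <= 1 ->
  sqnorm ((r ^+ e a)%:C%C *: c a) <= sqnorm (c a).
Proof.
move=> /andP[r0 r1]; rewrite sqnormZr -[leRHS]mul1r ler_wpM2r ?sqnorm_ge0//.
by rewrite !exprn_ile1 ?exprn_ge0.
Qed.

Lemma diagE (r : R) (c : l2 I K) a : 0 <= r <= 1 -> diag r c a = (r ^+ e a)%:C%C *: c a.
Proof.
move=> r01; apply: mkl2E; apply: (@is_l2_fin _ _ _ _ (sqnorm c)) => s us.
by apply: le_trans (sqnorm_l2_fin c us); apply: ler_sum => w _; exact: diag_le.
Qed.

Lemma bo_diag (r : R) : 0 <= r <= 1 -> bounded_op (diag r) /\ forall c, rn (diag r c) <= rn c.
Proof.
move=> r01; have h c : rn (diag r c) <= rn c.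
  rewrite rn_le; apply: sqnorm_l2_le => s us.
  by apply: le_trans (sqnorm_l2_fin c us); apply: ler_sum => w _; rewrite diagE//; exact: diag_le.
split=> //; apply: bo_isom => // a x y.
by apply: l2_ext => w; rewrite l2D l2Z !diagE// l2D l2Z scalerDr !scalerA mulrC.
Qed.

Lemma diag_cvg (c : l2 I K) : diag r c @[r --> (1:R)^'-] --> c.
Proof.
pose A r := if 0 <= r <= 1 then diag r else fun=> 0.
have bA r : bounded_op (A r).
  by rewrite /A; case: ifP => [/bo_diag[]|_] //; exact: bo_zero.
have h x : A r x @[r --> (1:R)^'-] --> x.
  apply: (@SOT_total R _ (1:R)^'- _ _ _ A idfun 1 (@ldelta_set R I K)) => //.
  - apply: nearW => r y; rewrite mul1r /A; case: ifP => [/bo_diag[_]|_]; first exact.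
    by rewrite rn0 rn_ge0.
  - exact: bo_id.
  - exact: total_ldelta.
  - move=> _ [a [v ->]] /=.
    have Ae r : 0 <= r <= 1 -> A r (ldelta a v) = (r ^+ e a)%:C%C *: ldelta a v.
      move=> r01; rewrite /A r01; apply: l2_ext => w; rewrite diagE// l2Z ldeltaE.
      by case: eqP => [->//|_]; rewrite !scaler0.
    apply: hcvg_rn.
    have c0 : `|r ^+ e a - 1| * rn (ldelta a v) @[r --> (1:R)^'-] --> `|1 ^+ e a - 1| * rn (ldelta a v).
      apply: cvgMl; apply: cvg_norm; apply: cvgB; last exact: cvg_cst.
      exact: expr_cvg_left1.
    rewrite expr1n subrr normr0 mul0r in c0; apply: cvg_trans c0; apply: near_eq_cvg.
    near=> r; have r01 : 0 <= r < 1 by near: r; exact: near_left01.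
    have /andP[r0 r1] := r01.
    rewrite Ae ?r0 ?ltW//; set q := r ^+ e a; set d := ldelta a v.
    rewrite (_ : q%:C%C *: d - d = (q - 1)%:C%C *: d) ?rnZr//.
    by rewrite rmorphB scalerBl scale1r.
apply: (hcvg_near (h c)); near=> r.
have /andP[r0 r1] : 0 <= r < 1 by near: r; exact: near_left01.
by rewrite /A r0 (ltW r1).
Unshelve. all: by end_near. Qed.

End abel_means.

Section transfer.
Context (R : realType) (n : nat).
Local Notation F2 := (H2f R n).
Local Notation S := (@Mshift R n).
Local Notation diag := (@diag R (word n) (cplx R) (fun a : word n => size a)).

(** For A = S the symbol c acts on a basis vector through its own Abel mean. *)
Let hcalc_fock r c (a : word n) : 0 <= r < 1 -> hcalc S r c (fbasis R a) = rapp a (diag r c).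
Proof.
move=> r01; have /andP[r0 r1] := r01; have cS := row_isom_contr (@Mshift_row_isom R n).
have r01' : 0 <= r <= 1 by rewrite r0 ltW.
suff /(congr1 (fun F => F c)) : (fun c => hcalc S r c (fbasis R a)) = rapp a \o diag r by [].
apply: (bo_eq_total _ _ (@fbasis_set_total R n)).
- exact: bo_hcalcl.
- by apply: bo_comp; [exact: (bo_diag (cplx R) (fun a : word n => size a) r01').1|exact: bo_rapp].
move=> _ [b ->] /=; rewrite hcalc_fbasis// word_op_scale; last by case: cS.
have -> : diag r (fbasis R b) = (r ^+ size b)%:C%C *: fbasis R b.
  apply: l2_ext => w; rewrite diagE// l2Z /fbasis ldeltaE.
  by case: eqP => [->//|_]; rewrite !scaler0.
rewrite (boZ _ _ (bo_rapp _ a)) rapp_fbasis; congr (_ *: _).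
by elim: b => //= i b ->; rewrite Mshift_fbasis.
Qed.

Lemma hcalc_fock_cvg M (mu : R) c : analytic M -> 0 <= mu -> (forall c, rn (M c) <= mu * rn c) ->
  hcalc S r (M (fbasis R [::])) c @[r --> (1:R)^'-] --> M c.
Proof.
move=> aM mu0 Mmu; have cS := row_isom_contr (@Mshift_row_isom R n).
pose A r := if 0 <= r < 1 then hcalc S r (M (fbasis R [::])) else fun=> 0.
have bA r : bounded_op (A r).
  by rewrite /A; case: ifP => [/(bo_hcalc _ cS)|_] //; exact: bo_zero.
have h x : A r x @[r --> (1:R)^'-] --> M x.
  apply: (@SOT_total R _ (1:R)^'- _ _ _ A M mu _ _ _ aM.1 (@fbasis_set_total R n)) => //.
  - apply: nearW => r y; rewrite /A; case: ifP => [r01|_]; first exact: von_neumann.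
    by rewrite rn0 mulr_ge0 ?rn_ge0.
  - move=> _ [a ->]; rewrite analytic_fbasis//.
    apply: (hcvg_near (bo_cvg (bo_rapp _ a) (@diag_cvg R _ (cplx R) (fun a : word n => size a) _))); near=> r.
    have r01 : 0 <= r < 1 by near: r; exact: near_left01.
    by rewrite /A r01 hcalc_fock.
apply: (hcvg_near (h c)); near=> r.
have r01 : 0 <= r < 1 by near: r; exact: near_left01.
by rewrite /A r01.
Unshelve. all: by end_near. Qed.

(** The values of M at [rA] are bounded by the von Neumann inequality, and on
    the range of each map chi they are the images of the values at [rS], which
    converge to M. As these ranges are total, the values at [rA] converge
    strongly to an operator B. *)
Theorem transfer (H : hilbertType R) (A : 'I_n -> H -> H) (X : set (F2 -> H))
    (M : F2 -> F2) (mu : R) : row_contr A ->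
  (forall chi, X chi -> bounded_op chi /\ forall j c, chi (S j c) = A j (chi c)) ->
  total_set [set h | exists chi c, X chi /\ h = chi c] ->
  analytic M -> 0 <= mu -> (forall c, rn (M c) <= mu * rn c) ->
  exists B : H -> H, [/\ bounded_op B, forall h, rn (B h) <= mu * rn h,
    forall chi c, X chi -> B (chi c) = chi (M c) &
    eval_rad (coef (M (fbasis R [::]))) A B].
Proof.
move=> cA Xchi tX aM mu0 Mmu; have cS := row_isom_contr (@Mshift_row_isom R n).
pose G r := if 0 <= r < 1 then hcalc A r (M (fbasis R [::])) else fun=> 0.
have bG r : bounded_op (G r).
  by rewrite /G; case: ifP => [/(bo_hcalc _ cA)|_] //; exact: bo_zero.
have Gmu r x : rn (G r x) <= mu * rn x.
  rewrite /G; case: ifP => [r01|_]; first exact: von_neumann.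
  by rewrite rn0 mulr_ge0 ?rn_ge0.
have Gchi chi c : X chi -> G r (chi c) @[r --> (1:R)^'-] --> chi (M c).
  move=> /Xchi[bchi Schi].
  apply: (hcvg_near (bo_cvg bchi (@hcalc_fock_cvg M mu c aM mu0 Mmu))); near=> r.
  have r01 : 0 <= r < 1 by near: r; exact: near_left01.
  rewrite /G r01.
  apply: esym; apply: (hcvg_unique (F := \oo)
    (u := fun m => chi (psum (coef (M (fbasis R [::]))) (scale_tuple r S) m c))).
    by apply: bo_cvg bchi _; exact: hcalc_cvg.
  rewrite (_ : (fun m => _) = fun m => psum (coef (M (fbasis R [::]))) (scale_tuple r A) m (chi c)).
    exact: hcalc_cvg.
  apply/funext => m; rewrite !psum_words (bo_sum _ _ _ bchi); apply: eq_bigr => a _.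
  rewrite (boZ _ _ bchi) !word_op_scale ?(boZ _ _ bchi); [|by case: cA|by case: cS].
  by congr (_ *: (_ *: _)); elim: a => //= i a <-; rewrite Schi.
have Gc h : cvg (G r h @[r --> (1:R)^'-]).
  apply: (SOT_total_cvg bG _ tX) => [|_ [chi [c [Xc ->]]]]; first exact: nearW.
  exact: cvgP (Gchi _ _ Xc).
pose B h := lim (G r h @[r --> (1:R)^'-]).
have [bB Bmu] : bounded_op B /\ forall h, rn (B h) <= mu * rn h.
  by apply: (bo_lim (A := G) (F := (1:R)^'-)) => //; exact: nearW.
exists B; split=> //; first by move=> chi c Xc; apply: cvg_lim => //; exact: Gchi.
split=> //; exists (2^-1 : R), G; split.
- by apply/andP; split; lra.
- move=> r /andP[r2 r1]; have r01 : 0 <= r < 1 by apply/andP; split; lra.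
  by rewrite /G r01; exact: eval_norm_hcalc.
- exact: Gc.
Unshelve. all: by end_near. Qed.

End transfer.

(** * Uniqueness of evaluations *)

Section abel.
Context (R : realType) (H : hilbertType R).

(** Abel's theorem on radial limits of convergent series, in a Hilbert space.
    *)
Lemma abel_limit (c : nat -> H) (s l : H) (F : R -> H) (delta : R) :
  \sum_(k < m) c k @[m --> \oo] --> s -> delta < 1 ->
  (forall r, delta < r < 1 -> \sum_(k < m) (r ^+ k)%:C%C *: c k @[m --> \oo] --> F r) ->
  F r @[r --> (1:R)^'-] --> l -> l = s.
Proof.
move=> cs d1 cF Fl; pose d m := \sum_(k < m) c k - s.
(* summation by parts, with the remainders d as the new coefficients *)
have parts (r : R) N : \sum_(k < N) (r ^+ k)%:C%C *: c k - s =
    (r ^+ N)%:C%C *: d N + (1 - r)%:C%C *: \sum_(k < N) (r ^+ k)%:C%C *: d k.+1.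
  elim: N => [|N IH]; first by rewrite !big_ord0 /d big_ord0 scaler0 addr0 scale1r.
  rewrite big_ord_recr /= addrAC IH [in RHS]big_ord_recr /= [(1 - r)%:C%C *: (_ + _)]scalerDr.
  have -> : c N = d N.+1 - d N by rewrite /d big_ord_recr /= opprB addrA subrK addrAC addrN add0r.
  set X := (1 - r)%:C%C *: _; rewrite [_ *: (d N.+1 - d N)]scalerBr.
  rewrite [LHS]addrC [LHS]addrA subrK [LHS]addrC [RHS]addrCA; congr (_ + _).
  rewrite scalerA -rmorphM -scalerDl -rmorphD exprS; congr (_%:C%C *: _).
  by rewrite [in RHS]/= mulrBl mul1r addrC subrK.
have key (e : R) : 0 < e -> exists C, 0 <= C /\ forall r : R, 0 <= r -> delta < r < 1 ->
    rn (F r - s) <= C * (1 - r) + e.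
  move=> e0; have /hcvg/(_ _ e0)[M _ MP] := cs.
  exists (\sum_(k < M) rn (d k.+1)); split; first by apply: sumr_ge0 => k _; exact: rn_ge0.
  move=> r r0 rd; have r1 : r < 1 by case/andP: rd.
  have r1' : 0 <= 1 - r by rewrite subr_ge0 ltW.
  apply/ler_addgt0Pr => e' e'0.
  apply: (hcvg_rn_le (F := \oo) (u := fun m => \sum_(k < m) (r ^+ k)%:C%C *: c k - s)).
    by apply: cvgB; [exact: cF|exact: cvg_cst].
  have /hcvg/(_ _ e'0)[N _ NP] := cs.
  exists (maxn M N) => // m /=; rewrite geq_max => /andP[Mm Nm].
  rewrite parts (le_trans (rnD _ _))// addrC lerD//.
    rewrite rnZr ger0_norm// mulrC.
    rewrite (le_trans (ler_wpM2r r1' (rn_sum _ _ _)))//.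
    have b k : rn ((r ^+ k)%:C%C *: d k.+1) <= r ^+ k * rn (d k.+1).
      by rewrite rnZr ger0_norm// exprn_ge0.
    apply: (@le_trans _ _ ((\sum_(k < m) r ^+ k * rn (d k.+1)) * (1 - r))).
      by rewrite ler_wpM2r// ler_sum.
    have -> : \sum_(k < m) r ^+ k * rn (d k.+1) =
        \sum_(0 <= k < M) r ^+ k * rn (d k.+1) + \sum_(M <= k < m) r ^+ k * rn (d k.+1).
      by rewrite -big_cat_nat//= big_mkord.
    rewrite mulrDl lerD//.
      rewrite ler_wpM2r// big_mkord ler_sum// => k _.
      by rewrite -[leRHS]mul1r ler_wpM2r ?rn_ge0// exprn_ile1// ltW.
    apply: (@le_trans _ _ ((\sum_(M <= k < m) r ^+ k * e) * (1 - r))).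
      rewrite ler_wpM2r// big_nat [leRHS]big_nat ler_sum// => k /andP[Mk _].
      by rewrite ler_wpM2l ?exprn_ge0// ltW//; apply: MP => /=; exact: leqW.
    rewrite -mulr_suml mulrAC -[leRHS]mul1r ler_wpM2r ?(ltW e0)//.
    apply: (@le_trans _ _ ((\sum_(0 <= k < m) r ^+ k) * (1 - r))).
      rewrite ler_wpM2r// (@big_cat_nat _ _ _ M 0%N m)//= lerDr sumr_ge0// => k _.
      exact: exprn_ge0.
    have : (1 - r) * \sum_(0 <= k < m) r ^+ k = 1 - r ^+ m.
      rewrite big_mkord; elim: (m) => [|p IH]; first by rewrite big_ord0 mulr0 subrr.
      by rewrite big_ord_recr /= mulrDr IH exprS; ring.
    by rewrite mulrC => ->; rewrite gerBl exprn_ge0.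
  rewrite rnZr ger0_norm ?exprn_ge0//.
  apply: (@le_trans _ _ (1 * rn (d m))); last by rewrite mul1r ltW// NP.
  by rewrite ler_wpM2r ?rn_ge0// exprn_ile1// ltW.
apply/eqP; rewrite -subr_eq0; apply/eqP/rn_eq0/le_anti; rewrite rn_ge0 andbT.
apply/ler_addgt0Pr => e e0; rewrite add0r.
have e2 : 0 < e / 2 by rewrite divr_gt0.
have [C [C0 CP]] := key _ e2.
apply: (hcvg_rn_le (F := (1:R)^'-) (u := fun r => F r - s)).
  by apply: cvgB => //; exact: cvg_cst.
have C1 : 0 < e / 2 / (C + 1) by rewrite !divr_gt0// ltr_wpDl.
near=> r.
have r0 : 0 <= r by near: r; apply: nbhs_left_ge.
have rd : delta < r < 1.
  by apply/andP; split; near: r; [apply: nbhs_left_gt|exact: nbhs_left_lt].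
apply: le_trans (CP r r0 rd) _; rewrite [leRHS](splitr e) lerD2r.
have : 1 - e / 2 / (C + 1) <= r.
  by near: r; apply: nbhs_left_ge; rewrite ltrBlDr ltrDl.
rewrite lerBlDr -lerBlDl ler_pdivlMr; last by rewrite ltr_wpDl.
have : r < 1 by case/andP: rd.
by move=> h1 h2; nra.
Unshelve. all: by end_near. Qed.

End abel.

Section evaluation_unique.
Context (R : realType) (n : nat) (H : hilbertType R).
Implicit Types (p : fps R n) (Y A : 'I_n -> H -> H) (T : H -> H).

Lemma eval_norm_bound p Y T : (forall i, bounded_op (Y i)) -> eval_norm p Y T ->
  forall e : R, 0 < e -> \forall m \near \oo, forall h, rn (psum p Y m h - T h) <= e * rn h.
Proof.
move=> bY [bT /cvgrPdist_lt pT] e /pT; apply: filterS => m; rewrite sub0r normrN => pm h.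
have bd := bo_sub (bo_psum p m bY) bT.
rewrite (le_trans (opnormP h bd))// ler_wpM2r ?rn_ge0//.
by rewrite (le_trans (ler_norm _))// ltW.
Qed.

Lemma eval_norm_cvg p Y T h : (forall i, bounded_op (Y i)) -> eval_norm p Y T ->
  psum p Y m h @[m --> \oo] --> T h.
Proof.
move=> bY pT; apply/hcvg => e e0; have h1 : 0 < rn h + 1 by rewrite ltr_wpDl ?rn_ge0.
have := eval_norm_bound bY pT (divr_gt0 e0 h1); apply: filterS => m /(_ h) hm.
apply: le_lt_trans hm _; rewrite mulrAC ltr_pdivrMr// ltr_pM2l// ltrDl//.
Qed.

Lemma eval_norm_unique p Y T T' : (forall i, bounded_op (Y i)) ->
  eval_norm p Y T -> eval_norm p Y T' -> T = T'.
Proof.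
move=> bY pT pT'; apply/funext => h.
by apply: hcvg_unique (eval_norm_cvg (h := h) bY pT) (eval_norm_cvg (h := h) bY pT').
Qed.

Lemma psum_scale p Y (r : R) m h : (forall i, bounded_op (Y i)) ->
  psum p (scale_tuple r Y) m h =
  \sum_(k < m) (r ^+ k)%:C%C *: \sum_(a : k.-tuple 'I_n) p a *: word_op Y a h.
Proof.
move=> bY; apply: eq_bigr => k _; rewrite scaler_sumr; apply: eq_bigr => a _.
by rewrite word_op_scale// size_tuple !scalerA mulrC.
Qed.

Definition eval_any p Y T := eval_SOT p Y T \/ eval_rad p Y T.

Let SOT_rad p Y T T' : (forall i, bounded_op (Y i)) ->
  eval_SOT p Y T -> eval_rad p Y T' -> T = T'.
Proof.
move=> bY [_ pT] [_ [delta [F [/andP[_ d1] pF FT']]]]; apply/funext => h; apply/esym.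
apply: (@abel_limit _ _ (fun k => \sum_(a : k.-tuple 'I_n) p a *: word_op Y a h) (T h) (T' h)
  (fun r => F r h) delta) => //; first exact: pT.
move=> r rd; have := eval_norm_cvg (h := h) (bo_scale_tuple r bY) (pF r rd).
by apply: cvg_trans; apply: near_eq_cvg; apply: nearW => m; rewrite psum_scale.
Qed.

(** A strongly convergent evaluation and a radial one agree by the theorem of
    Abel, so the two conventions never conflict. *)
Lemma eval_any_unique p Y T T' : (forall i, bounded_op (Y i)) ->
  eval_any p Y T -> eval_any p Y T' -> T = T'.
Proof.
move=> bY [h|h] [h'|h'].
- by apply/funext => x; apply: hcvg_unique (h.2 x) (h'.2 x).
- exact: SOT_rad h h'.
- exact/esym/(SOT_rad _ h' h).
case: h h' => [_ [d1 [F [/andP[d10 d11] pF FT]]]] [_ [d2 [G [/andP[d20 d21] pG GT]]]].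
apply/funext => x; apply: hcvg_unique (FT x) _; apply: (hcvg_near (GT x)).
near=> r; have r1 : r < 1 by near: r; exact: nbhs_left_lt.
rewrite (eval_norm_unique (bo_scale_tuple r bY) (pF r _) (pG r _))// r1 andbT.
  by near: r; exact: nbhs_left_gt.
by near: r; exact: nbhs_left_gt.
Unshelve. all: by end_near. Qed.

Lemma eval_tuple_any (f : 'I_n -> fps R n) Y A : eval_tuple f Y A -> forall i, eval_any (f i) Y (A i).
Proof. by case=> h i; [left|right]. Qed.

Lemma fval_unique (f : 'I_n -> fps R n) Y A : (forall i, bounded_op (Y i)) ->
  eval_tuple f Y A -> fval f Y = A.
Proof.
move=> bY fA; rewrite /fval; case: xgetP => [A' _ fA'|/(_ A)//].
by apply/funext => i; apply: eval_any_unique bY (eval_tuple_any fA' i) (eval_tuple_any fA i).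
Qed.

End evaluation_unique.

(** * Transporting the evaluation f(M_Z) *)

Section analytic_closure.
Context (R : realType) (n : nat).
Local Notation F2 := (H2f R n).
Implicit Types (MZ : 'I_n -> F2 -> F2) (M : F2 -> F2).

Lemma analytic_word MZ (a : word n) : (forall i, analytic (MZ i)) -> analytic (word_op MZ a).
Proof.
move=> aM; split; first by apply: bo_word_op => i; case: (aM i).
by move=> j; elim: a => //= i a IH c; rewrite IH (aM i).2.
Qed.

Lemma analytic_psum (p : fps R n) MZ m : (forall i, analytic (MZ i)) -> analytic (psum p MZ m).
Proof.
move=> aM; split; first by apply: bo_psum => i; case: (aM i).
move=> j c; rewrite !psum_words (bo_sum _ _ _ (bo_Lambda _ j)); apply: eq_bigr => a _.
by rewrite (analytic_word a aM).2 (boZ _ _ (bo_Lambda _ j)).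
Qed.

Lemma analytic_scale MZ (r : R) : (forall i, analytic (MZ i)) ->
  forall i, analytic (scale_tuple r MZ i).
Proof.
move=> aM i; split; first by apply: bo_scale; case: (aM i).
by move=> j c; rewrite /scale_tuple (aM i).2 (boZ _ _ (bo_Lambda _ j)).
Qed.

Lemma analytic_lim (T : Type) (F : set_system T) {FF : ProperFilter F} (N : T -> F2 -> F2) M :
  (forall t, analytic (N t)) -> bounded_op M -> (forall x, N t x @[t --> F] --> M x) ->
  analytic M.
Proof.
move=> aN bM NM; split=> // j c.
apply: hcvg_unique (NM _) _.
rewrite (_ : (fun t => _) = fun t => Lambda j (N t c)); first by apply: bo_cvg (bo_Lambda _ j) _.
by apply/funext => t; rewrite (aN t).2.
Qed.

Lemma analytic_sub M M' : analytic M -> analytic M' -> analytic (fun x => M x - M' x).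
Proof.
move=> aM aM'; split; first by apply: bo_sub; [case: aM|case: aM'].
by move=> j c; rewrite aM.2 aM'.2 (boB _ _ (bo_Lambda _ j)).
Qed.

End analytic_closure.

Section universal_model.
Context (R : realType) (n : nat) (f : 'I_n -> fps R n) (g : 'I_n -> H2f R n).
Context (MZ : 'I_n -> H2f R n -> H2f R n).
Local Notation F2 := (H2f R n).
Local Notation S := (@Mshift R n).

(** What the three model conditions have in common: each M_Zi is analytic with
    symbol g_i, and f(M_Z) is the tuple of left creation operators. *)
Definition universal_model : Prop :=
  [/\ forall i, analytic (MZ i), forall i, MZ i (fbasis R [::]) = g i & eval_tuple f MZ S].

(** The boundedness that defines the class [M^b], after the value of
    [f_i(M_Z)] has been identified as [S_i]. *)
Definition bounded_eval : Prop :=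
  (forall i, eval_SOT (f i) MZ (S i) /\
     exists2 C : R, 0 <= C & forall m h, rn (psum (f i) MZ m h) <= C * rn h) \/
  (forall i, eval_rad (f i) MZ (S i) /\
     exists2 C : R, 0 <= C & forall r : R, 0 <= r < 1 ->
       exists2 T, eval_norm (f i) (scale_tuple r MZ) T & forall h, rn (T h) <= C * rn h).

Lemma class_Mb_bounded : universal_model -> class_Mb f g MZ -> bounded_eval.
Proof.
move=> [aM _ fS] [_ hb]; have bM i : bounded_op (MZ i) by case: (aM i).
have TS i T : eval_any (f i) MZ T -> T = S i.
  by move=> fT; apply: eval_any_unique bM fT (eval_tuple_any fS i).
case: hb => h; [left|right] => i; have [[T fT] [C CP]] := h i.
  split; first by rewrite -(TS i T)//; left.
  exists `|C| => // -[|m] x; first by rewrite /psum big_ord0 rn0 mulr_ge0 ?rn_ge0.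
  apply: le_trans (opnormP x (bo_psum _ _ bM)) _; rewrite ler_wpM2r ?rn_ge0//.
  by rewrite (le_trans (CP m))// ler_norm.
split; first by rewrite -(TS i T)//; right.
exists `|C| => // r /CP[T' fT' T'C]; exists T' => // x.
apply: le_trans (opnormP x _) _; first by case: fT'.
by rewrite ler_wpM2r ?rn_ge0// (le_trans T'C)// ler_norm.
Qed.

Section transport.
Context (H : hilbertType R) (A T : 'I_n -> H -> H) (X : set (F2 -> H)).
Hypotheses (cA : row_contr A)
  (Xchi : forall chi, X chi -> bounded_op chi /\ forall j c, chi (S j c) = A j (chi c))
  (tX : total_set [set h | exists chi c, X chi /\ h = chi c])
  (bT : forall i, bounded_op (T i))
  (TX : forall i chi c, X chi -> T i (chi c) = chi (MZ i c)).

Lemma psum_transport (p : fps R n) (r : R) m chi c : X chi ->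
  psum p (scale_tuple r T) m (chi c) = chi (psum p (scale_tuple r MZ) m c).
Proof.
move=> Xc; have [bchi _] := Xchi Xc.
rewrite !psum_words (bo_sum _ _ _ bchi); apply: eq_bigr => a _.
rewrite (boZ _ _ bchi); congr (_ *: _).
by elim: a => //= i a ->; rewrite /scale_tuple (boZ _ _ bchi) TX.
Qed.

Lemma scale_tuple1 (K : hilbertType R) (Y : 'I_n -> K -> K) : scale_tuple 1 Y = Y.
Proof. by apply/funext => i; apply/funext => h; rewrite /scale_tuple scale1r. Qed.

(** An operator on the covered space that is intertwined with M by all the
    maps chi inherits the norm bound of M. *)
Lemma transfer_bound (M : F2 -> F2) (N : H -> H) (mu : R) : analytic M -> bounded_op N ->
  (forall chi c, X chi -> N (chi c) = chi (M c)) ->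
  0 <= mu -> (forall c, rn (M c) <= mu * rn c) -> forall h, rn (N h) <= mu * rn h.
Proof.
move=> aM bN NX mu0 Mmu; have [B [bB Bmu BX _]] := transfer cA Xchi tX aM mu0 Mmu.
suff -> : N = B by [].
by apply: (bo_eq_total bN bB tX) => _ [chi [c [Xc ->]]]; rewrite NX// BX.
Qed.

(** The partial sums, or the dilations, of [f_i(M_Z)] are uniformly bounded,
    and [transfer_bound] carries this bound over to T; on the range of each
    map chi the evaluation at T is the image of the one at M_Z, which
    converges to [S_i]. *)
Lemma eval_transport : universal_model -> bounded_eval -> eval_tuple f T A.
Proof.
move=> [aM gM fS] [hb|hb]; [left|right] => i; have [fi [C C0 CP]] := hb i.
  split; first by case: cA.
  apply: (@SOT_total R _ \oo _ _ _ (fun m => psum (f i) T m) (A i) C _ _ _ _ tX).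
  - by move=> m; exact: bo_psum.
  - apply: nearW => m; apply: (transfer_bound (M := psum (f i) MZ m)) => //.
    + exact: analytic_psum.
    + exact: bo_psum.
    + by move=> chi c Xc; have := psum_transport (f i) 1 m c Xc; rewrite !scale_tuple1.
  - by case: cA.
  - move=> _ [chi [c [Xc ->]]]; have [bchi chiS] := Xchi Xc.
    rewrite -chiS; apply: (hcvg_near (bo_cvg bchi (fi.2 c))); apply: nearW => m.
    by have := psum_transport (f i) 1 m c Xc; rewrite !scale_tuple1.
case: fi => _ [delta [F [/andP[d0 d1] fF FS]]].
have bMr r i' : bounded_op (scale_tuple r MZ i') by apply: bo_scale_tuple => j; case: (aM j).
have bTr r i' : bounded_op (scale_tuple r T i') by exact: bo_scale_tuple.
have F1 r : delta < r < 1 -> [/\ 0 <= r < 1, analytic (F r) & forall h, rn (F r h) <= C * rn h].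
  move=> rd; have r01 : 0 <= r < 1.
    by case/andP: rd => rd ->; rewrite (le_trans (ltW d0))// ltW.
  have [F' fF' F'C] := CP r r01.
  split=> //; last by rewrite (eval_norm_unique (bMr r) (fF r rd) fF').
  apply: (@analytic_lim _ _ _ \oo _ (fun m => psum (f i) (scale_tuple r MZ) m)).
  - by move=> m; apply: analytic_psum; exact: analytic_scale.
  - by case: (fF r rd).
  - by move=> x; exact: (eval_norm_cvg (bMr r) (fF r rd)).
have /choice[G GP] : forall r, exists G : H -> H, bounded_op G /\ (delta < r < 1 ->
    (forall h, rn (G h) <= C * rn h) /\ forall chi c, X chi -> G (chi c) = chi (F r c)).
  move=> r; case rd : (delta < r < 1); last by exists (fun=> 0); split; [exact: bo_zero|].
  have [r01 aF FC] := F1 r rd.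
  by have [B [bB BC BX _]] := transfer cA Xchi tX aF C0 FC; exists B.
have near_d : \forall r \near (1:R)^'-, delta < r < 1.
  near=> r; apply/andP; split; near: r; [exact: nbhs_left_gt|exact: nbhs_left_lt].
split; first by case: cA.
exists delta, G; split; first by rewrite d0.
- move=> r rd; have [r01 aF FC] := F1 r rd; have [bG /(_ rd)[GC GX]] := GP r.
  split=> //; apply/cvgrPdist_lt => e e0; have e2 : 0 < e / 2 by rewrite divr_gt0.
  have := eval_norm_bound (bMr r) (fF r rd) e2; apply: filterS => m hm.
  have bd := bo_sub (bo_psum (f i) m (bTr r)) bG.
  rewrite sub0r normrN ger0_norm; last exact: (opnorm_ge0 bd).
  apply: (@le_lt_trans _ _ (e / 2)); last by rewrite ltr_pdivrMr// ltr_pMr// ltr1n.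
  apply: opnorm_le; last exact: ltW.
  apply: (transfer_bound (M := fun c => psum (f i) (scale_tuple r MZ) m c - F r c)) => //.
  + by apply: analytic_sub => //; apply: analytic_psum; exact: analytic_scale.
  + move=> chi c Xc; have [bchi _] := Xchi Xc.
    rewrite -[LHS]/(psum (f i) (scale_tuple r T) m (chi c) - G r (chi c)).
    by rewrite (psum_transport _ _ _ _ Xc) GX// (boB _ _ bchi).
  + exact: ltW.
- apply: (@SOT_total R _ (1:R)^'- _ _ _ G (A i) C _ _ _ _ tX).
  + by move=> r; case: (GP r).
  + by apply: filterS near_d => r rd; case: (GP r) => _ /(_ rd)[].
  + by case: cA.
  + move=> _ [chi [c [Xc ->]]]; have [bchi chiS] := Xchi Xc.
    rewrite -chiS; apply: (hcvg_near (bo_cvg bchi (FS c))).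
    by apply: filterS near_d => r rd; case: (GP r) => _ /(_ rd)[_ ->].
Unshelve. all: by end_near. Qed.

End transport.

(** Left creation operators are bounded strong limits of polynomials in M_Z;
    a property stable under such limits passes from M_Z to them. *)
Lemma shift_closure (Q : (F2 -> F2) -> Prop) : universal_model -> bounded_eval ->
  (forall (r : R) p m, Q (psum p (scale_tuple r MZ) m)) ->
  (forall (T : Type) (F : set_system T) (N : T -> F2 -> F2) (M : F2 -> F2) (C : R),
     ProperFilter F -> (forall t, bounded_op (N t)) -> bounded_op M ->
     (\forall t \near F, Q (N t)) -> 0 <= C ->
     (\forall t \near F, forall x, rn (N t x) <= C * rn x) ->
     (forall x, N t x @[t --> F] --> M x) -> Q M) ->
  forall j, Q (S j).
Proof.
move=> [aM gM fS] hb Qp Ql j; have bM i : bounded_op (MZ i) by case: (aM i).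
case: hb => hb; have [fi [C C0 CP]] := hb j.
  apply: (Ql nat \oo (fun m => psum (f j) MZ m) _ C) => //.
  - by move=> m; exact: bo_psum.
  - exact: bo_Mshift.
  - by apply: nearW => m; have := Qp 1 (f j) m; rewrite scale_tuple1.
  - by apply: nearW.
  - by case: fi.
case: fi => _ [delta [F [/andP[d0 d1] fF FS]]].
have bMr r i' : bounded_op (scale_tuple r MZ i') by exact: bo_scale_tuple.
pose G r := if delta < r < 1 then F r else fun=> 0.
have near_d : \forall r \near (1:R)^'-, delta < r < 1.
  near=> r; apply/andP; split; near: r; [exact: nbhs_left_gt|exact: nbhs_left_lt].
apply: (Ql R (1:R)^'- G _ C) => //.
- by move=> r; rewrite /G; case: ifP => [/fF[]//|_]; exact: bo_zero.
- exact: bo_Mshift.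
- apply: filterS near_d => r rd; rewrite /G rd.
  have bF : bounded_op (F r) by case: (fF r rd).
  apply: (Ql nat \oo (fun m => psum (f j) (scale_tuple r MZ) m) _ (opnorm (F r) + 1)) => //.
  + by move=> m; exact: bo_psum.
  + exact: nearW.
  + by rewrite addr_ge0// opnorm_ge0.
  + have := eval_norm_bound (bMr r) (fF r rd) ltr01; apply: filterS => m h x.
    rewrite -[psum _ _ _ _](subrK (F r x)) (le_trans (rnD _ _))// addrC mulrDl lerD//.
    exact: opnormP.
  + by move=> x; exact: (eval_norm_cvg (bMr r) (fF r rd)).
- apply: filterS near_d => r rd x; rewrite /G rd.
  have r01 : 0 <= r < 1 by case/andP: rd => rd ->; rewrite (le_trans (ltW d0))// ltW.
  have [F' fF' F'C] := CP r r01.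
  by rewrite (eval_norm_unique (bMr r) (fF r rd) fF').
- by move=> x; apply: (hcvg_near (FS x)); apply: filterS near_d => r rd; rewrite /G rd.
Unshelve. all: by end_near. Qed.

(** Commutation with M_Z passes to polynomials in M_Z, and then to the left
    creation operators by [shift_closure]. *)
Lemma multi_analytic_shift (K1 K2 : hilbertType R) (Phi : H2t n K1 -> H2t n K2) :
  universal_model -> bounded_eval -> multi_analytic MZ Phi ->
  forall j y, Phi (fshift j y) = fshift j (Phi y).
Proof.
move=> um hb [bPhi cPhi] j; have [aM _ _] := um.
have bM i : bounded_op (MZ i) by case: (aM i).
pose Q (N : F2 -> F2) := bounded_op N -> forall y, Phi (tensop N (idfun : K1 -> K1) y) =
  tensop N (idfun : K2 -> K2) (Phi y).
suff : Q (S j) by apply; exact: bo_Mshift.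
apply: (shift_closure um hb).
- move=> r p m bp.
  have bMr i' : bounded_op (scale_tuple r MZ i') by exact: bo_scale_tuple.
  have tp (K : hilbertType R) : tensop (psum p (scale_tuple r MZ) m) (idfun : K -> K) =
      psum p (scale_tuple r (fun i => tensop (MZ i) (idfun : K -> K))) m.
    have bt i : bounded_op (scale_tuple r (fun i => tensop (MZ i) (idfun : K -> K)) i).
      by apply: bo_scale_tuple => i'; exact: (bo_tensop (bM i') (bo_id K)).
    apply: tensop_unique => //; [exact: bo_id|exact: bo_psum|].
    move=> c v; rewrite !psum_words (bo_sum _ _ _ (bo_etensl _ v)); apply: eq_bigr => a _.
    rewrite etensZl; congr (_ *: _); elim: a => //= i a ->.
    by rewrite /scale_tuple (tensop_etens _ _ (bM i) (bo_id _)) -etensZl.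
  move=> y; rewrite !tp !psum_words (bo_sum _ _ _ bPhi); apply: eq_bigr => a _.
  rewrite (boZ _ _ bPhi); congr (_ *: _); elim: a => //= i a <-.
  by rewrite /scale_tuple (boZ _ _ bPhi); congr (_ *: _); exact: (congr1 (fun F => F _) (cPhi i)).
- move=> T F N M C FF bN bM' QN C0 NC NM _ y.
  have tc (K : hilbertType R) y' : tensop (N t) (idfun : K -> K) y' @[t --> F] -->
      tensop M (idfun : K -> K) y'.
    apply: (@SOT_total R _ F _ _ _ (fun t => tensop (N t) (idfun : K -> K)) _ C (@etens_set R _ K)).
    + by move=> t; exact: (bo_tensop (bN t) (bo_id K)).
    + by apply: filterS NC => t Nt x; exact: (tensop_rn x (bN t) C0 Nt).
    + exact: (bo_tensop bM' (bo_id K)).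
    + exact: total_etens.
    + move=> _ [c [v ->]]; rewrite (tensop_etens _ _ bM' (bo_id K)).
      apply: (hcvg_near (bo_cvg (bo_etensl _ v) (NM c))); apply: nearW => t.
      by rewrite (tensop_etens _ _ (bN t) (bo_id K)).
  apply: hcvg_unique (bo_cvg bPhi (tc K1 y)) _; apply: (hcvg_near (tc K2 (Phi y))).
  by apply: filterS QN => t; apply.
Qed.

End universal_model.

(** * Composition of formal power series *)

Lemma sum_fin1 (V : nmodType) (J : finType) (j : J) (F : J -> V) :
  (forall i, i != j -> F i = 0) -> \sum_i F i = F j.
Proof. by move=> F0; rewrite (bigD1 j)//= [X in _ + X]big1 ?addr0// => i; exact: F0. Qed.

Section formal.
Context (R : realType) (n : nat).
Local Notation fps := (fps R n).
Local Notation W := (word n).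
Implicit Types (p q r : fps) (f : 'I_n -> fps) (w a b : W).

(** The series p with a leading letter i removed; products of series are
    computed recursively with it. *)
Definition tailw (i : 'I_n) p : fps := fun w => p (i :: w).
Definition onew : fps := fun w => (w == [::])%:R.

Lemma fps_mul_nil p q : fps_mul p q [::] = p [::] * q [::].
Proof. by rewrite /fps_mul big_ord1. Qed.

Lemma fps_mul_cons p q i w : fps_mul p q (i :: w) = p [::] * q (i :: w) + fps_mul (tailw i p) q w.
Proof. by rewrite /fps_mul big_ord_recl. Qed.

Lemma fps_mul_linl (x : R[i]) p p' q w :
  fps_mul (fun a => x * p a + p' a) q w = x * fps_mul p q w + fps_mul p' q w.
Proof.
rewrite /fps_mul mulr_sumr -big_split /=; apply: eq_bigr => k _.
by rewrite mulrDl mulrA.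
Qed.

Lemma fps_mulA p q r w : fps_mul (fps_mul p q) r w = fps_mul p (fps_mul q r) w.
Proof.
elim: w p q => [|i w IH] p q; first by rewrite !fps_mul_nil mulrA.
rewrite !fps_mul_cons fps_mul_nil.
rewrite (_ : tailw i (fps_mul p q) = fun a => p [::] * tailw i q a + fps_mul (tailw i p) q a).
  by rewrite fps_mul_linl IH mulrDr addrA mulrA.
by apply/funext => a; rewrite /tailw fps_mul_cons.
Qed.

Lemma fps_mul1 p w : fps_mul p onew w = p w.
Proof.
elim: w p => [|i w IH] p; first by rewrite fps_mul_nil /onew eqxx mulr1.
by rewrite fps_mul_cons IH /onew mulr0 add0r.
Qed.

Lemma mul1fps p w : fps_mul onew p w = p w.
Proof.
case: w => [|i w]; first by rewrite fps_mul_nil /onew eqxx mul1r.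
rewrite fps_mul_cons /onew eqxx mul1r /fps_mul big1 ?addr0// => k _.
by rewrite /tailw mul0r.
Qed.

Lemma fps_mul0 p q w : (forall k, p (take k w) * q (drop k w) = 0) -> fps_mul p q w = 0.
Proof. by move=> h; rewrite /fps_mul big1. Qed.

(** The product [Z_a p]. *)
Fixpoint zmul a p w : R[i] :=
  if a is i :: a' then (if w is j :: w' then (if i == j then zmul a' p w' else 0) else 0) else p w.

Lemma zmul_var i p w : fps_mul (fps_var R i) p w = zmul [:: i] p w.
Proof.
case: w => [|j w] /=; first by rewrite fps_mul_nil /fps_var mul0r.
rewrite fps_mul_cons /fps_var mul0r add0r.
case: eqP => [<-|ij].
  rewrite (_ : tailw i _ = onew) ?mul1fps//; apply/funext => a.
  by rewrite /tailw /onew eqseq_cons eqxx.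
rewrite (_ : tailw j _ = fun=> 0).
  by apply: fps_mul0 => k; rewrite mul0r.
by apply/funext => a; rewrite /tailw eqseq_cons; case: eqP => // /esym.
Qed.

Lemma zmul_cons i a p : zmul (i :: a) p = fps_mul (fps_var R i) (zmul a p).
Proof. by apply/funext => w; rewrite zmul_var; case: w. Qed.

Lemma sum_words_uptoS (F : W -> R[i]) m : \sum_(a <- words_upto n m.+1) F a =
  F [::] + \sum_i \sum_(a <- words_upto n m) F (i :: a).
Proof.
rewrite sum_words_upto big_ord_recl sum_tuple0; congr (_ + _).
under eq_bigr do rewrite /= sum_tupleS.
rewrite exchange_big /=; apply: eq_bigr => i _.
by rewrite (sum_words_upto m (fun a => F (i :: a))).
Qed.

Lemma fps_mul_zmul p q w m : (size w < m)%N ->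
  fps_mul p q w = \sum_(a <- words_upto n m) p a * zmul a q w.
Proof.
elim: w m p => [|j w IH] [//|m] p; rewrite /= => wm; rewrite sum_words_uptoS /=.
  rewrite fps_mul_nil big1 ?addr0// => i _; rewrite big1// => a _.
  by rewrite mulr0.
rewrite fps_mul_cons; congr (_ + _); rewrite (sum_fin1 (j := j)) => [|i ij]; last first.
  by rewrite big1// => a _; rewrite (negbTE ij) mulr0.
by rewrite (IH m)//; apply: eq_bigr => a _; rewrite eqxx.
Qed.

(** ** Local finiteness of a composition *)

(** In degrees at most m only the words shorter than N contribute to the
    composition of p with f. It holds for polynomials p, and for every p when
    f has no constant term. *)
Definition locfin p f m N : Prop :=
  forall w a, (size w <= m)%N -> (N <= size a)%N -> p a * fps_word f a w = 0.

Lemma fps_compE p f m N w : locfin p f m N -> (size w <= m)%N ->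
  fps_comp p f w = \sum_(a <- words_upto n N) p a * fps_word f a w.
Proof.
move=> h wm; rewrite /fps_comp (fsbigE (words_upto n N)).
- by apply: eq_bigl => a; rewrite in_setT.
- exact: words_upto_uniq.
- by [].
- by move=> a _; rewrite mem_words_upto -leqNgt => /(h w a wm).
Qed.

Lemma fps_comp_lin (x : R[i]) p p' f m N w : locfin p f m N -> locfin p' f m N -> (size w <= m)%N ->
  fps_comp (fun a => x * p a + p' a) f w = x * fps_comp p f w + fps_comp p' f w.
Proof.
move=> h h' wm; rewrite (fps_compE h wm) (fps_compE h' wm).
rewrite (@fps_compE _ _ m N)//; last first.
  by move=> v a vm aN; rewrite mulrDl -mulrA h// h'// mulr0 addr0.
rewrite mulr_sumr -big_split /=; apply: eq_bigr => a _.
by rewrite mulrDl mulrA.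
Qed.

Lemma fps_word_rcons f a j w : fps_word f (rcons a j) w = fps_mul (fps_word f a) (f j) w.
Proof.
elim: a w => [|i a IH] w; first exact: etrans (fps_mul1 (f j) w) (esym (mul1fps (f j) w)).
rewrite /= fps_mulA; congr (fps_mul _ _ _); apply/funext => v; exact: IH.
Qed.

(** The coefficients of [Z_j p]. *)
Definition lvar (j : 'I_n) p : fps := fun w => if w is i :: w' then (if i == j then p w' else 0) else 0.

Lemma lvar_zmul j p : lvar j p = zmul [:: j] p.
Proof. by apply/funext => -[|i w] //=; rewrite eq_sym. Qed.

Lemma lvar_var j p : lvar j p = fps_mul (fps_var R j) p.
Proof. by rewrite lvar_zmul zmul_cons. Qed.

Lemma fps_comp_lvar j p f m N w : locfin p f m N -> (size w <= m)%N ->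
  locfin (lvar j p) f m N.+1 /\
  fps_comp (lvar j p) f w = fps_mul (f j) (fps_comp p f) w.
Proof.
move=> h wm; have h' : locfin (lvar j p) f m N.+1.
  move=> v [|i a] //= vm; rewrite ltnS => aN; case: eqP => [->|_]; last by rewrite mul0r.
  rewrite /fps_mul mulr_sumr big1// => k _; rewrite mulrCA h ?mulr0//.
  by rewrite size_drop (leq_trans (leq_subr _ _)).
split=> //; rewrite (fps_compE h' wm) sum_words_uptoS mul0r add0r (sum_fin1 (j := j)) => [|i ij]; last first.
  by rewrite big1// => a _; rewrite /= (negbTE ij) mul0r.
rewrite [RHS]/fps_mul [RHS](eq_bigr (fun k : 'I_(size w).+1 => \sum_(a <- words_upto n N)
    f j (take k w) * (p a * fps_word f a (drop k w)))); last first.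
  move=> k _; rewrite (fps_compE h) ?mulr_sumr//.
  by rewrite size_drop (leq_trans (leq_subr _ _)).
rewrite exchange_big /=; apply: eq_bigr => a _; rewrite eqxx /fps_mul mulr_sumr.
by apply: eq_bigr => k _; rewrite mulrCA.
Qed.

(** The coefficients of [p Z_j]. *)
Definition rvar (j : 'I_n) p : fps := fun w => if w is i :: w' then (if last i w' == j then p (belast i w') else 0) else 0.

Lemma rvar_rcons j p a i : rvar j p (rcons a i) = if i == j then p a else 0.
Proof. by case: a => [|k a] //=; rewrite last_rcons belast_rcons. Qed.

Lemma sum_words_upto_rcons (V : nmodType) (F : W -> V) m : \sum_(a <- words_upto n m.+1) F a =
  F [::] + \sum_(a <- words_upto n m) \sum_i F (rcons a i).
Proof.
rewrite sum_words_upto big_ord_recl sum_tuple0; congr (_ + _).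
under eq_bigr do rewrite /= sum_tuple_rcons.
by rewrite (sum_words_upto m (fun a => \sum_i F (rcons a i))).
Qed.

Lemma fps_comp_rvar j p f m N w : locfin p f m N -> (size w <= m)%N ->
  locfin (rvar j p) f m N.+1 /\
  fps_comp (rvar j p) f w = fps_mul (fps_comp p f) (f j) w.
Proof.
move=> h wm; have h' : locfin (rvar j p) f m N.+1.
  move=> v a vm; case/lastP: a => [//|a i]; rewrite size_rcons ltnS => aN.
  rewrite rvar_rcons fps_word_rcons; case: eqP => [->|_]; last by rewrite mul0r.
  rewrite /fps_mul mulr_sumr big1// => k _; rewrite mulrA h ?mul0r//.
  by rewrite size_take_min (leq_trans (geq_minr _ _)).
split=> //; rewrite (fps_compE h' wm) sum_words_upto_rcons mul0r add0r.
rewrite [RHS]/fps_mul [RHS](eq_bigr (fun k : 'I_(size w).+1 => \sum_(a <- words_upto n N)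
    (p a * fps_word f a (take k w)) * f j (drop k w))); last first.
  move=> k _; rewrite (fps_compE h) ?mulr_suml//.
  by rewrite size_take_min (leq_trans (geq_minr _ _)).
rewrite [RHS]exchange_big /=; apply: eq_bigr => a _; rewrite (sum_fin1 (j := j)) => [|i ij]; last first.
  by rewrite rvar_rcons (negbTE ij) mul0r.
rewrite rvar_rcons eqxx fps_word_rcons /fps_mul mulr_sumr.
by apply: eq_bigr => k _; rewrite mulrA.
Qed.

Lemma fps_comp_one f w : fps_comp onew f w = onew w.
Proof.
have h : locfin onew f (size w) 1 by move=> v [|i a] // _ _; rewrite /onew mul0r.
rewrite (fps_compE h)// sum_words_upto big_ord1 /=.
by rewrite (sum_tuple0 (fun a => onew a * fps_word f a w)) /onew eqxx mul1r.
Qed.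

(** ** Polynomials *)

(** The polynomial p has degree less than N. *)
Definition degb p N := forall a, (N <= size a)%N -> p a = 0.

Lemma fps_polyP p : fps_poly p <-> exists N, degb p N.
Proof.
split=> [|[N pN]].
  rewrite /fps_poly => /finite_seqP[s sE]; exists (\max_(a <- s) (size a).+1)%N => a aN.
  apply/eqP/negPn/negP => pa; have sa : a \in s.
    by have : [set a | p a != 0] a by []; rewrite sE.
  move: aN; rewrite leqNgt => /negP; apply.
  by have := leq_bigmax_seq (F := fun a : W => (size a).+1) a sa isT.
apply: (@sub_finite_set _ _ [set` words_upto n N]); last exact: finite_seq.
move=> a /= pa; rewrite mem_words_upto ltnNge; apply/negP => /pN pa0.
by rewrite pa0 eqxx in pa.
Qed.

Lemma degb_locfin p f N m : degb p N -> locfin p f m N.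
Proof. by move=> h w a _ /h ->; rewrite mul0r. Qed.

Lemma degbW p N N' : (N <= N')%N -> degb p N -> degb p N'.
Proof. by move=> NN h a aN; apply: h; exact: leq_trans NN aN. Qed.

Lemma degb_mul p q N N' : degb p N -> degb q N' -> degb (fps_mul p q) (N + N').
Proof.
move=> h h' w wN; apply: fps_mul0 => k.
have [kN|kN] := leqP N (size (take k w)); first by rewrite h// mul0r.
rewrite [q _]h' ?mulr0//.
have : (size (take k w) + size (drop k w) = size w)%N by rewrite -size_cat cat_take_drop.
move=> e; move: wN; rewrite -e => wN.
by rewrite -(leq_add2l N) (leq_trans wN)// leq_add2r ltnW.
Qed.

Lemma degb_zmul a p N : degb p N -> degb (zmul a p) (size a + N).
Proof.
elim: a => [//|i a IH] h; elim=> // j w _ /=; rewrite addSn ltnS => wN.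
by case: ifP => // _; exact: IH.
Qed.

Lemma degb_word f a : (forall i, exists N, degb (f i) N) -> exists N, degb (fps_word f a) N.
Proof.
move=> hf; elim: a => [|i a [N h]]; first by exists 1%N => -[].
by have [N' h'] := hf i; exists (N' + N)%N; exact: degb_mul.
Qed.

Lemma fps_comp_sum (J : Type) (s : seq J) (x : J -> R[i]) (p : J -> fps) f N w :
  (forall j, degb (p j) N) ->
  fps_comp (fun a => \sum_(j <- s) x j * p j a) f w = \sum_(j <- s) x j * fps_comp (p j) f w.
Proof.
move=> hN; have hs : degb (fun a => \sum_(j <- s) x j * p j a) N.
  by move=> a aN; rewrite big1// => j _; rewrite hN// mulr0.
rewrite (fps_compE (degb_locfin (m := size w) f hs))//.
under eq_bigr do rewrite mulr_suml.
rewrite exchange_big /=; apply: eq_bigr => j _.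
rewrite (fps_compE (degb_locfin (m := size w) f (hN j)))// mulr_sumr.
by apply: eq_bigr => a _; rewrite mulrA.
Qed.

(** Composition turns the monomial [Z_a] into the product [f_a] of series; it
    is iterated from one letter. *)
Lemma fps_comp_zmul a p f N w : degb p N ->
  fps_comp (zmul a p) f w = fps_mul (fps_word f a) (fps_comp p f) w.
Proof.
move=> h; elim: a w => [|i a IH] w; first exact: esym (mul1fps _ _).
have h' := degb_locfin (m := size w) f (@degb_zmul a _ _ h).
have [_] := fps_comp_lvar i h' (leqnn _); rewrite lvar_var -zmul_cons => ->.
by rewrite /= fps_mulA; congr fps_mul; apply/funext => v; exact: IH.
Qed.

Lemma fps_comp_mul p q f N N' w : degb p N -> degb q N' ->
  fps_comp (fps_mul p q) f w = fps_mul (fps_comp p f) (fps_comp q f) w.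
Proof.
move=> h h'.
have -> : fps_mul p q = fun v => \sum_(a <- words_upto n N) p a * zmul a q v.
  apply/funext => v; rewrite (@fps_mul_zmul _ _ _ (maxn N (size v).+1)) ?leq_max ?leqnn ?orbT//.
  set m := maxn _ _; rewrite (sum_words_upto m (fun a => p a * zmul a q v)).
  rewrite (sum_words_upto N (fun a => p a * zmul a q v)).
  rewrite [RHS](big_ord_widen m (fun k => \sum_(a : k.-tuple 'I_n) p a * zmul a q v)) ?leq_maxl//.
  rewrite [RHS]big_mkcond /=; apply: eq_bigr => k _; case: ltnP => // Nk.
  by rewrite big1// => a _; rewrite h ?mul0r// size_tuple.
pose NN := (N + N')%N.
have hz a : (size a < N)%N -> degb (zmul a q) NN.
  by move=> aN; apply: degbW (@degb_zmul a _ _ h'); rewrite leq_add2r ltnW.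
pose pz a := if (size a < N)%N then zmul a q else fun=> 0.
have -> : (fun v => \sum_(a <- words_upto n N) p a * zmul a q v) =
    fun v => \sum_(a <- words_upto n N) p a * pz a v.
  apply/funext => v; apply: eq_big_seq => a; rewrite mem_words_upto => aN.
  by rewrite /pz aN.
rewrite (@fps_comp_sum _ _ _ _ _ NN); last by move=> a; rewrite /pz; case: ifP => // /hz.
rewrite [RHS]/fps_mul.
rewrite [RHS](eq_bigr (fun k : 'I_(size w).+1 => \sum_(a <- words_upto n N)
    (p a * fps_word f a (take k w)) * fps_comp q f (drop k w))); last first.
  move=> k _; rewrite (fps_compE (degb_locfin (m := size w) f h)) ?mulr_suml//.
  by rewrite size_take_min (leq_trans (geq_minr _ _)).
rewrite [RHS]exchange_big /=; apply: eq_big_seq => a; rewrite mem_words_upto => aN.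
rewrite /pz aN (fps_comp_zmul _ _ _ h') /fps_mul mulr_sumr.
by apply: eq_bigr => k _; rewrite mulrA.
Qed.

Lemma fps_word_var a w : fps_word (@fps_var R n) a w = (w == a)%:R.
Proof.
elim: a w => [//|i a IH] w; rewrite /= zmul_var.
by case: w => [|j w] //=; rewrite eqseq_cons IH eq_sym; case: eqP.
Qed.

(** Composing [p o f = 0] with a substitution q such that [f o q = id] gives
    back p, because composition is multiplicative on polynomials. *)
Lemma fps_comp_inj_poly f (q : 'I_n -> fps) p N :
  (forall i, exists N, degb (f i) N) -> (forall i, exists N, degb (q i) N) ->
  (forall i, fps_comp (f i) q = fps_var R i) ->
  degb p N -> (forall w, fps_comp p f w = 0) -> forall w, p w = 0.
Proof.
move=> hf hq fq hp pf w.
have fwq a v : fps_comp (fps_word f a) q v = (v == a)%:R.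
  elim: a v => [|i a IH] v; first exact: fps_comp_one.
  have [N1 h1] := hf i; have [N2 h2] := degb_word a hf.
  rewrite /= (fps_comp_mul _ _ h1 h2) fq.
  have -> : fps_comp (fps_word f a) q = fps_word (@fps_var R n) a.
    by apply/funext => u; rewrite IH fps_word_var.
  exact: (fps_word_var (i :: a)).
have [M hM] : exists M, forall a, (size a < N)%N -> degb (fps_word f a) M.
  have /choice[d dP] : forall a, exists M, degb (fps_word f a) M by move=> a; exact: degb_word.
  exists (\max_(a <- words_upto n N) d a)%N => a aN; apply: degbW (dP a).
  by apply: leq_bigmax_seq; rewrite ?mem_words_upto.
pose fw a := if (size a < N)%N then fps_word f a else fun=> 0.
have e : fps_comp p f = fun v => \sum_(a <- words_upto n N) p a * fw a v.
  apply/funext => v; rewrite (fps_compE (degb_locfin (m := size v) f hp))//.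
  by apply: eq_big_seq => a; rewrite mem_words_upto => aN; rewrite /fw aN.
have : fps_comp (fps_comp p f) q w = 0.
  rewrite (_ : fps_comp p f = fun=> 0); last exact/funext.
  by rewrite (@fps_compE _ _ (size w) 0) ?big_nil// => v a _ _; rewrite mul0r.
rewrite e (@fps_comp_sum _ _ _ _ _ M); last by move=> a; rewrite /fw; case: ifP => // /hM.
have [wN <-|wN _] := ltnP (size w) N; last exact: hp.
rewrite (sum_seq1 (i := w)) ?words_upto_uniq ?mem_words_upto//.
  by rewrite /fw wN fwq eqxx mulr1.
move=> a aw; rewrite /fw; case: ifP => _; first by rewrite fwq eq_sym (negbTE aw) mulr0.
by rewrite (@fps_compE _ _ (size w) 0) ?big_nil ?mulr0// => v b _ _; rewrite mul0r.
Qed.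

(** ** Substitutions without constant term *)

Lemma fps_word_low f a w : (forall i, f i [::] = 0) -> (size w < size a)%N -> fps_word f a w = 0.
Proof.
move=> f0; elim: a w => [//|i a IH] w wa /=; apply: fps_mul0 => k.
case: w wa => [|j w] wa; first by rewrite f0 mul0r.
case: k => [|k]; first by rewrite f0 mul0r.
by rewrite /= IH ?mulr0// size_drop (leq_ltn_trans (leq_subr _ _)).
Qed.

Lemma locfin_low p f m : (forall i, f i [::] = 0) -> locfin p f m m.+1.
Proof. by move=> f0 w a wm ma; rewrite fps_word_low ?mulr0// (leq_ltn_trans wm). Qed.

Lemma fps_word_lead f i a j w : (forall i, f i [::] = 0) -> size a = size w ->
  fps_word f (i :: a) (j :: w) = f i [:: j] * fps_word f a w.
Proof.
move=> f0 aw; rewrite /= fps_mul_cons f0 mul0r add0r.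
case: w aw => [|k w] aw; first by rewrite fps_mul_nil.
rewrite fps_mul_cons [X in _ + X](_ : _ = 0) ?addr0// /fps_mul big1// => l _.
by rewrite [fps_word f a _]fps_word_low ?mulr0// aw size_drop ltnS leq_subr.
Qed.

(** The lowest homogeneous part of p is sent to that of [p o f] by the linear
    substitution with matrix J; this substitution is inverted one letter at a
    time. *)
Lemma fps_comp_inj_lead f p : (forall i, f i [::] = 0) ->
  \det (\matrix_(i, j) f i [:: j]) != 0 ->
  (forall w, fps_comp p f w = 0) -> forall w, p w = 0.
Proof.
move=> f0 detf pf.
pose J := \matrix_(i, j) f i [:: j].
(* the homogeneous case, by peeling off the first letter *)
have key k (d : fps) : (forall w, size w = k -> \sum_(a : k.-tuple 'I_n) d a * fps_word f a w = 0) ->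
    forall a, size a = k -> d a = 0.
  elim: k d => [|k IH] d h a.
    move=> /size0nil ->; have := h [::] erefl.
    by rewrite (sum_tuple0 (fun a => d a * fps_word f a [::])) /= mulr1.
  case: a => [//|i a] [ak].
  suff : (\row_i d (i :: a)) *m J = 0.
    move=> /(congr1 (fun v => v *m invmx J)); rewrite mulmxK ?mul0mx ?unitmxE ?unitfE//.
    by move=> /rowP/(_ i); rewrite !mxE.
  apply/rowP => j; rewrite !mxE.
  rewrite (eq_bigr (fun i => f i [:: j] * d (i :: a))); last by move=> l _; rewrite !mxE mulrC.
  apply: (IH (fun a => \sum_i f i [:: j] * d (i :: a))) => // w wk.
  have := h (j :: w) (congr1 S wk).
  rewrite (sum_tupleS _ (fun a => d a * fps_word f a (j :: w))) exchange_big /= => e.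
  rewrite -[RHS]e.
  apply: eq_bigr => b _; rewrite mulr_suml; apply: eq_bigr => l _.
  by rewrite -[fps_mul _ _ _]/(fps_word f (l :: b) (j :: w)) fps_word_lead ?size_tuple// mulrA [d _ * _]mulrC.
suff h k a : (size a < k)%N -> p a = 0 by move=> w; exact: (h (size w).+1).
elim: k a => [//|k IH] a; rewrite ltnS leq_eqVlt => /orP[/eqP ak|]; last exact: IH.
apply: (key k p) => // w wk.
have := pf w; rewrite (fps_compE (locfin_low (m := size w) p f0)) // wk => e.
have := e; rewrite (sum_words_upto k.+1 (fun a => p a * fps_word f a w)) big_ord_recr /=.
rewrite big1 ?add0r// => l _; rewrite big1// => b _.
by rewrite IH ?mul0r// size_tuple.
Qed.

End formal.

(** * The three model properties yield a universal model *)

Section coefficients.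
Context (R : realType) (n : nat).
Local Notation F2 := (H2f R n).
Local Notation S := (@Mshift R n).
Implicit Types (c d : F2) (a b : word n).

Lemma coef_Mshift j c : coef (Mshift j c) = lvar j (coef c).
Proof.
apply/funext => w; rewrite /coef MshiftE reidxE; last exact: pinj_lpre.
by case: w => [|i w] //=; case: eqP.
Qed.

Lemma coef_Lambda j c : coef (Lambda j c) = rvar j (coef c).
Proof.
apply/funext => w; rewrite /coef LambdaE reidxE; last exact: pinj_rpre.
by case: w => [|i w] //=; case: eqP.
Qed.

Lemma coef_fbasis a w : coef (fbasis R a) w = (w == a)%:R.
Proof. by rewrite /coef /fbasis ldeltaE; case: eqP. Qed.

Lemma coef_onew : coef (fbasis R ([::] : word n)) = onew R (n := n).
Proof. by apply/funext => w; rewrite coef_fbasis. Qed.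

Lemma coef_inj c d : coef c = coef d -> c = d.
Proof. by move=> cd; apply: l2_ext => w; exact: (congr1 (fun F => F w) cd). Qed.

Lemma degb_fbasis a : degb (coef (fbasis R a)) (size a).+1.
Proof.
by move=> w wa; rewrite coef_fbasis; case: eqP wa => // ->; rewrite ltnn.
Qed.

End coefficients.

Section formal_models.
Context (R : realType) (n : nat) (f : 'I_n -> fps R n) (g : 'I_n -> H2f R n).
Context (MZ : 'I_n -> H2f R n -> H2f R n).
Local Notation F2 := (H2f R n).
Local Notation S := (@Mshift R n).

(** An element of [H^2(f)] is determined by its composition with f. In terms
    of compositions, left and right creation are left and right multiplication
    by [f_j] while [M_Zi] is left multiplication by [Z_i], so the commutation
    relations are those of formal series. *)
Lemma model_S_universal : model_S f g MZ -> universal_model f g MZ.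
Proof.
case=> hf det hg hMZ [Mf hMf fMf].
have f0 i : f i [::] = 0 by case: (hf i).
have loc p m : locfin p f m m.+1 by exact: locfin_low.
have inj (c d : F2) : (forall w, fps_comp (coef c) f w = fps_comp (coef d) f w) -> c = d.
  move=> cd; apply: coef_inj; apply/funext => w; apply/eqP; rewrite -subr_eq0; apply/eqP.
  have := @fps_comp_inj_lead R n f (fun a => -1 * coef d a + coef c a) f0 det.
  move=> /(_ _ w) h; rewrite addrC -mulN1r h// => v.
  by rewrite (fps_comp_lin _ (loc _ _) (loc _ _) (leqnn _)) cd mulN1r addNr.
have evL j (c : F2) : fps_comp (coef (Lambda j c)) f = fps_mul (fps_comp (coef c) f) (f j).
  by apply/funext => w; rewrite coef_Lambda; case: (fps_comp_rvar j (loc (coef c) _) (leqnn (size w))).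
have evS j (c : F2) : fps_comp (coef (S j c)) f = fps_mul (f j) (fps_comp (coef c) f).
  by apply/funext => w; rewrite coef_Mshift; case: (fps_comp_lvar j (loc (coef c) _) (leqnn (size w))).
split.
- move=> i; have [bM eM] := hMZ i; split=> // j c; apply: inj => w.
  by rewrite eM !evL eM fps_mulA.
- move=> i; have [bM eM] := hMZ i; apply: inj => w; rewrite eM hg coef_onew.
  by rewrite -[RHS]fps_mul1; congr fps_mul; apply/funext => v; exact: fps_comp_one.
- suff -> : S = Mf by [].
  apply/funext => j; apply/funext => c; apply: inj => w.
  by have [_ ->] := hMf j; rewrite evS.
Qed.

(** The same computation on polynomials, which are dense; here the series
    [f_j(M_Z)] is a finite sum, identified with [S_j] on basis vectors. *)
Lemma model_A_universal : model_A f g MZ -> universal_model f g MZ.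
Proof.
case=> hf [q [hq fq qf]] hg hMZ.
have df i : exists N, degb (f i) N by exact/fps_polyP.
have dq i : exists N, degb (q i) N by exact/fps_polyP.
pose poly (c : F2) := exists N, degb (coef c) N.
have MZp i (c : F2) : poly c -> poly (MZ i c) /\
    fps_comp (coef (MZ i c)) f = fps_mul (fps_var R i) (fps_comp (coef c) f).
  by move=> /fps_polyP pc; have [_ /(_ c pc) [h1 h2]] := hMZ i; split=> //; exact/fps_polyP.
have inj (c d : F2) : poly c -> poly d ->
    (forall w, fps_comp (coef c) f w = fps_comp (coef d) f w) -> c = d.
  move=> [N1 h1] [N2 h2] cd; apply: coef_inj; apply/funext => w.
  apply/eqP; rewrite -subr_eq0; apply/eqP.
  have hN : degb (fun a => -1 * coef d a + coef c a) (maxn N1 N2).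
    by move=> a; rewrite geq_max => /andP[a1 a2]; rewrite h1// h2// mulr0 addr0.
  have := fps_comp_inj_poly df dq fq hN.
  move=> /(_ _ w) h; rewrite addrC -mulN1r h// => v.
  have l1 := degb_locfin (m := size v) f (degbW (leq_maxl N1 N2) h1).
  have l2 := degb_locfin (m := size v) f (degbW (leq_maxr N1 N2) h2).
  by rewrite (fps_comp_lin _ l2 l1 (leqnn _)) cd mulN1r addNr.
have polyL j (c : F2) : poly c -> poly (Lambda j c) /\
    fps_comp (coef (Lambda j c)) f = fps_mul (fps_comp (coef c) f) (f j).
  move=> [N h]; split.
    exists N.+1 => a; rewrite coef_Lambda; case/lastP: a => // a i.
    by rewrite size_rcons ltnS rvar_rcons => /h ->; case: ifP.
  apply/funext => w; rewrite coef_Lambda.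
  by case: (fps_comp_rvar j (degb_locfin (m := size w) f h) (leqnn _)).
have polyS j (c : F2) : poly c -> poly (S j c) /\
    fps_comp (coef (S j c)) f = fps_mul (f j) (fps_comp (coef c) f).
  move=> [N h]; split.
    by exists N.+1 => -[|i a] //=; rewrite ltnS coef_Mshift /= => /h ->; case: ifP.
  apply/funext => w; rewrite coef_Mshift.
  by case: (fps_comp_lvar j (degb_locfin (m := size w) f h) (leqnn _)).
have polyb a : poly (fbasis R a) by exists (size a).+1; exact: degb_fbasis.
have bM i : bounded_op (MZ i) by case: (hMZ i).
split.
- move=> i; split=> // j c; move: c; suff h : MZ i \o Lambda j = Lambda j \o MZ i.
    by move=> c; exact: (congr1 (fun F => F c) h).
  apply: (bo_eq_total _ _ (@fbasis_set_total R n)).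
  + by apply: bo_comp => //; exact: bo_Lambda.
  + by apply: bo_comp => //; exact: bo_Lambda.
  move=> _ [a ->] /=; have pa := polyb a.
  have [pL eL] := polyL j _ pa; have [pM eM] := MZp i _ pa.
  have [pML eML] := MZp i _ pL; have [pLM eLM] := polyL j _ pM.
  by apply: inj => // w; rewrite eML eL eLM eM fps_mulA.
- move=> i; have [pM eM] := MZp i _ (polyb [::]); have [/fps_polyP pg eg] := hg i.
  apply: inj => // w; rewrite eM eg coef_onew.
  by rewrite -[RHS]fps_mul1; congr fps_mul; apply/funext => v; exact: fps_comp_one.
- left=> j; split; first exact: bo_Mshift.
  have [N0 hN0] := df j.
  have pw a (c : F2) : poly c -> poly (word_op MZ a c) /\
      fps_comp (coef (word_op MZ a c)) f = zmul a (fps_comp (coef c) f).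
    move=> pc; elim: a => [//|i a [IH1 IH2]] /=; have [h1 h2] := MZp i _ IH1.
    by split=> //; rewrite h2 IH2 -zmul_cons.
  have psumN m : (N0 <= m)%N -> forall h, psum (f j) MZ m h = psum (f j) MZ N0 h.
    move=> Nm h; rewrite /psum [RHS](big_ord_widen m (fun k => \sum_(a : k.-tuple 'I_n) f j a *: word_op MZ a h))//.
    rewrite [RHS]big_mkcond /=; apply: eq_bigr => k _; case: ltnP => // Nk.
    by rewrite big1// => a _; rewrite hN0 ?scale0r// size_tuple.
  have Pe : psum (f j) MZ N0 = S j.
    apply: (bo_eq_total _ _ (@fbasis_set_total R n)); [exact: bo_psum|exact: bo_Mshift|].
    move=> _ [b ->]; have pb := polyb b; have [pS eS] := polyS j _ pb.
    have psE (s : seq (word n)) : let c : F2 := \sum_(a <- s) f j a *: word_op MZ a (fbasis R b) in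
        poly c /\ forall w, fps_comp (coef c) f w =
          \sum_(a <- s) f j a * zmul a (fps_comp (coef (fbasis R b)) f) w.
      elim: s => [|a s [[N1 h1] IH]] /=.
        rewrite big_nil; split; first by exists 0%N.
        by move=> w; rewrite big_nil (@fps_compE _ _ _ _ (size w) 0) ?big_nil// => v c _ _; rewrite mul0r.
      have [[N2 h2] e2] := pw a _ pb; rewrite big_cons.
      set c := \sum_(a <- s) _ in h1 IH *.
      have ce : coef (f j a *: word_op MZ a (fbasis R b) + c) =
        fun v => f j a * coef (word_op MZ a (fbasis R b)) v + coef c v by [].
      split.
        exists (maxn N1 N2) => v; rewrite geq_max => /andP[v1 v2].
        by rewrite ce h1// h2// mulr0 addr0.
      move=> w; rewrite ce big_cons -IH -e2.
      have l1 := degb_locfin (m := size w) f (degbW (leq_maxl N1 N2) h1).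
      have l2 := degb_locfin (m := size w) f (degbW (leq_maxr N1 N2) h2).
      by rewrite (fps_comp_lin _ l2 l1 (leqnn _)).
    have [pp _] := psE (words_upto n N0).
    rewrite psum_words; apply: inj => // w; rewrite eS.
    pose m := maxn N0 (size w).+1.
    rewrite -psum_words -(psumN m) ?leq_maxl// psum_words (psE _).2.
    by rewrite -fps_mul_zmul// leq_max leqnn orbT.
  move=> h; rewrite -Pe; apply: cvg_near_cst; exists N0 => // m /= Nm.
  exact: psumN.
Qed.

End formal_models.

Section holomorphic_model.
Context (R : realType) (n : nat).
Local Notation F2 := (H2f R n).
Local Notation S := (@Mshift R n).

(** The level sums are bounded by [|c|^2], and the roots of order 2k of a
    fixed bound are at most [1 + e] for large k, by the Bernoulli inequality.
    *)
Lemma free_hol_coef (c : F2) : free_hol 1 (coef c).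
Proof.
rewrite /free_hol limn_esup_lim invr1; apply/lee_addgt0Pr => e e0.
apply: lime_le; first exact: is_cvg_esups.
pose M := sqnorm c; have M0 : 0 <= M by exact: sqnorm_ge0.
exists (Num.truncn (M / e)).+1 => // m /= Mm.
apply: ge_ereal_sup => _ [k /= mk <-]; rewrite -EFinD lee_fin.
have k0 : (0 < k)%N by apply: leq_trans mk; apply: leq_ltn_trans Mm.
have sM : \sum_(a : k.-tuple 'I_n) complex.Re `|coef c a| ^+ 2 <= M.
  have := sqnorm_l2_fin c (s := [seq tval a | a <- enum {:k.-tuple 'I_n}]).
  rewrite big_map big_enum => h; apply: le_trans (h _).
    apply: ler_sum => a _; rewrite sqnorm_cplx normc_def /= sqr_sqrtr//.
    by rewrite addr_ge0 ?sqr_ge0.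
  by rewrite map_inj_uniq ?enum_uniq//; exact: val_inj.
have s0 : 0 <= \sum_(a : k.-tuple 'I_n) complex.Re `|coef c a| ^+ 2.
  by apply: sumr_ge0 => a _; exact: sqr_ge0.
have e1 : 0 <= 1 + e by rewrite addr_ge0// ltW.
have kk : 0 < (2 * k)%:R :> R by rewrite ltr0n muln_gt0.
have -> : 1 + e = ((1 + e) `^ (2 * k)%:R) `^ ((2 * k)%:R^-1).
  by rewrite -powRrM divff ?gt_eqF// powRr1.
apply: ge0_ler_powR; rewrite ?nnegrE ?invr_ge0 ?ler0n// ?powR_ge0//.
apply: le_trans sM _; rewrite powR_mulrn//.
have Mk : M <= k%:R * e.
  rewrite -ler_pdivrMr//; apply: le_trans (ltW (truncnS_gt _)) _.
  by rewrite ler_nat (leq_trans Mm).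
apply: le_trans Mk _.
have bern j : j%:R * e <= (1 + e) ^+ j.
  suff : 1 + j%:R * e <= (1 + e) ^+ j by apply: le_trans; rewrite lerDr.
  elim: j => [|j IH]; first by rewrite mul0r addr0.
  rewrite exprS; apply: le_trans (ler_wpM2l e1 IH).
  rewrite -natr1; have : 0 <= (j%:R : R) by rewrite ler0n.
  by have := ltW e0; nra.
apply: le_trans (bern _) _; rewrite ler_weXn2l// ?lerDl ?ltW//.
by rewrite leq_pmull.
Qed.

Section psum_shift.
Context (H : hilbertType R) (A : 'I_n -> H -> H) (bA : forall i, bounded_op (A i)).

Lemma psum_Lambda j (c : F2) m h : psum (coef (Lambda j c)) A m.+1 h = psum (coef c) A m (A j h).
Proof.
rewrite !psum_words sum_words_upto_rcons coef_Lambda scale0r add0r.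
apply: eq_bigr => a _; rewrite (sum_fin1 (j := j)) => [|i ij].
  by rewrite rvar_rcons eqxx word_op_rcons.
by rewrite rvar_rcons (negbTE ij) scale0r.
Qed.

Lemma psum_Mshift j (c : F2) m h : psum (coef (S j c)) A m.+1 h = A j (psum (coef c) A m h).
Proof.
rewrite !psum_words (bo_sum _ _ _ (bA j)) sum_words_upto big_ord_recl /=.
rewrite (sum_tuple0 (fun a => coef (S j c) a *: word_op A a h)) coef_Mshift scale0r add0r.
under eq_bigr do rewrite (sum_tupleS _ (fun a => lvar j (coef c) a *: word_op A a h)).
rewrite (sum_words_upto m (fun a => A j (coef c a *: word_op A a h))).
apply: eq_bigr => k _; rewrite (sum_fin1 (j := j)) => [|i ij].
  by apply: eq_bigr => a _; rewrite /= eqxx (boZ _ _ (bA j)).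
by rewrite big1// => a _; rewrite /= (negbTE ij) scale0r.
Qed.

Lemma eval_normP (p : fps R n) T : bounded_op T ->
  (forall e : R, 0 < e -> \forall m \near \oo, forall h, rn (psum p A m h - T h) <= e * rn h) ->
  eval_norm p A T.
Proof.
move=> bT pT; split=> //; apply/cvgrPdist_lt => e e0.
have e2 : 0 < e / 2 by rewrite divr_gt0.
have := pT _ e2; apply: filterS => m hm.
have bd := bo_sub (bo_psum p m bA) bT.
rewrite sub0r normrN ger0_norm; last exact: (opnorm_ge0 bd).
apply: (@le_lt_trans _ _ (e / 2)); last by rewrite ltr_pdivrMr// ltr_pMr// ltr1n.
by apply: opnorm_le => //; exact: ltW.
Qed.

Lemma eval_norm_cst (p : fps R n) T : bounded_op T ->
  (\forall m \near \oo, forall h, psum p A m h = T h) -> eval_norm p A T.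
Proof.
move=> bT pT; apply: eval_normP => // e e0; apply: filterS pT => m hm h.
by rewrite hm subrr rn0 mulr_ge0 ?rn_ge0// ltW.
Qed.

Lemma eval_norm_one : eval_norm (coef (fbasis R ([::] : word n))) A idfun.
Proof.
apply: eval_norm_cst; first exact: bo_id.
exists 1%N => // m /= m1 h; rewrite psum_words (sum_seq1 (i := [::])) ?words_upto_uniq ?mem_words_upto//.
  by rewrite coef_fbasis eqxx scale1r.
by move=> a a0; rewrite coef_fbasis (negbTE a0) scale0r.
Qed.

Lemma eval_norm_var i : eval_norm (fps_var R i) A (A i).
Proof.
apply: eval_norm_cst => //.
exists 2%N => // m /= m1 h; rewrite psum_words (sum_seq1 (i := [:: i])) ?words_upto_uniq ?mem_words_upto//.
  by rewrite /fps_var eqxx scale1r.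
by move=> a a0; rewrite /fps_var (negbTE a0) scale0r.
Qed.

Lemma eval_norm_Lambda j (c : F2) T : eval_norm (coef c) A T ->
  eval_norm (coef (Lambda j c)) A (T \o A j).
Proof.
move=> cT; have bT : bounded_op T by case: cT.
apply: eval_normP => [|e e0]; first exact: bo_comp.
have [C C0 AC] := bo_ex (bA j); have C1 : 0 < C + 1 by rewrite ltr_wpDl.
have [N _ NP] := eval_norm_bound bA cT (divr_gt0 e0 C1).
exists N.+1 => // -[//|m] /=; rewrite ltnS => Nm h; rewrite psum_Lambda.
apply: le_trans (NP m Nm _) _; rewrite mulrAC ler_pdivrMr// -mulrA ler_wpM2l ?(ltW e0)//.
rewrite (le_trans (AC h))// mulrC ler_wpM2l ?rn_ge0// lerDl//.
Qed.

Lemma eval_norm_Mshift j (c : F2) T : eval_norm (coef c) A T ->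
  eval_norm (coef (S j c)) A (A j \o T).
Proof.
move=> cT; have bT : bounded_op T by case: cT.
apply: eval_normP => [|e e0]; first exact: bo_comp.
have [C C0 AC] := bo_ex (bA j); have C1 : 0 < C + 1 by rewrite ltr_wpDl.
have [N _ NP] := eval_norm_bound bA cT (divr_gt0 e0 C1).
exists N.+1 => // -[//|m] /=; rewrite ltnS => Nm h; rewrite psum_Mshift -(boB _ _ (bA j)).
apply: le_trans (AC _) _; apply: le_trans (ler_wpM2l C0 (NP m Nm h)) _.
rewrite mulrA ler_wpM2r ?rn_ge0// mulrCA -[leRHS]mulr1 ler_wpM2l ?(ltW e0)//.
by rewrite ler_pdivrMr// mul1r lerDl.
Qed.

Lemma eval_norm_sub (c d : F2) T T' : eval_norm (coef c) A T -> eval_norm (coef d) A T' ->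
  eval_norm (coef (c - d)) A (fun h => T h - T' h).
Proof.
move=> cT dT'; apply: eval_normP => [|e e0].
  by apply: bo_sub; [case: cT|case: dT'].
have e2 : 0 < e / 2 by rewrite divr_gt0.
apply: filterS2 (eval_norm_bound bA cT e2) (eval_norm_bound bA dT' e2) => m h1 h2 h.
have -> : psum (coef (c - d)) A m h = psum (coef c) A m h - psum (coef d) A m h.
  rewrite !psum_words -sumrB; apply: eq_bigr => a _.
  by rewrite -scalerBl.
rewrite opprD opprK addrACA [X in _ + X]addrC -[X in _ + X]opprB.
by rewrite (le_trans (rnB _ _))// [e]splitr mulrDl lerD.
Qed.

End psum_shift.

(** An element of [H^2(f)] is determined by its values at the points [f(X)],
    by the independence hypothesis on f; there left and right creation become
    left and right multiplication by [f_j(X)]. *)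
Lemma model_F_universal (f : 'I_n -> fps R n) (g : 'I_n -> F2) (MZ : 'I_n -> F2 -> F2) :
  model_F f g MZ -> universal_model f g MZ.
Proof.
case=> H [gamma [_ g0 [_ hX hG hg [hMZ [Mf hMf fMf]]]]].
have inj (c d : F2) : (forall X : 'I_n -> H -> H, op_ball gamma X -> forall A,
     (forall i, eval_norm (f i) X (A i)) -> exists2 T, eval_norm (coef c) A T & eval_norm (coef d) A T) ->
   c = d.
  move=> cd; apply/eqP; rewrite -subr_eq0; apply/eqP; apply: coef_inj.
  rewrite (hG _ (free_hol_coef _)); first by apply/funext.
  move=> X bX; have [A fA _] := hX X bX; exists A => //.
  have bA i : bounded_op (A i) by case: (fA i).
  have [T cT dT] := cd X bX A fA.
  have := eval_norm_sub bA cT dT; rewrite (_ : (fun h => _) = fun=> 0)//.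
  by apply/funext => h; rewrite subrr.
have uniqA (X A A' : 'I_n -> H -> H) : op_ball gamma X -> (forall i, eval_norm (f i) X (A i)) ->
    (forall i, eval_norm (f i) X (A' i)) -> A' = A.
  move=> [bX _] fA fA'; apply/funext => i; exact: eval_norm_unique bX (fA' i) (fA i).
have evM (p : fps R n) (B : F2 -> F2) (c : F2) (X A : 'I_n -> H -> H) P : lmul_hol H gamma f p B -> op_ball gamma X ->
    (forall i, eval_norm (f i) X (A i)) -> eval_norm p X P ->
    exists2 T, eval_norm (coef c) A T & eval_norm (coef (B c)) A (P \o T).
  move=> [_ hB] bX fA pP; have [P' [T [pP' [A1 fA1 cT] [A2 fA2 BcT]]]] := hB c X bX.
  rewrite (uniqA _ _ _ bX fA fA1) in cT; rewrite (uniqA _ _ _ bX fA fA2) in BcT.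
  by exists T => //; rewrite (eval_norm_unique bX.1 pP pP').
split.
- move=> i; have bM : bounded_op (MZ i) by case: (hMZ i).
  split=> // j c; apply: inj => X bX A fA; have bA k : bounded_op (A k) by case: (fA k).
  have [T cT McT] := evM _ _ c _ _ _ (hMZ i) bX fA (eval_norm_var bX.1 i).
  have [T' LcT' MLcT'] := evM _ _ (Lambda j c) _ _ _ (hMZ i) bX fA (eval_norm_var bX.1 i).
  exists (X i \o T') => //.
  rewrite (eval_norm_unique bA LcT' (eval_norm_Lambda bA j cT)).
  exact: (eval_norm_Lambda bA j McT).
- move=> i; apply: inj => X bX A fA; have bA k : bounded_op (A k) by case: (fA k).
  have [T cT McT] := evM _ _ (fbasis R [::]) _ _ _ (hMZ i) bX fA (eval_norm_var bX.1 i).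
  rewrite (eval_norm_unique bA cT (eval_norm_one bA)) in McT.
  exists (X i) => //; have [A' fA' gA'] := hg i X bX.
  by rewrite (uniqA _ _ _ bX fA fA') in gA'.
- suff -> : S = Mf by [].
  apply/funext => j; apply/funext => c; apply: inj => X bX A fA.
  have bA k : bounded_op (A k) by case: (fA k).
  have [T cT McT] := evM _ _ c _ _ _ (hMf j) bX fA (fA j).
  by exists (A j \o T) => //; exact: eval_norm_Mshift.
Qed.

Lemma model_universal (f : 'I_n -> fps R n) (g : 'I_n -> F2) (MZ : 'I_n -> F2 -> F2) :
  model f g MZ -> universal_model f g MZ.
Proof.
by case; [exact: model_A_universal|exact: model_S_universal|exact: model_F_universal].
Qed.

End holomorphic_model.

(** * The functional model *)

Lemma sqnorm_l2_ord (R : realType) (n : nat) (H : hilbertType R) (h : l2 'I_n H) :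
  sqnorm h = \sum_i sqnorm (h i).
Proof.
have us : uniq (enum 'I_n) by exact: enum_uniq.
apply/le_anti/andP; split.
  apply: sqnorm_l2_le => s uss; rewrite -[leRHS]big_enum /=.
  by apply: ler_sum_sub => // [i|i _]; [exact: sqnorm_ge0|rewrite mem_enum].
by rewrite -big_enum; exact: sqnorm_l2_fin.
Qed.

Section hsum_lemmas.
Context (R : realType) (V W : hilbertType R).

Lemma inner_hsum (x y : hsum V W) : inner x y = inner x.1 y.1 + inner x.2 y.2.
Proof. by []. Qed.

Lemma sqnorm_hsum (x : hsum V W) : sqnorm x = sqnorm x.1 + sqnorm x.2.
Proof. by rewrite /sqnorm inner_hsum raddfD. Qed.

Lemma bo_fst : bounded_op (fun x : hsum V W => x.1).
Proof.
apply: bo_isom => // x; rewrite rn_le sqnorm_hsum lerDl; exact: sqnorm_ge0.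
Qed.

Lemma bo_snd : bounded_op (fun x : hsum V W => x.2).
Proof.
apply: bo_isom => // x; rewrite rn_le sqnorm_hsum lerDr; exact: sqnorm_ge0.
Qed.

Lemma bo_pair (K : hilbertType R) (A : K -> V) (B : K -> W) : bounded_op A -> bounded_op B ->
  bounded_op (fun x => (A x, B x) : hsum V W).
Proof.
move=> bA bB; have [M M0 AM] := bo_ex bA; have [N N0 BN] := bo_ex bB.
apply: (@boP _ _ _ _ (M + N)) => [a x y|x].
  by rewrite (boD _ _ bA) (boZ _ _ bA) (boD _ _ bB) (boZ _ _ bB).
rewrite sqnorm_rn_le ?addr_ge0// sqnorm_hsum /=.
have := AM x; have := BN x; rewrite !sqnorm_rn_le// => h1 h2.
have h3 : 0 <= M * N * sqnorm x by rewrite !mulr_ge0 ?sqnorm_ge0.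
have -> : (M + N) ^+ 2 * sqnorm x =
  M ^+ 2 * sqnorm x + N ^+ 2 * sqnorm x + 2 * (M * N * sqnorm x) by ring.
lra.
Qed.

End hsum_lemmas.

Section functional_model.
Context (R : realType) (n : nat) (f : 'I_n -> fps R n) (g : 'I_n -> H2f R n).
Context (MZ : 'I_n -> H2f R n -> H2f R n).
Context (um : universal_model f g MZ) (hb : bounded_eval f MZ).
Context (E Es : hilbertType R) (Theta : H2t n Es -> H2t n E).
Context (ma : multi_analytic MZ Theta) (ct : opnorm Theta <= 1).
Local Notation F2 := (H2f R n).
Local Notation Dsp := (Delta_space Theta).
Local Notation Delta := (Delta_Theta Theta).
Local Notation toD := (to_clrange Delta).
Local Notation Hm := (model_space Theta).
Local Notation Amb := (model_ambient Theta).
Local Notation J := (@subsp_val R Amb (orthoc (@model_graph R n E Es Theta))).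

Let bT : bounded_op Theta := ma.1.
Let ThS j y : Theta (fshift j y) = fshift j (Theta y) := multi_analytic_shift um hb ma j y.
Let bM i : bounded_op (MZ i). Proof. by case: um => aM _ _; case: (aM i). Qed.

Let Th_rn y : rn (Theta y) <= rn y. Proof. exact: bo_contr. Qed.

Let DeltaP : [/\ bounded_op Delta, forall x, 0 <= inner (Delta x) x &
  forall x, Delta (Delta x) = x - adj Theta (Theta x)].
Proof.
have bB : bounded_op (adj Theta \o Theta) by apply: bo_comp => //; exact: bo_adj.
have sB x y : inner ((adj Theta \o Theta) x) y = inner x ((adj Theta \o Theta) y).
  by rewrite /= -(adjE _ _ bT) -(adjEr _ _ bT).
have cB x : rn ((adj Theta \o Theta) x) <= rn x.
  by rewrite /= (le_trans (adj_contr bT Th_rn _)).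
by case: (opsqrtP bB sB cB).
Qed.

Lemma bo_Delta : bounded_op Delta. Proof. by case: DeltaP. Qed.

Lemma inner_Delta x y : inner (Delta x) (Delta y) = inner x y - inner (Theta x) (Theta y).
Proof.
have [bD D0 DD] := DeltaP.
by rewrite (pos_self bD D0) DD innerBr (adjE _ _ bT).
Qed.

Lemma sqnorm_Delta y : sqnorm (Delta y) = sqnorm y - sqnorm (Theta y).
Proof. by rewrite /sqnorm inner_Delta raddfB. Qed.

Lemma inner_toD x y : inner (toD x) (toD y) = inner x y - inner (Theta x) (Theta y).
Proof. exact: inner_Delta. Qed.

Lemma bo_toD : bounded_op toD.
Proof.
have [M M0 DM] := bo_ex bo_Delta; apply: (@boP _ _ _ _ M) => [a x y|x]; last exact: DM.
by apply: subsp_val_inj; rewrite /= (boD _ _ bo_Delta) (boZ _ _ bo_Delta).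
Qed.

Lemma total_toD : total_set (range toD).
Proof. exact: total_clrange. Qed.

Lemma inner_fshift (K : hilbertType R) i j (x y : H2t n K) :
  inner (fshift i x) (fshift j y) = if i == j then inner x y else 0.
Proof.
rewrite (adjE _ _ (bo_fshift _ i)) adj_fshift bshift_fshift.
by case: eqP => //; rewrite inner0r.
Qed.

Lemma fshift_etens (K : hilbertType R) i (c : F2) (v : K) :
  fshift i (etens c v) = etens (Mshift i c) v.
Proof. exact: (tensop_etens _ _ (bo_Mshift _ i) (bo_id K)). Qed.

Lemma toD_shift_inner i j x y : inner (toD (fshift i x)) (toD (fshift j y)) =
  if i == j then inner (toD x) (toD y) else 0.
Proof.
by rewrite !inner_toD !ThS !inner_fshift; case: eqP => //; rewrite subrr.
Qed.

(** Theta intertwines the shifts, so the maps [toD y |-> toD (S_i y)] preserve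
    inner products and have orthogonal ranges. *)
Lemma V_ex : exists V : 'I_n -> Dsp -> Dsp,
  row_isom V /\ forall i y, V i (toD y) = toD (fshift i y).
Proof.
have /choice[V VP] : forall i, exists V : Dsp -> Dsp, bounded_op V /\
    forall y, V (toD y) = toD (fshift i y).
  move=> i; have bB := bo_comp (bo_fshift Es i) bo_toD.
  have [|V [bV VE _]] := clrange_ext (Q := Delta) (B := toD \o fshift i) bo_Delta bB.1 (ler01 : 0 <= 1 :> R).
    move=> x; rewrite mul1r rn_le.
    have e : sqnorm (toD (fshift i x)) = sqnorm (toD x) by rewrite /sqnorm toD_shift_inner eqxx.
    by rewrite -[leLHS]/(sqnorm (toD (fshift i x))) e.
  by exists V.
exists V; split=> [|i y]; last by case: (VP i).
have bV i : bounded_op (V i) by case: (VP i).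
have VE i y : V i (toD y) = toD (fshift i y) by case: (VP i).
split=> // i j w.
pose B := if i == j then (idfun : Dsp -> Dsp) else (fun=> 0).
have bB : bounded_op B by rewrite /B; case: eqP => _; [exact: bo_id|exact: bo_zero].
have -> : (if i == j then w else 0) = B w by rewrite /B; case: eqP.
move: w; suff h : adj (V i) \o V j = B by move=> w; exact: (congr1 (fun F => F w) h).
apply: (bo_eq_total _ bB total_toD).
  by apply: bo_comp => //; exact: bo_adj.
move=> _ [y _ <-] /=; apply/eqP; rewrite -subr_eq0; apply/eqP/total_toD => _ [x _ <-].
rewrite innerBl -(adjEr _ _ (bV i)) !VE toD_shift_inner eq_sym /B.
by case: eqP; rewrite ?subrr// inner0l subrr.
Qed.

Lemma total_toD_etens : total_set [set w | exists (c : F2) (v : Es), w = toD (etens c v)].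
Proof.
move=> w h; apply: total_toD => _ [y _ <-]; rewrite (adjEr _ _ bo_toD).
rewrite (_ : adj toD w = 0) ?inner0l//; apply: total_etens => _ [c [v ->]].
by rewrite -(adjEr _ _ bo_toD) h//; exists c, v.
Qed.

(** The row isometry V is covered by the maps [c |-> toD (c (x) v)], which
    intertwine it with S; [D_i] is what they transport from [M_Zi]. *)
Lemma model_D_ex : exists D : 'I_n -> Dsp -> Dsp, is_model_D MZ D.
Proof.
have [V [iV VE]] := V_ex; have [aM _ _] := um.
pose X : set (F2 -> Dsp) := [set chi | exists v, chi = fun c => toD (etens c v)].
have Xchi chi : X chi -> bounded_op chi /\ forall j c, chi (Mshift j c) = V j (chi c).
  move=> [v ->]; split; first exact: (bo_comp (bo_etensl _ v) bo_toD).
  by move=> j c; rewrite VE fshift_etens.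
have tX : total_set [set h | exists chi c, X chi /\ h = chi c].
  move=> w h; apply: total_toD_etens => _ [c [v ->]]; apply: h.
  by exists (fun c => toD (etens c v)), c; split=> //; exists v.
have /choice[D DP] : forall i, exists D : Dsp -> Dsp, bounded_op D /\
    forall c v, D (toD (etens c v)) = toD (etens (MZ i c) v).
  move=> i; have [D [bD _ DX _]] := transfer (row_isom_contr iV) Xchi tX (aM i)
    (opnorm_ge0 (bM i)) (fun c => opnormP c (bM i)).
  exists D; split=> // c v; apply: (DX (fun c => toD (etens c v))); by exists v.
exists D => i; have [bD DE] := DP i; split=> // y.
have bt := bo_tensop (bM i) (bo_id Es).
suff h : D i \o toD = toD \o tensop (MZ i) (idfun : Es -> Es) by exact: (congr1 (fun F => F y) h).
apply: (bo_eq_total _ _ (@total_etens R _ Es)).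
- exact: (bo_comp bo_toD bD).
- exact: (bo_comp bt bo_toD).
- by move=> _ [c [v ->]] /=; rewrite DE (tensop_etens _ _ (bM i) (bo_id Es)).
Qed.

(** ** The compressed row contraction *)

Context (V : 'I_n -> Dsp -> Dsp) (iV : row_isom V).
Context (VE : forall i y, V i (toD y) = toD (fshift i y)).

Let bV i : bounded_op (V i) := iV.1 i.
Let bJ : bounded_op J. Proof. exact: bo_subsp_val. Qed.

(** The adjoint of [S_i (x) I + V_i] on the ambient space. *)
Definition Wadj (i : 'I_n) (z : Amb) : Amb := (bshift i z.1, adj (V i) z.2).

Let bW i : bounded_op (Wadj i).
Proof.
by apply: bo_pair; [exact: (bo_comp (bo_fst _ _) (bo_bshift _ i))|
  exact: (bo_comp (bo_snd _ _) (bo_adj (bV i)))].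
Qed.

(** The restriction of [Wadj] to the model space; its adjoint [modelA] is the
    compression that turns out to be [f_i(T)]. *)
Definition modelC (i : 'I_n) (v : Hm) : Hm := adj J (Wadj i (J v)).
Definition modelA (i : 'I_n) : Hm -> Hm := adj (modelC i).

Let bC i : bounded_op (modelC i).
Proof. exact: (bo_comp (bo_comp bJ (bW i)) (bo_adj bJ)). Qed.

Lemma model_orth (v : Hm) y : inner (J v).1 (Theta y) + inner (J v).2 (toD y) = 0.
Proof.
have := subsp_in v; rewrite orthocE => h.
by have := h (Theta y, toD y) (ex_intro2 _ _ y I erefl).
Qed.

(** The graph is invariant under [S_i (x) I + V_i], so its orthogonal
    complement is invariant under the adjoint. *)
Lemma J_modelC i v : J (modelC i v) = Wadj i (J v).
Proof.
apply: subsp_proj; rewrite orthocE => _ [y _ <-].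
rewrite inner_hsum /= -(adj_fshift) -(adjEr _ _ (bo_fshift _ i)) -(adjEr _ _ (bV i)).
by rewrite -ThS VE model_orth.
Qed.

Lemma adj_modelA i : adj (modelA i) = modelC i.
Proof. by apply: adjK. Qed.

Lemma bo_modelA i : bounded_op (modelA i).
Proof. exact: bo_adj. Qed.

Let sqnorm_J (v : Hm) : sqnorm (J v) = sqnorm (J v).1 + sqnorm (J v).2.
Proof. exact: (@sqnorm_hsum R (H2t n E) Dsp (J v)). Qed.

Let sqnorm_incl (v : Hm) : sqnorm v = sqnorm (J v).
Proof. exact (esym (@sqnorm_subsp R Amb _ v)). Qed.

Lemma sqnorm_model (v : Hm) : sqnorm v = sqnorm (J v).1 + sqnorm (J v).2.
Proof. by rewrite sqnorm_incl sqnorm_J. Qed.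

Lemma modelA_contr : row_contr modelA.
Proof.
split=> [i|v]; first exact: bo_modelA.
rewrite [leRHS]sqnorm_model.
have h1 := (row_isom_contr (@fshift_row_isom R n E)).2 (J v).1.
have h2 := (row_isom_contr iV).2 (J v).2.
apply: le_trans (lerD h1 h2); rewrite -big_split /=; apply: ler_sum => i _.
by rewrite adj_modelA sqnorm_model J_modelC adj_fshift.
Qed.

(** The projections onto the model space of the two summands of the ambient
    space. *)
Definition inE_ (x : H2t n E) : Hm := adj J (x, 0).
Definition inD_ (w : Dsp) : Hm := adj J (0, w).

Lemma inner_inE x v : inner (inE_ x) v = inner x (J v).1.
Proof. by rewrite -(adjEr _ _ bJ) innerC inner_hsum /= inner0r addr0 -innerC. Qed.

Lemma inner_inD w v : inner (inD_ w) v = inner w (J v).2.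
Proof. by rewrite -(adjEr _ _ bJ) innerC inner_hsum /= inner0r add0r -innerC. Qed.

Lemma bo_inE : bounded_op inE_.
Proof. exact: (bo_comp (bo_pair (bo_id _) (bo_zero _ _)) (bo_adj bJ)). Qed.

Lemma bo_inD : bounded_op inD_.
Proof. exact: (bo_comp (bo_pair (bo_zero _ _) (bo_id _)) (bo_adj bJ)). Qed.

Lemma modelA_inE i x : modelA i (inE_ x) = inE_ (fshift i x).
Proof.
apply: inner_extl => v; rewrite /modelA -(adjEr _ _ (bC i)) !inner_inE J_modelC /=.
by rewrite -adj_fshift -(adjE _ _ (bo_fshift _ i)).
Qed.

Lemma modelA_inD i w : modelA i (inD_ w) = inD_ (V i w).
Proof.
apply: inner_extl => v; rewrite /modelA -(adjEr _ _ (bC i)) !inner_inD J_modelC /=.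
by rewrite -(adjE _ _ (bV i)).
Qed.

(** The intertwining maps that cover the model space: the two summands of the
    ambient space, projected and evaluated on elementary tensors. *)
Definition model_maps : set (F2 -> Hm) :=
  [set chi | (exists e, chi = fun c => inE_ (etens c e)) \/
             (exists v, chi = fun c => inD_ (toD (etens c v)))].

Lemma model_mapsP chi : model_maps chi ->
  bounded_op chi /\ forall j c, chi (Mshift j c) = modelA j (chi c).
Proof.
case=> [[e ->]|[v ->]]; split.
- exact: (bo_comp (bo_etensl _ e) bo_inE).
- by move=> j c; rewrite modelA_inE fshift_etens.
- exact: (bo_comp (bo_comp (bo_etensl _ v) bo_toD) bo_inD).
- by move=> j c; rewrite modelA_inD VE fshift_etens.
Qed.

Lemma model_maps_total : total_set [set h | exists chi c, model_maps chi /\ h = chi c].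
Proof.
move=> h hX.
have h1 : (J h).1 = 0.
  apply: total_etens => _ [c [e ->]]; have := hX (inE_ (etens c e)).
  rewrite innerC inner_inE => hh; rewrite -[LHS]conjCK -innerC.
  rewrite -[inner _ _]conjCK hh ?conjC0 ?conjC0//.
  by exists (fun c => inE_ (etens c e)), c; split=> //; left; exists e.
have h2 : (J h).2 = 0.
  apply: total_toD_etens => _ [c [v ->]]; have := hX (inD_ (toD (etens c v))).
  rewrite innerC inner_inD => hh; rewrite -[LHS]conjCK -innerC.
  rewrite -[inner _ _]conjCK hh ?conjC0 ?conjC0//.
  by exists (fun c => inD_ (toD (etens c v))), c; split=> //; right; exists v.
apply: subsp_val_inj; rewrite (bo0 bJ).
by case: (J h) h1 h2 => a b /= -> ->.
Qed.

Lemma total_split (w : Hm) : (forall x, inner w (inE_ x) = 0) ->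
  (forall y, inner w (inD_ (toD y)) = 0) -> w = 0.
Proof.
move=> h1 h2; apply: model_maps_total => _ [chi [c [[[e ->]|[v ->]] ->]]].
  exact: h1.
exact: h2.
Qed.

Section tuple.
Context (D : 'I_n -> Dsp -> Dsp) (mD : is_model_D MZ D).

Lemma D_etens i c v : D i (toD (etens c v)) = toD (etens (MZ i c) v).
Proof. by rewrite (mD i).2 (tensop_etens _ _ (bM i) (bo_id Es)). Qed.

Lemma adj_MZ_tens (K : hilbertType R) i (x : H2t n K) c e :
  inner (tensop (adj (MZ i)) (idfun : K -> K) x) (etens c e) = inner x (etens (MZ i c) e).
Proof.
have bt := bo_tensop (bM i) (bo_id K).
by rewrite -(tensop_adj K (bM i)) -(adjEr _ _ bt) (tensop_etens _ _ (bM i) (bo_id K)).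
Qed.

(** The defining formula for the adjoint says that T is what the
    intertwining maps transport from M_Z. *)
Lemma model_tupleP (T : 'I_n -> Hm -> Hm) : (forall i, bounded_op (T i)) ->
  is_model_tuple MZ D T <->
  forall i chi c, model_maps chi -> T i (chi c) = chi (MZ i c).
Proof.
move=> bTt; split=> [mT i chi c [[e ->]|[v ->]]|TX i].
- apply: inner_extl => v; rewrite (adjE _ _ (bTt i)) !inner_inE (mT i).2 /=.
  by rewrite innerC adj_MZ_tens -innerC.
- apply: inner_extl => w; rewrite (adjE _ _ (bTt i)) !inner_inD (mT i).2 /=.
  by rewrite -(adjE _ _ (mD i).1) D_etens.
split=> // v.
have h1 : (J (adj (T i) v)).1 = tensop (adj (MZ i)) idfun (J v).1.
  apply/eqP; rewrite -subr_eq0; apply/eqP/total_etens => _ [c [e ->]].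
  rewrite innerBl adj_MZ_tens (innerC (etens c e)) -inner_inE -(adjE _ _ (bTt i)).
  rewrite (TX _ (fun c => inE_ (etens c e))); last by left; exists e.
  by rewrite inner_inE -innerC subrr.
have h2 : (J (adj (T i) v)).2 = adj (D i) (J v).2.
  apply/eqP; rewrite -subr_eq0; apply/eqP/total_toD_etens => _ [c [w ->]].
  rewrite innerBl -(adjEr _ _ (mD i).1) D_etens (innerC (toD _)) -inner_inD -(adjE _ _ (bTt i)).
  rewrite (TX _ (fun c => inD_ (toD (etens c w)))); last by right; exists w.
  by rewrite inner_inD -innerC subrr.
by case: (J (adj (T i) v)) h1 h2 => a b /= -> ->.
Qed.

Lemma model_T_ex : exists T : 'I_n -> Hm -> Hm, is_model_tuple MZ D T.
Proof.
have [aM _ _] := um.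
have /choice[T TP] : forall i, exists T : Hm -> Hm, bounded_op T /\
    forall chi c, model_maps chi -> T (chi c) = chi (MZ i c).
  move=> i; have [T [bTi _ TX _]] := transfer modelA_contr model_mapsP model_maps_total (aM i)
    (opnorm_ge0 (bM i)) (fun c => opnormP c (bM i)).
  by exists T.
exists T; apply/model_tupleP; first by move=> i; case: (TP i).
by move=> i; case: (TP i).
Qed.

Context (T : 'I_n -> Hm -> Hm) (mT : is_model_tuple MZ D T).

Let bTi i : bounded_op (T i) := (mT i).1.
Let TX := (model_tupleP bTi).1 mT.

Lemma model_fval : fval f T = modelA.
Proof.
apply: fval_unique => //.
exact: (eval_transport modelA_contr model_mapsP model_maps_total bTi TX um hb).
Qed.

Lemma model_in_domain : in_domain f g T.
Proof.
have [aM gM _] := um; split=> //.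
- by exists modelA; exact: (eval_transport modelA_contr model_mapsP model_maps_total bTi TX um hb).
- rewrite model_fval; apply: opnorm_le => // h; rewrite mul1r rn_le sqnorm_l2_ord.
  exact: (row_contr_row (fun i => h i) modelA_contr).
right=> i; rewrite model_fval -gM.
have [B [bB _ BX gB]] := transfer modelA_contr model_mapsP model_maps_total (aM i)
  (opnorm_ge0 (bM i)) (fun c => opnormP c (bM i)).
suff -> : T i = B by [].
by apply: (bo_eq_total (bTi i) bB model_maps_total) => _ [chi [c [Xc ->]]]; rewrite TX// BX.
Qed.

Lemma J_wadj a v : J (wadj modelA a v) = (wadj (@fshift R n E) a (J v).1, wadj V a (J v).2).
Proof.
elim: a v => [|i a IH] v /=; first by case: (J v).
by rewrite IH adj_modelA J_modelC /= adj_fshift.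
Qed.

Lemma Phi_iter m v : inner (iter m (Phi_map f T) idfun v) v =
  (\sum_(a : m.-tuple 'I_n) sqnorm (wadj modelA a v))%:C%C.
Proof.
elim: m v => [|m IH] v /=.
  by rewrite (sum_tuple0 (fun a => sqnorm (wadj modelA a v))) sqnormE.
rewrite {1}/Phi_map model_fval inner_suml (sum_tupleS _ (fun a => sqnorm (wadj modelA a v))) rmorph_sum.
by apply: eq_bigr => i _; rewrite (adjE _ _ (bo_modelA i)) IH.
Qed.

Lemma wadj_fshift a (x : H2t n E) w : (wadj (@fshift R n E) a x : l2 _ _) w = x (a ++ w).
Proof.
by elim: a x w => //= i a IH x w; rewrite IH adj_fshift bshiftE.
Qed.

(** The words of length less than m together with the backward shifts along
    the words of length m exhaust a vector of the Fock space. *)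
Lemma fock_tail m (x : H2t n E) :
  \sum_(a : m.-tuple 'I_n) sqnorm (wadj (@fshift R n E) a x) +
  \sum_(a <- words_upto n m) sqnorm ((x : l2 _ _) a) = sqnorm x.
Proof.
elim: m => [|m IH].
  by rewrite (sum_tuple0 (fun a => sqnorm (wadj (@fshift R n E) a x))) big_nil addr0.
rewrite -[RHS]IH (sum_tuple_rcons _ (fun a => sqnorm (wadj (@fshift R n E) a x))) /=.
rewrite big_cat big_map big_enum /= addrCA addrC; congr (_ + _).
rewrite -big_split /=; apply: eq_bigr => a _.
rewrite [RHS]fock_decomp wadj_fshift cats0 addrC; congr (_ + _).
by apply: eq_bigr => i _; rewrite wadj_rcons adj_fshift.
Qed.

(** If all level sums equal the norm of v, then so do those of the Fock
    component, since V is contractive; but these tend to 0 by [fock_tail], so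
    this component vanishes. Orthogonality to the graph then kills the other
    one. *)
Lemma model_cnc : cnc f T.
Proof.
move=> v hv.
have x0 : (J v).1 = 0.
  apply: l2_ext => a; rewrite l20; set x := (J v).1.
  have := hv (size a).+1 isT; rewrite Phi_iter -innerxx sqnormE => -[].
  rewrite (eq_bigr (fun b : (size a).+1.-tuple 'I_n =>
    sqnorm (wadj (@fshift R n E) b x) + sqnorm (wadj V b (J v).2))); last first.
    by move=> b _; rewrite sqnorm_model J_wadj.
  rewrite big_split /= => e.
  have h1 := fock_tail (size a).+1 x.
  have h2 := row_contr_level (size a).+1 (J v).2 (row_isom_contr iV).
  have h3 : sqnorm v = sqnorm x + sqnorm (J v).2 := sqnorm_model v.
  have h4 : sqnorm (x a) <= \sum_(b <- words_upto n (size a).+1) sqnorm (x b).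
    rewrite (bigD1_seq a) ?words_upto_uniq ?mem_words_upto//= lerDl sumr_ge0// => b _.
    exact: sqnorm_ge0.
  apply: inner_eq0; rewrite sqnormE; congr (_%:C%C); apply/le_anti; rewrite sqnorm_ge0 andbT.
  lra.
apply: total_split => [x|y]; rewrite innerC.
  by rewrite inner_inE x0 inner0r conjC0.
by rewrite inner_inD innerC; have := model_orth v y; rewrite x0 inner0l add0r => ->; rewrite !conjC0.
Qed.

Lemma model_in_domain_cnc : in_domain_cnc f g T.
Proof. by split; [exact: model_in_domain|exact: model_cnc]. Qed.

End tuple.

End functional_model.

(** * The characteristic function of a row contraction *)

(** The Neumann series of [r N] converges because N is a contraction and [r <
    1]. *)
Lemma opinv_neumann (R : realType) (H : hilbertType R) (N : H -> H) (r : R) :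
  bounded_op N -> (forall x, rn (N x) <= rn x) -> 0 <= r < 1 ->
  let M := fun x => x - r%:C%C *: N x in
  [/\ bounded_op (opinv M), cancel M (opinv M) & cancel (opinv M) M].
Proof.
move=> bN N1 r01 M; have /andP[r0 r1] := r01.
have bM : bounded_op M by apply: bo_sub; [exact: bo_id|exact: bo_scale].
rewrite /opinv; case: xgetP => [B _ //|noB]; exfalso.
pose u (y : H) k := (r ^+ k)%:C%C *: iter k N y.
have bi k : bounded_op (iter k N).
  elim: k => [|k IH]; first exact: bo_id.
  by rewrite (_ : iter k.+1 N = N \o iter k N)//; exact: bo_comp.
have iN k y : rn (iter k N y) <= rn y.
  by elim: k => [//|k IH] /=; exact: le_trans (N1 _) IH.
have uM y k : rn (u y k) <= rn y * r ^+ k.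
  by rewrite rnZr ger0_norm ?exprn_ge0// mulrC ler_wpM2r ?exprn_ge0.
have /choice[G GP] : forall y, exists l, forall m, rn (\sum_(k < m) u y k - l) <= rn y * r ^+ m / (1 - r).
  by move=> y; apply: geom_series_lim => //; exact: rn_ge0.
have Gc y : \sum_(k < m) u y k @[m --> \oo] --> G y.
  have rc := @geom_bound_cvg R (rn y) r r01; apply/hcvg => e e0; have /cvgrPdist_lt/(_ _ e0) := rc; apply: filterS => k.
  rewrite sub0r normrN => h1; apply: le_lt_trans h1; apply: le_trans (ler_norm _); exact: GP.
have bG : bounded_op G.
  apply: (@boP _ _ _ _ ((1 - r)^-1)) => [a x y|y].
    apply: hcvg_unique (Gc _) _.
    rewrite (_ : (fun m => _) = fun m => a *: \sum_(k < m) u x k + \sum_(k < m) u y k); last first.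
      apply/funext => m; rewrite scaler_sumr -big_split /=; apply: eq_bigr => k _.
      by rewrite /u (boD _ _ (bi k)) (boZ _ _ (bi k)) scalerDr !scalerA mulrC.
    by apply: cvgD; [apply: cvgZr|]; exact: Gc.
  have := GP y 0%N; rewrite big_ord0 sub0r rnN expr0 mulr1 mulrC //.
have MG y : M (G y) = y.
  apply: hcvg_unique (bo_cvg bM (Gc y)) _.
  have e m : M (\sum_(k < m) u y k) = y - u y m.
    elim: m => [|m IH]; first by rewrite big_ord0 (bo0 bM) /u scale1r subrr.
    rewrite big_ord_recr /= (boD _ _ bM) IH /M (_ : r%:C%C *: N (u y m) = u y m.+1).
      by rewrite addrA subrK.
    by rewrite /u (boZ _ _ bN) scalerA exprS rmorphM.
  rewrite (_ : (fun m => _) = fun m => y - u y m); last by apply/funext => m; rewrite e.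
  rewrite -[X in _ --> X]subr0; apply: cvgB; first exact: cvg_cst.
  apply/hcvg => e' e0.
  have rc : (rn y * r ^+ m) @[m --> \oo] --> (0 : R).
    rewrite -[0](mulr0 (rn y)); apply: cvgMr.
    by apply: cvg_expr; rewrite ger0_norm.
  have /cvgrPdist_lt/(_ _ e0) := rc; apply: filterS => k.
  rewrite sub0r normrN subr0 => h1; apply: le_lt_trans h1; apply: le_trans (ler_norm _); exact: uM.
have M0 x : M x = 0 -> x = 0.
  rewrite /M => /eqP; rewrite subr_eq0 => /eqP xE; apply: rn_eq0; apply/le_anti; rewrite rn_ge0 andbT.
  have : rn x <= r * rn x.
    by rewrite {1}xE rnZr ger0_norm// ler_wpM2l.
  have := rn_ge0 x; nra.
apply: (noB G); split=> // x.
by apply/eqP; rewrite -subr_eq0; apply/eqP/M0; rewrite (boB _ _ bM) MG subrr.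
Qed.

Local Opaque adj opsqrt tensop opinv.

Lemma sqnorm_l2_eq (R : realType) (I : countType) (K1 K2 K3 K4 : hilbertType R)
    (p : l2 I K1) (q : l2 I K2) (s : l2 I K3) (t : l2 I K4) :
  (forall a, sqnorm (p a) + sqnorm (q a) = sqnorm (s a) + sqnorm (t a)) ->
  sqnorm p + sqnorm q = sqnorm s + sqnorm t.
Proof.
move=> h; rewrite !sqnorm_l2 -!csumD; [|exact: l2P..].
by congr csum; apply/funext => a.
Qed.

Section charfun.
Context (R : realType) (n : nat) (H : hilbertType R) (A : 'I_n -> H -> H) (cA : row_contr A).
Local Notation W := (word n).
Local Notation Hn := (l2 'I_n H).

Let bA : forall i, bounded_op (A i) := cA.1.

Lemma bo_l2coord i : bounded_op (@Defs.coord R n H i).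
Proof. exact: bo_coord. Qed.

Lemma row_op_rn (h : Hn) : rn (row_op A h) <= rn h.
Proof.
rewrite rn_le sqnorm_l2_ord.
exact: (row_contr_row (fun i => h i) cA).
Qed.

Lemma bo_row_op : bounded_op (row_op A).
Proof.
apply: bo_bigsum => i; exact: (bo_comp (bo_l2coord i) (bA i)).
Qed.

Lemma adj_row_op h i : adj (row_op A) h i = adj (A i) h.
Proof.
apply: inner_extr => z; rewrite -(adjE _ _ (bA i)).
rewrite innerC -inner_ldelta -innerC -(adjE _ _ bo_row_op); congr inner.
rewrite /row_op (sum_fin1 (j := i)) => [|j ji]; first by rewrite ldeltaE eqxx.
by rewrite ldeltaE (negbTE ji) (bo0 (bA j)).
Qed.

Let B1 (h : H) : H := \sum_i A i (adj (A i) h).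
Let B2 (h : Hn) : Hn := adj (row_op A) (row_op A h).
(** The defect operators of the row A and of its adjoint. *)
Definition defT : H -> H := opsqrt (fun h => h - B1 h).
Definition defS : Hn -> Hn := opsqrt (fun h => h - B2 h).

Let B1E h : B1 h = row_op A (adj (row_op A) h).
Proof. by apply: eq_bigr => i _; rewrite adj_row_op. Qed.

Let facts1 : [/\ bounded_op B1, forall x y, inner (B1 x) y = inner x (B1 y) & forall x, rn (B1 x) <= rn x].
Proof.
rewrite (_ : B1 = row_op A \o adj (row_op A)); last by apply/funext => h; rewrite B1E.
split=> [|x y|x] /=.
- exact: (bo_comp (bo_adj bo_row_op) bo_row_op).
- by rewrite (adjE _ _ bo_row_op) (adjEr _ _ bo_row_op).
- by rewrite (le_trans (row_op_rn _))// (adj_contr bo_row_op row_op_rn).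
Qed.

Let facts2 : [/\ bounded_op B2, forall x y, inner (B2 x) y = inner x (B2 y) & forall x, rn (B2 x) <= rn x].
Proof.
split=> [|x y|x].
- exact: (bo_comp bo_row_op (bo_adj bo_row_op)).
- by rewrite -(adjE _ _ bo_row_op) -(adjEr _ _ bo_row_op).
- by rewrite (le_trans (adj_contr bo_row_op row_op_rn _))// row_op_rn.
Qed.

Lemma defTP : [/\ bounded_op defT, forall x y, inner (defT x) y = inner x (defT y) &
  forall x, defT (defT x) = x - row_op A (adj (row_op A) x)].
Proof.
have [b s c] := facts1; have [bD D0 DD _] := opsqrtP b s c.
by split; [exact: bD|exact: pos_self|move=> x; rewrite -B1E; exact: DD].
Qed.

Lemma defSP : [/\ bounded_op defS, forall x y, inner (defS x) y = inner x (defS y) &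
  forall x, defS (defS x) = x - adj (row_op A) (row_op A x)].
Proof.
have [b s c] := facts2; have [bD D0 DD _] := opsqrtP b s c.
by split; [exact: bD|exact: pos_self|exact: DD].
Qed.

Lemma sqnorm_defT h : sqnorm (defT h) = sqnorm h - sqnorm (adj (row_op A) h).
Proof.
have [bD sD DD] := defTP.
by rewrite /sqnorm sD DD innerBr -raddfB (adjEr _ _ bo_row_op).
Qed.

Lemma sqnorm_defS h : sqnorm (defS h) = sqnorm h - sqnorm (row_op A h).
Proof.
have [bD sD DD] := defSP.
by rewrite /sqnorm sD DD innerBr -raddfB -(adjE _ _ bo_row_op).
Qed.

Lemma row_defS h : row_op A (defS h) = defT (row_op A h).
Proof.
have [b1 s1 c1] := facts1; have [b2 s2 c2] := facts2.
by apply: (opsqrt_comm b2 s2 c2 b1 s1 c1 bo_row_op) => x; rewrite B1E.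
Qed.

(** The 2 x 2 operator with entries [A^*], [defS], [defT] and [- A] is isometric, by
    [row_defS] and the definition of the defect operators. *)
Lemma colligation u y : sqnorm (adj (row_op A) u + defS y) + sqnorm (- row_op A y + defT u) =
  sqnorm u + sqnorm y.
Proof.
have [_ sT _] := defTP.
rewrite !sqnormD sqnormN sqnorm_defS sqnorm_defT -(adjEr _ _ bo_row_op) row_defS -sT.
rewrite innerNl raddfN /= (innerC (defT u)).
by rewrite [complex.Re (_ ^*)](_ : _ = complex.Re (inner (defT u) (row_op A y))); [lra|case: inner].
Qed.

(** ** The transfer function *)

(** The row [Lambda_1, ..., Lambda_n], and the operator [sum_i Lambda_i (x)
    A_i^*] of the characteristic function. *)
Definition rshift (v : H2t n Hn) : H2t n H := \sum_i tensop (Lambda i) (@Defs.coord R n H i) v.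
Definition rstep (x : H2t n H) : H2t n H := \sum_i tensop (Lambda i) (adj (A i)) x.

Lemma rpre_rcons (a : W) i j : rpre i (rcons a j) = if j == i then Some a else None.
Proof. by case: a => [|k a] //=; rewrite last_rcons belast_rcons. Qed.

Lemma rshift_nil v : (rshift v : l2 _ _) [::] = 0.
Proof.
rewrite /rshift l2_sum big1// => i _; rewrite LambdaE tensop_reidx//; first exact: pinj_rpre.
exact: bo_l2coord.
Qed.

Lemma rshift_rcons v a i : (rshift v : l2 _ _) (rcons a i) = (v : l2 _ _) a i.
Proof.
rewrite /rshift l2_sum (sum_fin1 (j := i)) => [|j ji].
  by rewrite LambdaE tensop_reidx ?rpre_rcons ?eqxx//; [exact: pinj_rpre|exact: bo_l2coord].
rewrite LambdaE tensop_reidx ?rpre_rcons 1?eq_sym ?(negbTE ji)//; first exact: pinj_rpre.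
exact: bo_l2coord.
Qed.

Lemma rstep_rshift x : rstep x = rshift (lmap (adj (row_op A)) x).
Proof.
have ba i := bo_adj (bA i).
apply: l2_ext => w; case/lastP: w => [|a i].
  by rewrite rshift_nil /rstep l2_sum big1// => i _; rewrite LambdaE tensop_reidx//; exact: pinj_rpre.
rewrite rshift_rcons lmapE; last exact: bo_adj bo_row_op.
rewrite adj_row_op /rstep l2_sum (sum_fin1 (j := i)) => [|j ji].
  by rewrite LambdaE tensop_reidx ?rpre_rcons ?eqxx//; exact: pinj_rpre.
by rewrite LambdaE tensop_reidx ?rpre_rcons 1?eq_sym ?(negbTE ji)//; exact: pinj_rpre.
Qed.

Lemma bo_rshift : bounded_op rshift.
Proof.
by apply: bo_bigsum => i; apply: bo_tensop; [exact: bo_Lambda|exact: bo_l2coord].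
Qed.

Lemma rshift_rn v : rn (rshift v) <= rn v.
Proof.
rewrite rn_le; apply: sqnorm_l2_le => s us.
pose m := (\max_(a <- s) size a)%N.
apply: (@le_trans _ _ (\sum_(a <- words_upto n m.+1) sqnorm ((rshift v : l2 _ _) a))).
  apply: ler_sum_sub => // [a|a sa]; first exact: sqnorm_ge0.
  by rewrite mem_words_upto ltnS /m; exact: leq_bigmax_seq.
rewrite (sum_words_upto_rcons (fun a => sqnorm ((rshift v : l2 _ _) a))) rshift_nil sqnorm0 add0r.
apply: le_trans (sqnorm_l2_fin v (words_upto_uniq n m)).
by apply: ler_sum => a _; rewrite sqnorm_l2_ord; under eq_bigr do rewrite rshift_rcons.
Qed.

Lemma bo_rstep : bounded_op rstep.
Proof.
rewrite (_ : rstep = rshift \o lmap (adj (row_op A))); last by apply/funext => x; rewrite rstep_rshift.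
by apply: bo_comp; [exact/bo_lmap/bo_adj/bo_row_op|exact: bo_rshift].
Qed.

Lemma rstep_rn x : rn (rstep x) <= rn x.
Proof.
rewrite rstep_rshift (le_trans (rshift_rn _))// -[leRHS]mul1r.
apply: lmap_rn => //; first exact/bo_adj/bo_row_op.
by move=> h; rewrite mul1r (adj_contr bo_row_op row_op_rn).
Qed.

(** The operator at radius r of the characteristic function of A;
    [capprox_cvg] identifies its limit. *)
Definition capprox (r : R) (y : H2t n Hn) : H2t n H :=
  - tensop idfun (row_op A) y +
  tensop idfun defT (opinv (fun x => x - r%:C%C *: rstep x) (r%:C%C *: rshift (tensop idfun defS y))).

Section fixed_radius.
Context (r : R) (r01 : 0 <= r < 1).

(** Only the fixed-point equation of the state is used below, which is why the
    state is abstracted from the inverse that defines it. *)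
Lemma cstate_ex : exists c : H2t n Hn -> H2t n H, [/\ bounded_op c,
  forall y, c y = r%:C%C *: rshift (lmap (adj (row_op A)) (c y) + lmap defS y) &
  forall y, capprox r y = - tensop idfun (row_op A) y + tensop idfun defT (c y)].
Proof.
have [bO _ KO] := opinv_neumann bo_rstep rstep_rn r01; have [bS _ _] := defSP.
exists (fun y => opinv (fun x => x - r%:C%C *: rstep x) (r%:C%C *: rshift (tensop idfun defS y))).
split=> // [|y].
  apply: (bo_comp _ bO); apply: bo_scale; apply: (bo_comp _ bo_rshift).
  exact: (bo_tensop (bo_id _) bS).
have := KO (r%:C%C *: rshift (tensop idfun defS y)).
move: (opinv _ _) => c e; rewrite (tensop_idl _ bS) rstep_rshift in e.
rewrite (boD _ _ bo_rshift) scalerDr.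
by apply/eqP; rewrite addrC -subr_eq; apply/eqP; exact: e.
Qed.

Context (cstate : H2t n Hn -> H2t n H) (bo_cstate : bounded_op cstate)
  (cstateE : forall y, cstate y =
     r%:C%C *: rshift (lmap (adj (row_op A)) (cstate y) + lmap defS y))
  (capprox_cstate : forall y, capprox r y =
     - tensop idfun (row_op A) y + tensop idfun defT (cstate y)).

Lemma cstate_nil y : (cstate y : l2 _ _) [::] = 0.
Proof. by rewrite cstateE l2Z rshift_nil scaler0. Qed.

Lemma cstate_rcons y a i : (cstate y : l2 _ _) (rcons a i) =
  r%:C%C *: (adj (A i) ((cstate y : l2 _ _) a) + defS ((y : l2 _ _) a) i).
Proof.
have [bS _ _] := defSP.
rewrite [in LHS]cstateE l2Z rshift_rcons; congr (_ *: _).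
transitivity ((lmap (adj (row_op A)) (cstate y) : l2 _ _) a i + (lmap defS y : l2 _ _) a i) => //.
have e1 := lmapE (cstate y) a (bo_adj bo_row_op); have e2 := lmapE y a bS.
congr (_ + _); last exact: (congr1 (fun h : Hn => h i) e2).
exact: (etrans (congr1 (fun h : Hn => h i) e1) (adj_row_op _ i)).
Qed.

Lemma capproxE y w : (capprox r y : l2 _ _) w =
  - row_op A ((y : l2 _ _) w) + defT ((cstate y : l2 _ _) w).
Proof.
have [bT _ _] := defTP.
by rewrite capprox_cstate l2D l2N !tensop_idlE//; exact: bo_row_op.
Qed.

Lemma bo_capprox : bounded_op (capprox r).
Proof.
have [bT _ _] := defTP.
rewrite (_ : capprox r = fun y => - tensop idfun (row_op A) y + tensop idfun defT (cstate y)).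
  apply: bo_add; last exact: (bo_comp bo_cstate (bo_tensop (bo_id _) bT)).
  exact: (bo_opp (bo_tensop (bo_id _) bo_row_op)).
exact/funext/capprox_cstate.
Qed.

(** Balance of energy: the colligation preserves the norm at every word, and
    passing the state on to longer words does not increase it. *)
Lemma capprox_rn y : rn (capprox r y) <= rn y.
Proof.
have [bS _ _] := defSP; have bR := bo_adj bo_row_op; have /andP[r0 r1] := r01.
set q := lmap (adj (row_op A)) (cstate y) + lmap defS y.
have e : sqnorm q + sqnorm (capprox r y) = sqnorm (cstate y) + sqnorm y.
  apply: (@sqnorm_l2_eq R (word n)) => a; rewrite capproxE.
  have -> : (q : l2 _ _) a = adj (row_op A) ((cstate y : l2 _ _) a) + defS ((y : l2 _ _) a).
    have e1 := lmapE (cstate y) a bR; have e2 := lmapE y a bS.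
    by rewrite -[RHS](congr2 +%R e1 e2).
  exact: colligation.
have : sqnorm (cstate y) <= sqnorm q.
  rewrite -rn_le cstateE -/q rnZr ger0_norm// -[leRHS]mul1r ler_pM ?rn_ge0 ?rshift_rn//.
  exact: ltW.
rewrite rn_le => h; move: e h.
by move: (sqnorm q) (sqnorm (cstate y)) (sqnorm (capprox r y)) (sqnorm y) => a b c' d; lra.
Qed.

(** An input x at the word [al] creates, at each word [al j be], the state
    [A_be^* (defS x)_j] weighted by a power of r. *)
Lemma cstate_ldelta (al : W) x w : (cstate (ldelta al x) : l2 _ _) w =
  if prefix al w then
    if drop (size al) w is j :: be then (r ^+ (size be).+1)%:C%C *: wadj A be (defS x j) else 0
  else 0.
Proof.
have [bS _ _] := defSP.
elim/last_ind: w => [|a i IH].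
  by rewrite cstate_nil; case: ifP => // /prefixP[s]; case: al.
rewrite cstate_rcons IH ldeltaE.
case: (boolP (prefix al a)) => [/prefixP[ga ->]|npre].
  rewrite rcons_cat prefix_prefix !drop_size_cat//.
  case: ga {IH} => [|j be] /=.
    by rewrite cats0 eqxx (bo0 (bo_adj (bA i))) add0r.
  have -> : al ++ j :: be == al = false.
    by apply/eqP => /(congr1 size) /eqP; rewrite size_cat /= -[X in _ == X]addn0 eqn_add2l.
  rewrite (bo0 bS) l20 addr0 (boZ _ _ (bo_adj (bA i))) scalerA size_rcons -rmorphM -exprS.
  by rewrite wadj_rcons.
have -> : a == al = false.
  by apply: contraNF npre => /eqP ->; exact: prefix_refl.
rewrite (bo0 (bo_adj (bA i))) (bo0 bS) l20 addr0 scaler0.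
case: ifP => // /prefixP[s e]; case/lastP: s e => [|s j].
  by rewrite cats0 => <-; rewrite drop_size.
rewrite -rcons_cat => /rcons_inj[aE _]; case/negP: npre; rewrite aE; exact: prefix_prefix.
Qed.

End fixed_radius.

(** On a vector supported at one word the coordinates of [capprox] are those
    of L weighted by powers of r, so they converge as Abel means; [capprox_rn]
    bounds the whole family. *)
Lemma capprox_cvg (D : hilbertType R) (J : D -> Hn) (X : set D) (L : H2t n D -> H2t n H) :
  bounded_op J -> (forall x, rn (J x) <= rn x) -> total_set X ->
  bounded_op L -> (forall j y, L (fshift j y) = fshift j (L y)) ->
  (forall x, X x -> (L (ldelta ([::] : W) x) : l2 _ _) [::] = - row_op A (J x)) ->
  (forall x j be, X x ->
     (L (ldelta ([::] : W) x) : l2 _ _) (j :: be) = defT (wadj A be (defS (J x) j))) ->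
  forall y, capprox r (tensop idfun J y) @[r --> (1:R)^'-] --> L y.
Proof.
move=> bJ J1 tX bL LS L0 L1 y; have [bT _ _] := defTP; have bi := bo_id (H2f R n).
pose G r := if 0 <= r < 1 then capprox r \o tensop idfun J else fun=> 0.
have bG r : bounded_op (G r).
  rewrite /G; case: ifP => [r01|_]; last exact: bo_zero.
  have [c [bc _ cC]] := cstate_ex r01.
  exact: (bo_comp (bo_tensop bi bJ) (bo_capprox bc cC)).
have tXl : total_set [set z : H2t n D | exists al x, X x /\ z = ldelta (al : W) x].
  move=> z hz; apply: l2_ext => al; apply: tX => x Xx.
  by rewrite -inner_ldelta hz//; exists al, x.
have Lal (al w : W) x : (L (ldelta al x) : l2 _ _) w =
    if prefix al w then (L (ldelta ([::] : W) x) : l2 _ _) (drop (size al) w) else 0.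
  elim: al w => [|i al IH] w; first by rewrite drop0 prefix0s.
  have -> : ldelta (i :: al) x = fshift i (ldelta al x) :> H2t n D.
    by rewrite fshift_reidx (reidx_ldelta (j := i :: al))//; [exact: pinj_lpre|exact/lpreP].
  rewrite LS fshiftE; case: w => [//|j w] /=; rewrite eq_sym.
  by case: eqP => //= _; exact: IH.
have h z : G r z @[r --> (1:R)^'-] --> L z.
  apply: (@SOT_total R _ (1:R)^'- _ _ _ G L 1 _ bG _ bL tXl).
    apply: nearW => r x; rewrite mul1r /G; case: ifP => [r01|_]; last by rewrite rn0 rn_ge0.
    have [c [bc cE cC]] := cstate_ex r01.
    apply: le_trans (capprox_rn r01 cE cC _) _; rewrite (tensop_idl _ bJ) -[leRHS]mul1r.
    by apply: lmap_rn => // v; rewrite mul1r.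
  move=> _ [al [x [Xx ->]]].
  have dc := @diag_cvg R (word n) H (fun w : W => (size w - size al)%N) (L (ldelta al x)).
  apply: (@hcvg_near R _ (1:R)^'- _ (H2t n H) _ _ _ dc).
  near=> r; have r01 : 0 <= r < 1 by near: r; exact: near_left01.
  have r01' : 0 <= r <= 1 by case/andP: r01 => -> /ltW ->.
  have [c [bc cE cC]] := cstate_ex r01.
  rewrite /G r01 /=; apply: l2_ext => w; rewrite diagE// (capproxE cC).
  have -> : tensop idfun J (ldelta al x) = ldelta al (J x).
    by apply: l2_ext => v; rewrite tensop_idlE// !ldeltaE; case: eqP => // _; rewrite (bo0 bJ).
  rewrite (cstate_ldelta cE) Lal ldeltaE; case: (boolP (prefix al w)) => [/prefixP[ga ->]|npre].
    rewrite drop_size_cat// size_cat addKn; case: ga => [|j be] /=.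
      by rewrite cats0 eqxx (bo0 bT) addr0 L0// scale1r.
    have -> : al ++ j :: be == al = false.
      by apply/eqP => /(congr1 size) /eqP; rewrite size_cat /= -[X in _ == X]addn0 eqn_add2l.
    by rewrite (bo0 bo_row_op) oppr0 add0r (boZ _ _ bT) L1.
  have -> : w == al = false by apply: contraNF npre => /eqP ->; exact: prefix_refl.
  by rewrite (bo0 bT) (bo0 bo_row_op) oppr0 addr0 scaler0.
apply: (hcvg_near (h y)); near=> r; have r01 : 0 <= r < 1 by near: r; exact: near_left01.
by rewrite /G r01.
Unshelve. all: by end_near. Qed.

End charfun.

(** * Characteristic functions from isometric factorizations *)

(** Equal quadratic forms polarize to equal inner products, so [Q h |-> B h]
    is a well-defined isometry; its range is total. *)
Lemma clrange_unitary (R : realType) (H K L : hilbertType R) (Q : H -> K) (B : H -> L) :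
  bounded_op Q -> bounded_op B -> (forall h, sqnorm (B h) = sqnorm (Q h)) ->
  total_set (range B) ->
  exists U : subsp (clrange Q) -> L, [/\ bounded_op U, forall h, U (to_clrange Q h) = B h,
    [/\ cancel U (adj U), cancel (adj U) U & forall x, rn (U x) = rn x] &
    unitary_op U /\ unitary_op (adj U)].
Proof.
move=> bQ bB BQ tB.
have [|U [bU UE Uc]] := clrange_ext (B := B) bQ bB.1 (ler01 : 0 <= 1 :> R).
  by move=> x; rewrite mul1r rn_le BQ.
have bT : bounded_op (to_clrange Q).
  have [M M0 QM] := bo_ex bQ; apply: (@boP _ _ _ _ M) => [a x y|x]; last exact: QM.
  by apply: subsp_val_inj; rewrite /= (boD _ _ bQ) (boZ _ _ bQ).
have g h k : inner (B h) (B k) = inner (to_clrange Q h) (to_clrange Q k).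
  pose G x := adj B (B x) - adj (to_clrange Q) (to_clrange Q x).
  have bG : bounded_op G.
    by apply: bo_sub; [exact: (bo_comp bB (bo_adj bB))|exact: (bo_comp bT (bo_adj bT))].
  have G0 : forall x, G x = 0.
    apply: (polarize0 bG) => x; rewrite innerBl -(adjEr _ _ bB) -(adjEr _ _ bT) !sqnormE BQ.
    by rewrite -(sqnorm_subsp (to_clrange Q x)) subrr.
  rewrite (adjEr _ _ bB) (adjEr _ _ bT); congr inner; apply/eqP; rewrite -subr_eq0; apply/eqP.
  exact: G0.
have UU : cancel U (adj U).
  move=> w; suff e : adj U \o U = idfun by exact: (congr1 (fun F => F w) e).
  apply: (bo_eq_total (bo_comp bU (bo_adj bU)) (bo_id _) (@total_clrange _ _ _ Q)) => _ [h _ <-] /=.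
  apply/eqP; rewrite -subr_eq0; apply/eqP/total_clrange => _ [k _ <-].
  by rewrite innerBl -(adjEr _ _ bU) !UE g subrr.
have Urn x : rn (U x) = rn x.
  apply/le_anti; rewrite -{3}(UU x) (adj_contr bU) ?andbT.
    by have := Uc x; rewrite mul1r.
  by move=> y; have := Uc y; rewrite mul1r.
have tU : total_set (range U).
  move=> y hy; apply: tB => _ [h _ <-]; rewrite -UE; apply: hy.
  by exists (to_clrange Q h).
have [c1 c2 u1 u2] := isometry_total bU Urn tU.
by exists U.
Qed.

Lemma tensop_idl_comm (R : realType) (n : nat) (K L : hilbertType R) (M : H2f R n -> H2f R n)
    (B : K -> L) (x : H2t n K) : bounded_op M -> bounded_op B ->
  tensop idfun B (tensop M idfun x) = tensop M idfun (tensop idfun B x).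
Proof.
move=> bM bB; have bi := bo_id (H2f R n).
by rewrite (tensop_comp bM bi (bo_id K) bB) (tensop_comp bi bM bB (bo_id L)).
Qed.

Lemma tensop_ldelta (R : realType) (n : nat) (K L : hilbertType R) (B : K -> L) (a : word n) v :
  bounded_op B -> tensop idfun B (ldelta a v : H2t n K) = ldelta a (B v).
Proof.
move=> bB; apply: l2_ext => w; rewrite (tensop_idlE _ _ bB) !ldeltaE.
by case: eqP => // _; rewrite (bo0 bB).
Qed.

Lemma tensop_cancel (R : realType) (n : nat) (K L : hilbertType R) (U : K -> L) (U' : L -> K) :
  bounded_op U -> bounded_op U' -> cancel U U' ->
  cancel (tensop idfun U : H2t n K -> H2t n L) (tensop idfun U').
Proof.
move=> bU bU' UK x; apply: l2_ext => w.
by rewrite (tensop_idlE _ _ bU') (tensop_idlE _ _ bU) UK.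
Qed.

(** A contractive multi-analytic operator is the characteristic function of the
    row contraction A up to unitaries as soon as its values on constants are
    those of the transfer function of A, in coordinates s0 and e0 that factor
    the squares of the two defect operators. *)
Section char_fun_factorization.
Context (R : realType) (n : nat) (MZ : 'I_n -> H2f R n -> H2f R n).
Context (bM : forall i, bounded_op (MZ i)).
Context (E Es H : hilbertType R) (Theta : H2t n Es -> H2t n E).
Context (ma : multi_analytic MZ Theta) (ct : opnorm Theta <= 1).
Context (ThS : forall j y, Theta (fshift j y) = fshift j (Theta y)).
Context (A : 'I_n -> H -> H) (cA : row_contr A).
Context (e0 : H -> E) (s0 : l2 'I_n H -> Es).
Context (be0 : bounded_op e0) (bs0 : bounded_op s0).
Context (e0T : forall h, sqnorm (e0 h) = sqnorm (defT A h)).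
Context (s0S : forall x, sqnorm (s0 x) = sqnorm (defS A x)).
Context (te0 : total_set (range e0)) (ts0 : total_set (range s0)).
Context (Th_nil : forall x, (Theta (ldelta ([::] : word n) (s0 x)) : l2 _ _) [::] = - e0 (row_op A x)).
Context (Th_cons : forall x j (a : word n),
  (Theta (ldelta ([::] : word n) (s0 x)) : l2 _ _) (j :: a) = e0 (wadj A a (defS A (defS A x) j))).

(** The two factorizations define unitaries from the defect spaces onto E and
    Es, and conjugating Theta by them gives the operator with the symbol of A;
    [capprox_cvg] recognises it as the limit of the transfer functions. *)
Theorem char_fun_factorization :
  exists2 ThT : H2t n (subsp (clrange (defS A))) -> H2t n (subsp (clrange (defT A))),
    [/\ multi_analytic MZ ThT, opnorm ThT <= 1 &
      forall y, capprox A r (tensop idfun (@subsp_val _ _ _) y) @[r --> 1^'-]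
        --> (tensop idfun (@subsp_val _ _ _) (ThT y) : H2t n H)] &
    coincide Theta ThT.
Proof.
have [bDT _ _] := defTP cA; have [bDS _ _] := defSP cA.
have [U2 [bU2 U2E [U2K U2K' U2rn] [uU2 uU2']]] := clrange_unitary bDT be0 e0T te0.
have [U1 [bU1 U1E [U1K U1K' U1rn] [uU1 uU1']]] := clrange_unitary bDS bs0 s0S ts0.
have bA1 := bo_adj bU1; have bA2 := bo_adj bU2; have bTh := ma.1.
have bi := bo_id (H2f R n).
have b1 := bo_tensop bi bU1; have b2 := bo_tensop bi bA2.
pose ThT x := tensop idfun (adj U2) (Theta (tensop idfun U1 x)).
have bThT : bounded_op ThT by exact: (bo_comp (bo_comp b1 bTh) b2).
have A2c x : rn (adj U2 x) <= rn x by apply: (adj_contr bU2) => y; rewrite U2rn.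
exists ThT; last first.
  exists (adj U1), (adj U2); split=> //; apply/funext => x.
  by rewrite /ThT /=; congr tensop; congr Theta; exact: (tensop_cancel bA1 bU1 U1K').
split.
- split=> // i; apply/funext => x; rewrite /ThT /=.
  rewrite (tensop_idl_comm _ (bM i) bU1).
  have := congr1 (fun F => F (tensop idfun U1 x)) (ma.2 i); rewrite /= => ->.
  by rewrite (tensop_idl_comm _ (bM i) bA2).
- apply: opnorm_le => // x; rewrite /ThT mul1r (tensop_idl _ bA2).
  apply: (@le_trans _ _ (1 * rn (Theta (tensop idfun U1 x)))).
    by apply: lmap_rn => // v; rewrite mul1r.
  rewrite mul1r (le_trans (bo_contr _ bTh ct))// (tensop_idl _ bU1) -[leRHS]mul1r.
  by apply: lmap_rn => // v; rewrite mul1r U1rn.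
have bv (Q : csubspace H) : bounded_op (@subsp_val R H Q) := bo_subsp_val Q.
move=> y; apply: (capprox_cvg cA (X := range (to_clrange (defS A)))
  (L := fun x => tensop idfun (@subsp_val _ _ _) (ThT x))).
- exact: bo_subsp_val.
- by move=> x; rewrite rn_le.
- exact: total_clrange.
- exact: (bo_comp bThT (bo_tensop bi (bo_subsp_val _))).
- move=> j x; rewrite /ThT /fshift (tensop_idl_comm _ (bo_Mshift R j) bU1) -/(fshift j _) ThS.
  by rewrite /fshift (tensop_idl_comm _ (bo_Mshift R j) bA2) (tensop_idl_comm _ (bo_Mshift R j) (bo_subsp_val _)).
- move=> _ [x _ <-]; rewrite /ThT (tensop_ldelta _ _ bU1) U1E.
  rewrite (tensop_idlE _ _ (bo_subsp_val _)) (tensop_idlE _ _ bA2) Th_nil (boN _ bA2) -U2E U2K.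
  by rewrite /= row_defS.
- move=> _ j be [x _ <-]; rewrite /ThT (tensop_ldelta _ _ bU1) U1E.
  by rewrite (tensop_idlE _ _ (bo_subsp_val _)) (tensop_idlE _ _ bA2) Th_cons -U2E U2K.
Qed.

End char_fun_factorization.

(** The coordinate at a nonempty word is read off from a backward shift. *)
Lemma constant_ldelta (R : realType) (n : nat) (K : hilbertType R) (x : H2t n K) :
  (forall j, bshift j x = 0) -> x = ldelta ([::] : word n) ((x : l2 _ _) [::]).
Proof.
move=> h; apply: l2_ext => -[|j a]; rewrite ldeltaE//.
by rewrite -bshiftE h l20.
Qed.

(** Here W is an isometric dilation of A on a space K which splits orthogonally
    as J H + Psi (F Es), while P maps K onto the Fock space F E; the operator
    P Psi is then a characteristic function of A. The last axiom says that W
    restricts to a Cuntz row unitary on the kernel of P. *)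
Section dilation.
Context (R : realType) (n : nat) (E Es H K : hilbertType R).
Local Notation F := (H2t n).
Context (A : 'I_n -> H -> H) (cA : row_contr A).
Context (J : H -> K) (bJ : bounded_op J) (iJ : forall h, sqnorm (J h) = sqnorm h).
Context (Psi : F Es -> K) (bPsi : bounded_op Psi) (iPsi : forall y, sqnorm (Psi y) = sqnorm y).
Context (W : 'I_n -> K -> K) (iW : row_isom W).
Context (P : K -> F E) (bP : bounded_op P).
Context (JPsi : forall h y, inner (J h) (Psi y) = 0).
Context (split_K : forall z, (forall h, inner z (J h) = 0) -> z = Psi (adj Psi z)).
Context (PsiS : forall i y, Psi (fshift i y) = W i (Psi y)).
Context (JA : forall i h, J (adj (A i) h) = adj (W i) (J h)).
Context (PW : forall i z, P (W i z) = fshift i (P z)).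
Context (PWadj : forall i z, P (adj (W i) z) = bshift i (P z)).
Context (PK : forall x, P (adj P x) = x).
Context (cuntz : forall z, sqnorm z = sqnorm ((P z : l2 _ _) [::]) + \sum_i sqnorm (adj (W i) z)).
Context (pc : purely_contractive (fun y => P (Psi y))).

Let bW i : bounded_op (W i) := iW.1 i.
Let aPsi := bo_adj bPsi.
Let bA i : bounded_op (A i) := cA.1 i.

Let PsiK y : adj Psi (Psi y) = y.
Proof. by apply: isometry_adjK => // x; rewrite /rn iPsi. Qed.

Let bshift_adjPsi j z : bshift j (adj Psi z) = adj Psi (adj (W j) z).
Proof.
apply: inner_extr => y; rewrite -adj_fshift -(adjE _ _ (bo_fshift _ j)) -(adjE _ _ bPsi).
by rewrite -(adjE _ _ bPsi) PsiS (adjE _ _ (bW j)).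
Qed.

Let adjPsiJ h : adj Psi (J h) = 0.
Proof. by apply: inner_extl => y; rewrite -(adjEr _ _ bPsi) JPsi inner0l. Qed.

Let inner_J h k : inner (J h) (J k) = inner h k.
Proof.
rewrite (adjE _ _ bJ) (isometry_adjK bJ)// => x; by rewrite /rn iJ.
Qed.

Let lift (x : l2 'I_n H) : K := \sum_i W i (J (x i)).

Let bo_lift : bounded_op lift.
Proof.
apply: bo_bigsum => i; exact: (bo_comp (bo_comp (bo_coord _ i) bJ) (bW i)).
Qed.

Let Wadj_lift j x : adj (W j) (lift x) = J (x j).
Proof.
rewrite /lift (bo_sum _ _ _ (bo_adj (bW j))) (sum_fin1 (j := j)) => [|i ij].
  by rewrite iW.2 eqxx.
by rewrite iW.2 eq_sym (negbTE ij).
Qed.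

Let e0 (h : H) : E := (P (J h) : l2 _ _) [::].
Let s0 (x : l2 'I_n H) : Es := (adj Psi (lift x) : l2 _ _) [::].

Let bo_e0 : bounded_op e0.
Proof. exact: (bo_comp (bo_comp bJ bP) (bo_coord _ [::])). Qed.

Let bo_s0 : bounded_op s0.
Proof. exact: (bo_comp (bo_comp bo_lift aPsi) (bo_coord _ [::])). Qed.

Let adjPsi_lift x : adj Psi (lift x) = ldelta ([::] : word n) (s0 x).
Proof. by apply: constant_ldelta => j; rewrite bshift_adjPsi Wadj_lift adjPsiJ. Qed.

(** The component of the lifted vector in the range of Psi is constant, and the
    other one is the row A applied to x; comparing norms and coordinates gives the
    hypotheses of [char_fun_factorization]. *)
Let lift_split x : lift x = Psi (ldelta ([::] : word n) (s0 x)) + J (row_op A x).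
Proof.
apply/eqP; rewrite -subr_eq; apply/eqP; rewrite [LHS]split_K => [|h].
  by rewrite (boB _ _ aPsi) adjPsiJ subr0 adjPsi_lift.
rewrite innerBl /lift /row_op (bo_sum _ _ _ bJ) !inner_suml -sumrB big1// => i _.
by rewrite (adjE _ _ (bW i)) -JA !inner_J (adjE _ _ (bA i)) subrr.
Qed.

Let s0S x : sqnorm (s0 x) = sqnorm (defS A x).
Proof.
rewrite (sqnorm_defS cA).
have e := row_isom_sum (fun i => J (x i)) iW; rewrite -[\sum_i W i _]/(lift x) in e.
have : sqnorm (lift x) = sqnorm (s0 x) + sqnorm (row_op A x).
  rewrite lift_split sqnormD iPsi iJ innerC JPsi conjC0 mulr0 addr0.
  by rewrite -!rn_sqr rn_ldelta.
by rewrite e sqnorm_l2_ord (eq_bigr _ (fun i _ => iJ (x i))) => ->; rewrite addrK.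
Qed.

Let e0T h : sqnorm (e0 h) = sqnorm (defT A h).
Proof.
rewrite (sqnorm_defT cA) -iJ cuntz sqnorm_l2_ord -[X in X = _]addr0 -addrA; congr (_ + _).
apply/esym/eqP; rewrite subr_eq0; apply/eqP/eq_bigr => i _.
by rewrite (adj_row_op cA) -JA iJ.
Qed.

Let sqnorm_adjP x : sqnorm (adj P x) = sqnorm x.
Proof. by rewrite /sqnorm -(adjE _ _ bP) PK. Qed.

Let Wadj_adjP j x : adj (W j) (adj P x) = adj P (bshift j x).
Proof.
apply: inner_extr => z; rewrite -(adjE _ _ (bW j)) -(adjE _ _ bP) PW -(adjE _ _ bP).
by rewrite (adjE _ _ (bo_fshift _ j)) adj_fshift.
Qed.

Let pure_ldelta k : rn ((P (Psi (ldelta ([::] : word n) k)) : l2 _ _) [::]) = rn k -> k = 0.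
Proof.
move=> e; apply/eqP/negPn/negP => /pc.
by rewrite /fbasis -ldelta_etens !normE e ltxx.
Qed.

(** A vector e orthogonal to the range of e0 would be the value of Theta at a
    constant of the same norm. *)
Let te0 : total_set (range e0).
Proof.
move=> x hx; pose z := adj P (ldelta ([::] : word n) x).
have zE : z = Psi (adj Psi z).
  apply: split_K => h; rewrite /z innerC (adjEr _ _ (bo_adj bP)) adjK// -innerC.
  by rewrite innerC inner_ldelta -innerC hx//; exists h.
have yE : adj Psi z = ldelta ([::] : word n) ((adj Psi z : l2 _ _) [::]).
  apply: constant_ldelta => j; rewrite bshift_adjPsi /z Wadj_adjP.
  rewrite (_ : bshift j _ = 0) ?(bo0 (bo_adj bP)) ?(bo0 aPsi)//.
  by apply: l2_ext => a; rewrite bshiftE ldeltaE l20.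
move: zE; rewrite yE; set k := (adj Psi z : l2 _ _) [::] => zE.
have Pz : P (Psi (ldelta ([::] : word n) k)) = ldelta ([::] : word n) x.
  by rewrite -zE /z PK.
have nk : rn k = rn x.
  have := iPsi (ldelta ([::] : word n) k); rewrite -zE /z sqnorm_adjP !sqnorm_ldelta => e.
  by rewrite /rn e.
have k0 : k = 0 by apply: pure_ldelta; rewrite Pz ldeltaE eqxx nk.
by apply: rn_eq0; rewrite -nk k0 rn0.
Qed.

(** For k orthogonal to the range of s0, all backward shifts annihilate the image
    of the constant k, so by the Cuntz condition Theta preserves its norm. *)
Let ts0 : total_set (range s0).
Proof.
move=> k hk; pose z := Psi (ldelta ([::] : word n) k).
have Wz j : adj (W j) z = 0.
  rewrite [LHS]split_K => [|h].
    rewrite -bshift_adjPsi /z PsiK (_ : bshift j _ = 0) ?(bo0 bPsi)//.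
    by apply: l2_ext => a; rewrite bshiftE ldeltaE l20.
  have -> : inner (adj (W j) z) (J h) = inner z (lift (ldelta j h)).
    rewrite -(adjEr _ _ (bW j)); congr inner.
    rewrite /lift (sum_fin1 (j := j)) => [|i ij]; first by rewrite ldeltaE eqxx.
    by rewrite ldeltaE (negbTE ij) (bo0 bJ) (bo0 (bW i)).
  rewrite /z (adjE _ _ bPsi) adjPsi_lift inner_ldelta ldeltaE eqxx; apply: hk.
  by exists (ldelta j h).
apply: pure_ldelta; have := cuntz z; rewrite big1 ?addr0 => [|j _]; last by rewrite Wz sqnorm0.
by rewrite {1}/z iPsi sqnorm_ldelta /rn => ->.
Qed.

Let Psi_s0 x : Psi (ldelta ([::] : word n) (s0 x)) = lift x - J (row_op A x).
Proof. by rewrite lift_split addrK. Qed.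

Let Th_nil x : (P (Psi (ldelta ([::] : word n) (s0 x))) : l2 _ _) [::] = - e0 (row_op A x).
Proof.
rewrite Psi_s0 (boB _ _ bP) l2D l2N -[RHS]add0r; congr (_ + _).
rewrite /lift (bo_sum _ _ _ bP) l2_sum big1// => i _.
by rewrite PW fshiftE.
Qed.

Let P_wadj a h w : (P (J (wadj A a h)) : l2 _ _) w = (P (J h) : l2 _ _) (a ++ w).
Proof. by elim: a h w => //= i a IH h w; rewrite IH JA PWadj bshiftE. Qed.

Let Th_cons x j (a : word n) : (P (Psi (ldelta ([::] : word n) (s0 x))) : l2 _ _) (j :: a) =
  e0 (wadj A a (defS A (defS A x) j)).
Proof.
have [_ _ SS] := defSP cA.
rewrite -bshiftE -PWadj /e0 P_wadj cats0; suff -> : adj (W j) (Psi (ldelta ([::] : word n) (s0 x))) = J (defS A (defS A x) j) by [].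
rewrite Psi_s0 (boB _ _ (bo_adj (bW j))) Wadj_lift -JA -(boB _ _ bJ); congr J.
by rewrite SS l2D l2N (adj_row_op cA).
Qed.

(** The value of [P Psi] at a constant s0 x is computed from the splitting of
    the lifted vector x, and pure contractivity makes the maps e0 and s0 have
    total range. *)
Theorem char_fun_dilation (MZ : 'I_n -> H2f R n -> H2f R n) : (forall i, bounded_op (MZ i)) ->
  multi_analytic MZ (fun y => P (Psi y)) -> opnorm (fun y => P (Psi y)) <= 1 ->
  exists2 ThT : F (subsp (clrange (defS A))) -> F (subsp (clrange (defT A))),
    [/\ multi_analytic MZ ThT, opnorm ThT <= 1 &
      forall y, capprox A r (tensop idfun (@subsp_val _ _ _) y) @[r --> 1^'-]
        --> (tensop idfun (@subsp_val _ _ _) (ThT y) : F H)] &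
    coincide (fun y => P (Psi y)) ThT.
Proof.
move=> bM ma ct; have ThS j y : P (Psi (fshift j y)) = fshift j (P (Psi y)) by rewrite PsiS PW.
exact: (char_fun_factorization bM ma ct ThS cA bo_e0 bo_s0 e0T s0S te0 ts0 Th_nil Th_cons).
Qed.

End dilation.

(** * The characteristic function of the model *)

Section model_char_fun.
Context (R : realType) (n : nat) (f : 'I_n -> fps R n) (g : 'I_n -> H2f R n).
Context (MZ : 'I_n -> H2f R n -> H2f R n).
Context (um : universal_model f g MZ) (hb : bounded_eval f MZ).
Context (E Es : hilbertType R) (Theta : H2t n Es -> H2t n E).
Context (ma : multi_analytic MZ Theta) (ct : opnorm Theta <= 1).
Local Notation Dsp := (Delta_space Theta).
Local Notation Delta := (Delta_Theta Theta).
Local Notation toD := (to_clrange Delta).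
Local Notation Hm := (model_space Theta).
Local Notation Amb := (model_ambient Theta).
Local Notation J := (@subsp_val R Amb (orthoc (@model_graph R n E Es Theta))).
Context (pc : purely_contractive Theta).
Context (hcl : closure (range Delta) = closure (Delta @`
  (cspan (\bigcup_i range (tensop (Mshift i) (idfun : Es -> Es))) : set (H2t n Es)))).
Context (V : 'I_n -> Dsp -> Dsp) (iV : row_isom V).
Context (VE : forall i y, V i (toD y) = toD (fshift i y)).

Let bT : bounded_op Theta := ma.1.
Let bD : bounded_op Delta := bo_Delta ma ct.
Let btoD : bounded_op toD := bo_toD ma ct.
Let bV i : bounded_op (V i) := iV.1 i.
Let bM i : bounded_op (MZ i). Proof. by case: um => aM _ _; case: (aM i). Qed.
Let ThS j y : Theta (fshift j y) = fshift j (Theta y) := multi_analytic_shift um hb ma j y.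

(** The closure hypothesis says that the row isometry V has total range. *)
Lemma V_coisom (w : Dsp) : \sum_i sqnorm (adj (V i) w) = sqnorm w.
Proof.
have V0 v : (forall i, adj (V i) v = 0) -> v = 0.
  move=> hv; pose S := orthoc [set subsp_val v].
  have SE x : (S : set (H2t n Es)) x = (inner x (subsp_val v) = 0).
    by rewrite orthocE; apply/propext; split=> [|h _ ->//]; exact.
  have sub : Delta @` (cspan (\bigcup_i range (tensop (Mshift i) (idfun : Es -> Es))) : set _)
      `<=` (S : set (H2t n Es)).
    move=> _ [x Cx <-]; rewrite SE -[LHS]/(inner (toD x) v) innerC (adjEr _ _ btoD).
    have : (orthoc [set adj toD v] : set (H2t n Es)) x.
      apply: Cx => _ [i _ [u _ <-]]; rewrite orthocE => _ ->.
      by rewrite -(adjE _ _ btoD) -VE (adjE _ _ (bV i)) hv inner0r.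
    by rewrite orthocE innerC => ->//; rewrite !conjC0.
  apply: total_toD => _ [x _ <-]; rewrite innerC.
  have : closure (range Delta) (Delta x) by apply: subset_closure; exists x.
  rewrite hcl => /(closure_subset sub).
  rewrite -((closure_id _).1 (@csubspace_closed _ _ S)) SE => h.
  by rewrite -[inner (toD x) v]/(inner (Delta x) (subsp_val v)) h conjC0.
have /eqP : w - \sum_i V i (adj (V i) w) = 0.
  apply: V0 => i; rewrite (boB _ _ (bo_adj (bV i))) (bo_sum _ _ _ (bo_adj (bV i))).
  rewrite (sum_fin1 (j := i)) => [|j ji]; first by rewrite iV.2 eqxx subrr.
  by rewrite iV.2 eq_sym (negbTE ji).
by rewrite subr_eq0 => /eqP {2}->; rewrite (row_isom_sum _ iV).
Qed.

(** The dilation: Psi parametrises the graph of Theta and P is the first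
    projection, so that [P Psi] is Theta. *)
Let Psi (y : H2t n Es) : Amb := (Theta y, toD y).
Let W (i : 'I_n) (z : Amb) : Amb := (fshift i z.1, V i z.2).
Let P (z : Amb) : H2t n E := z.1.

Let bPsi : bounded_op Psi. Proof. exact: (bo_pair bT btoD). Qed.
Let bP : bounded_op P. Proof. exact: (bo_fst (H2t n E) Dsp). Qed.

Let iPsi y : sqnorm (Psi y) = sqnorm y.
Proof.
rewrite (@sqnorm_hsum R (H2t n E) Dsp) /=.
by rewrite [X in _ + X](_ : _ = sqnorm (Delta y))// (sqnorm_Delta ma ct) addrC subrK.
Qed.

Let bW i : bounded_op (W i).
Proof.
exact: (bo_pair (bo_comp (bo_fst _ _) (bo_fshift _ i)) (bo_comp (bo_snd _ _) (bV i))).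
Qed.

Let adjW i : adj (W i) = Wadj V i.
Proof.
apply: (adj_unique (bW i)) => x z.
rewrite !(@inner_hsum R (H2t n E) Dsp) /= -(adj_fshift) -(adjE _ _ (bo_fshift _ i)).
by rewrite -(adjE _ _ (bV i)).
Qed.

Let iW : row_isom W.
Proof.
split=> // i j z; rewrite adjW /Wadj /= bshift_fshift iV.2.
by case: eqP => // _; case: z.
Qed.

Let adjP x : adj P x = (x, 0) :> Amb.
Proof.
suff -> : adj P = (fun x => (x, 0) : Amb) by [].
apply: (adj_unique bP) => z y.
by rewrite (@inner_hsum R (H2t n E) Dsp) /= inner0r addr0.
Qed.

Let split_K z : (forall v : Hm, inner z (J v) = 0) -> z = Psi (adj Psi z).
Proof.
move=> hz; pose p := z - Psi (adj Psi z).
have Gp : (orthoc (@model_graph R n E Es Theta) : set Amb) p.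
  rewrite orthocE => _ [y _ <-]; rewrite -[(_, _)]/(Psi y) (adjEr _ _ bPsi).
  by rewrite /p (boB _ _ (bo_adj bPsi)) (isometry_adjK bPsi) ?subrr ?inner0l// => x; rewrite /rn iPsi.
apply/eqP; rewrite -subr_eq0; apply/eqP/inner_eq0; rewrite -/p {1}/p innerBl.
rewrite -(subsp_proj Gp) hz.
have := model_orth (adj J p) (adj Psi z).
rewrite -(@inner_hsum R (H2t n E) Dsp _ (Psi _)) innerC => /(congr1 Num.conj).
by rewrite conjCK conjC0 => ->; rewrite subrr.
Qed.

Let cuntz z : sqnorm z = sqnorm ((P z : l2 _ _) [::]) + \sum_i sqnorm (adj (W i) z).
Proof.
rewrite (@sqnorm_hsum R (H2t n E) Dsp) -V_coisom (fock_decomp z.1) -addrA; congr (_ + _).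
rewrite -big_split /=; apply: eq_bigr => i _.
by rewrite adjW (@sqnorm_hsum R (H2t n E) Dsp).
Qed.

(** The model space is the complement of the range of Psi, and [V_coisom]
    provides the Cuntz condition. *)
Theorem model_char_fun :
  exists2 ThT : H2t n (subsp (clrange (defS (modelA V)))) -> H2t n (subsp (clrange (defT (modelA V)))),
    [/\ multi_analytic MZ ThT, opnorm ThT <= 1 &
      forall y, capprox (modelA V) r (tensop idfun (@subsp_val _ _ _) y) @[r --> 1^'-]
        --> (tensop idfun (@subsp_val _ _ _) (ThT y) : H2t n Hm)] &
    coincide Theta ThT.
Proof.
have cA := modelA_contr um hb ma iV VE.
have JPsi (h : Hm) y : inner (J h) (Psi y) = 0 by exact: model_orth.
have PsiS i y : Psi (fshift i y) = W i (Psi y) by rewrite /W /Psi /= VE ThS.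
have JA i h : J (adj (modelA V i) h) = adj (W i) (J h).
  by rewrite (adj_modelA iV) (J_modelC um hb ma iV VE) adjW.
have PWadj i z : P (adj (W i) z) = bshift i (P z) by rewrite adjW.
have PK x : P (adj P x) = x by rewrite adjP.
exact: (char_fun_dilation cA (bo_subsp_val _) (fun=> erefl) bPsi iPsi iW bP
  JPsi split_K PsiS JA (fun _ _ => erefl) PWadj PK cuntz pc bM ma ct).
Qed.

End model_char_fun.

Theorem theorem2p5 (R : realType) (n : nat)
    (f : 'I_n -> fps R n) (g : 'I_n -> H2f R n) (MZ : 'I_n -> H2f R n -> H2f R n)
    (hf : class_Mb f g MZ)
    (E Es : hilbertType R) (Theta : H2t n Es -> H2t n E)
    (Theta_ma : multi_analytic MZ Theta) (Theta_contr : opnorm Theta <= 1) :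
  (exists D : 'I_n -> Delta_space Theta -> Delta_space Theta,
     is_model_D MZ D /\
     exists T : 'I_n -> model_space Theta -> model_space Theta, is_model_tuple MZ D T) /\
  forall (D : 'I_n -> Delta_space Theta -> Delta_space Theta)
         (T : 'I_n -> model_space Theta -> model_space Theta),
    is_model_D MZ D -> is_model_tuple MZ D T ->
    in_domain_cnc f g T /\
    (purely_contractive Theta ->
     closure (range (Delta_Theta Theta)) =
       closure (Delta_Theta Theta @`
         (cspan (\bigcup_i range (tensop (Mshift i) (idfun : Es -> Es))) : set (H2t n Es))) ->
     exists2 ThT : H2t n (defect_star f T) -> H2t n (defect f T),
       is_char_fun MZ f T ThT & coincide Theta ThT).
Proof.
have um := model_universal hf.1; have hb := class_Mb_bounded um hf.
have [V [iV VE]] := V_ex um hb Theta_ma Theta_contr.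
split=> [|D T mD mT].
  have [D mD] := model_D_ex um hb Theta_ma Theta_contr.
  by exists D; split=> //; exact: (model_T_ex um hb Theta_ma Theta_contr iV VE mD).
split=> [|pc hcl].
  exact: (model_in_domain_cnc um hb Theta_ma Theta_contr iV VE mD mT).
have := model_char_fun um hb Theta_ma Theta_contr pc hcl iV VE.
by rewrite -(model_fval um hb Theta_ma Theta_contr iV VE mD mT).
Qed.
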